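(* Let $\{\Phi_k\}\cup\{\psi^h_{j,\ell,k}\}\cup\{\psi^v_{j,\ell,k}\}\cup\{\psi_{j,\ell,k}\}$ be the smooth Parseval frame of shearlets described in the context. Then the composition of the analysis and synthesis operators is the identity on $\mathcal{S}'(\mathbb{R}^2)$: for every $f\in\mathcal{S}'$, $$f=\sum_{k\in\mathbb{Z}^2}\langle f,\Phi_k\rangle\Phi_k+\sum_{\mathfrak d\in\{h,v\}}\sum_{j\ge0}\sum_{|\ell|<2^j}\sum_{k\in\mathbb{Z}^2}\langle f,\psi^{\mathfrak d}_{j,\ell,k}\rangle\psi^{\mathfrak d}_{j,\ell,k}+\sum_{j\ge0}\sum_{\ell=\pm2^j}\sum_{k\in\mathbb{Z}^2}\langle f,\psi_{j,\ell,k}\rangle\psi_{j,\ell,k},$$ with convergence in $\mathcal{S}'$.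
   Context: Points $x\in\mathbb{R}^2$ are columns, $\xi=(\xi_1,\xi_2)\in\hat{\mathbb{R}}^2$ are rows, $\hat f(\xi)=\int f(x)e^{-2\pi i\xi x}dx$ and $f\mapsto f^\wedge$ also denotes the Fourier transform. $\langle f,g\rangle$ is the pairing that is conjugate-linear in $g\in\mathcal{S}$, i.e. $\langle f,g\rangle=\int f\overline g$ when $f$ is a function. Let $A_h=\begin{pmatrix}4&0\\0&2\end{pmatrix}$, $B_h=\begin{pmatrix}1&1\\0&1\end{pmatrix}$, $A_v=\begin{pmatrix}2&0\\0&4\end{pmatrix}$, $B_v=\begin{pmatrix}1&0\\1&1\end{pmatrix}$. Let $\phi$ be a univariate function with $\hat\phi\in C^\infty(\mathbb{R})$, $0\le\hat\phi\le1$, $\hat\phi=1$ on $[-\frac1{16},\frac1{16}]$ and $\hat\phi=0$ outside $[-\frac18,\frac18]$. Put $\hat\Phi(\xi)=\hat\phi(\xi_1)\hat\phi(\xi_2)$ and $W^2(\xi)=\hat\Phi^2(2^{-2}\xi)-\hat\Phi^2(\xi)$, with $W\in C^\infty(\hat{\mathbb{R}}^2)$ real-valued; then $\hat\Phi^2(\xi)+\sum_{j\ge0}W^2(2^{-2j}\xi)=1$ for all $\xi$. Let $v\in C^\infty(\mathbb{R})$ be real-valued with $v(0)=1$, $v^{(n)}(0)=0$ for all $n\ge1$, $\mathrm{supp}\,v\subset[-1,1]$ and $|v(u-1)|^2+|v(u)|^2+|v(u+1)|^2=1$ for $|u|\le1$. Let $\mathcal{D}^h=\{\xi:|\xi_2|\le|\xi_1|,\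 \xi_1\ne0\}$ and $\mathcal{D}^v=\{\xi:|\xi_1|\le|\xi_2|,\ \xi_2\neq0\}$. The elements of the system are defined by their Fourier transforms: (i) Coarse functions: $\Phi_k(x)=\Phi(x-k)$, $k\in\mathbb{Z}^2$. (ii) Interior shearlets, for $j\ge0$, $|\ell|<2^j$, $k\in\mathbb{Z}^2$: $(\psi^h_{j,\ell,k})^\wedge(\xi)=2^{-3j/2}W(2^{-2j}\xi)\,v(2^j\tfrac{\xi_2}{\xi_1}-\ell)\,e^{-2\pi i\xi A_h^{-j}B_h^{-\ell}k}$ on $\mathcal{D}^h$ and $0$ elsewhere; $(\psi^v_{j,\ell,k})^\wedge(\xi)=2^{-3j/2}W(2^{-2j}\xi)\,v(2^j\tfrac{\xi_1}{\xi_2}-\ell)\,e^{-2\pi i\xi A_v^{-j}B_v^{-\ell}k}$ on $\mathcal{D}^v$ and $0$ elsewhere. (iii) Boundary shearlets, for $j\ge1$, $\ell=\pm2^j$, $k\in\mathbb{Z}^2$: $(\psi_{j,\ell,k})^\wedge(\xi)=2^{-3j/2-1}W(2^{-2j}\xi)\,\omega_{j,\ell}(\xi)\,e^{-2\pi i\xi 2^{-1}A_h^{-j}B_h^{-\ell}k}$, and for $j=0$, $\ell=\pm1$: $(\psi_{0,\ell,k})^\wedge(\xi)=W(\xi)\,\omega_{0,\ell}(\xi)\,e^{-2\pi i\xi k}$, where $\omega_{j,\ell}(\xi)=v(2^j\frac{\xi_2}{\xi_1}-\ell)$ for $\xi\in\mathcal{D}^h$ and $\omega_{j,\ell}(\xi)=v(2^j\frac{\xi_1}{\xi_2}-\ell)$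 for $\xi\in\mathcal{D}^v$. All these functions lie in $\mathcal{S}$, and the system is a Parseval frame of $L^2(\mathbb{R}^2)$; on the Fourier side this corresponds to $$|\hat\Phi(\xi)|^2+\sum_{j\ge0}W^2(2^{-2j}\xi)\Big[\sum_{|\ell|<2^j}\big(|v(2^j\tfrac{\xi_2}{\xi_1}-\ell)|^2\chi_{\mathcal{D}^h}(\xi)+|v(2^j\tfrac{\xi_1}{\xi_2}-\ell)|^2\chi_{\mathcal{D}^v}(\xi)\big)+\sum_{\ell=\pm2^j}|\omega_{j,\ell}(\xi)|^2\Big]=1.$$ *)

(* Defs.v *)
From HB Require Import structures.
From mathcomp Require Import all_boot all_order all_algebra finmap complex.
From mathcomp Require Import all_classical all_reals all_analysis.
From mathcomp.analysis.showcase Require Export summability.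

Set Implicit Arguments.
Unset Strict Implicit.
Unset Printing Implicit Defensive.

Import Order.TTheory GRing.Theory Num.Theory.
Import numFieldNormedType.Exports.

Local Open Scope classical_set_scope.
Local Open Scope ring_scope.
Local Open Scope complex_scope.

Section Smooth.
Context {R : realType}.
Implicit Types (x : R * R) (s : seq 'I_2).

Definition smooth1 (f : R -> R) : Prop :=
  forall n t, derivable (derive1n n f) t 1.

Definition axis (i : 'I_2) : R * R := ((i == 0)%:R, (i == 1)%:R).

Definition pderiv (i : 'I_2) (f : R * R -> R) : R * R -> R :=
  fun x => 'D_(axis i) f x.

(* Iterated partial derivatives along a word; the last letter acts first. *)
Definition pderivs s (f : R * R -> R) : R * R -> R := foldr pderiv f s.

Definition smooth2 (f : R * R -> R) : Prop :=
  forall s, continuous (pderivs s f) /\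
    forall i x, derivable (pderivs s f) x (axis i).

End Smooth.

Section Schwartz.
Context {R : realType}.
Local Notation C := (R[i]).
Implicit Types (g h : R * R -> C) (a b : nat * nat) (x xi : R * R).

Definition re g : R * R -> R := fun x => complex.Re (g x).
Definition im g : R * R -> R := fun x => complex.Im (g x).

Definition cderiv b g : R * R -> C := fun x =>
  let s := nseq b.1 (0 : 'I_2) ++ nseq b.2 (1 : 'I_2) in
  pderivs s (re g) x +i* pderivs s (im g) x.

Definition seminorm a b g : \bar R :=
  ereal_sup [set (`|x.1 ^+ a.1 * x.2 ^+ a.2| * Normc.normc (cderiv b g x))%:E
            | x in [set: R * R]].

Definition schwartz g : Prop :=
  [/\ smooth2 (re g), smooth2 (im g) &
      forall a b, (seminorm a b g < +oo)%E].

Definition bounded_index (N : nat) a : bool := (a.1 <= N)%N && (a.2 <= N)%N.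

(* A distribution is a functional on all functions [R * R -> R[i]], of which
   only the values on Schwartz functions are meaningful.  Continuity is
   continuity at each point for the topology generated by the seminorms. *)
Record tempered (T : (R * R -> C) -> C) : Prop := {
  tempered_linear : forall (c : C) g h, schwartz g -> schwartz h ->
    T (fun x => c * g x + h x) = c * T g + T h;
  tempered_continuous : forall g, schwartz g ->
    forall e : R, 0 < e -> exists N : nat, exists2 d : R, 0 < d &
      forall h, schwartz h ->
        (forall a b, bounded_index N a -> bounded_index N b ->
           (seminorm a b (fun x => h x - g x)%R < d%:E)%E) ->
        Normc.normc (T h - T g) < e }.

Definition pairing (T : (R * R -> C) -> C) g : C := T (fun x => (g x)^*).

Definition lebesgue2 : set (measurableTypeR R * measurableTypeR R) -> \bar R :=
  (@lebesgue_measure R \x @lebesgue_measure R)%E.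

Definition cintegral (g : R * R -> C) : C :=
  Rintegral lebesgue2 setT (re g) +i* Rintegral lebesgue2 setT (im g).

(* The distribution attached to a function, so that
   [pairing (regular h) g] is the integral of [h] times the conjugate
   of [g]. *)
Definition regular h : (R * R -> C) -> C :=
  fun g => cintegral (fun x => h x * g x).

(* The space of tempered distributions carries its weak-* topology. *)
Definition cvg_tempered (X : Type) (F : set_system X)
    (T : X -> (R * R -> C) -> C) (T0 : (R * R -> C) -> C) : Prop :=
  forall g, schwartz g ->
    (fun n => pairing (T n) g : C^o) @ F --> (pairing T0 g : C^o).

Definition rowv xi : 'rV[R]_2 := \row_j (if j == 0 then xi.1 else xi.2).
Definition colv x : 'cV[R]_2 := \col_i (if i == 0 then x.1 else x.2).

(* Frequencies are read as rows and points as columns. *)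
Definition phase xi (M : 'M[R]_2) x : R := (rowv xi *m M *m colv x) 0 0.

Definition expi (t : R) : C := cos t +i* sin t.

Definition fourier g : R * R -> C := fun xi =>
  cintegral (fun x => g x * expi (- (2 * pi * phase xi 1 x))).

Definition schwartz_with_fourier g (ghat : R * R -> C) : Prop :=
  schwartz g /\ forall xi, fourier g xi = ghat xi.

End Schwartz.

Section Shearlets.
Context {R : realType}.
Local Notation C := (R[i]).
Implicit Types (phihat v : R -> R) (W : R * R -> R) (xi : R * R).
Implicit Types (j : nat) (l : int) (k : int * int).

(* [phihat] is the Fourier transform of the univariate function [phi], which
   enters only through it. *)
Record coarse_window phihat : Prop := {
  coarse_smooth : smooth1 phihat;
  coarse_range : forall t, 0 <= phihat t <= 1;
  coarse_one : forall t : R, t \in `[- (1 / 16), 1 / 16] -> phihat t = 1;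
  coarse_zero : forall t : R, t \notin `[- (1 / 8), 1 / 8] -> phihat t = 0 }.

Definition Phihat phihat xi : R := phihat xi.1 * phihat xi.2.

Record radial_window phihat W : Prop := {
  radial_smooth : smooth2 W;
  radial_sqr : forall xi, W xi ^+ 2 =
    Phihat phihat ((2 ^- 2 : R) *: xi) ^+ 2 - Phihat phihat xi ^+ 2 }.

Record angular_window v : Prop := {
  angular_smooth : smooth1 v;
  angular_one : v 0 = 1;
  angular_flat : forall n, (1 <= n)%N -> derive1n n v 0 = 0;
  angular_supp : closure [set u | v u != 0] `<=` `[-1, 1];
  angular_sqr : forall u : R, `|u| <= 1 ->
    `|v (u - 1)| ^+ 2 + `|v u| ^+ 2 + `|v (u + 1)| ^+ 2 = 1 }.

Definition mx2 (a b c d : R) : 'M[R]_2 :=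
  \matrix_(i < 2, j < 2) nth 0 (nth [::] [:: [:: a; b]; [:: c; d]] i) j.

Definition A_h := mx2 4 0
                      0 2.
Definition B_h := mx2 1 1
                      0 1.
Definition A_v := mx2 2 0
                      0 4.
Definition B_v := mx2 1 0
                      1 1.

Definition D_h xi : bool := (`|xi.2| <= `|xi.1|) && (xi.1 != 0).
Definition D_v xi : bool := (`|xi.1| <= `|xi.2|) && (xi.2 != 0).

Definition zvec k : R * R := (k.1%:~R, k.2%:~R).

(* [exp (- 2 pi i xi M k)] *)
Definition modulation (M : 'M[R]_2) k xi : C :=
  expi (- (2 * pi * phase xi M (zvec k))).

Definition psi_h_hat W v j l k xi : C :=
  if D_h xi then
    (2 `^ (- (3 * j%:R / 2)) * W ((2 ^- (2 * j) : R) *: xi)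
       * v (2 ^+ j * (xi.2 / xi.1) - l%:~R))%:C
    * modulation (A_h ^- j *m B_h ^ (- l)) k xi
  else 0.

Definition psi_v_hat W v j l k xi : C :=
  if D_v xi then
    (2 `^ (- (3 * j%:R / 2)) * W ((2 ^- (2 * j) : R) *: xi)
       * v (2 ^+ j * (xi.1 / xi.2) - l%:~R))%:C
    * modulation (A_v ^- j *m B_v ^ (- l)) k xi
  else 0.

(* Where [D_h] and [D_v] overlap, [xi.2 / xi.1 = xi.1 / xi.2]; the last case is
   the origin, where [W] vanishes. *)
Definition omega v j l xi : R :=
  if D_h xi then v (2 ^+ j * (xi.2 / xi.1) - l%:~R)
  else if D_v xi then v (2 ^+ j * (xi.1 / xi.2) - l%:~R)
  else 0.

Definition psi_b_hat W v j l k xi : C :=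
  if j == 0 then
    (W xi * omega v 0 l xi)%:C * modulation 1 k xi
  else
    (2 `^ (- (3 * j%:R / 2) - 1) * W ((2 ^- (2 * j) : R) *: xi)
       * omega v j l xi)%:C
    * modulation (2^-1 *: (A_h ^- j *m B_h ^ (- l))) k xi.

(* The elements are the Schwartz functions with the prescribed Fourier
   transforms; only [|l| < 2 ^ j] (interior) and [|l| = 2 ^ j] (boundary) are
   meaningful. *)
Record shearlet_system phihat W v (Phi : R * R -> C)
    (psi_h psi_v psi_b : nat -> int -> int * int -> R * R -> C) : Prop := {
  shearlet_coarse :
    schwartz_with_fourier Phi (fun xi => (Phihat phihat xi)%:C);
  shearlet_h : forall j l k, `|l| < 2 ^+ j ->
    schwartz_with_fourier (psi_h j l k) (psi_h_hat W v j l k);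
  shearlet_v : forall j l k, `|l| < 2 ^+ j ->
    schwartz_with_fourier (psi_v j l k) (psi_v_hat W v j l k);
  shearlet_b : forall j l k, `|l| = 2 ^+ j ->
    schwartz_with_fourier (psi_b j l k) (psi_b_hat W v j l k) }.

Definition translate (Phi : R * R -> C) k : R * R -> C :=
  fun x => Phi (x - zvec k).

End Shearlets.

Definition interior_index : Type := {p : nat * int | `|p.2| < 2 ^+ p.1}.
Definition boundary_index : Type := {p : nat * int | `|p.2| == 2 ^+ p.1}.
HB.instance Definition _ := Choice.on interior_index.
HB.instance Definition _ := Choice.on boundary_index.

(* Coarse, horizontal, vertical and boundary elements, in this order. *)
Definition shearlet_index : Type :=
  ((int * int) + interior_index * (int * int) + interior_index * (int * int)
   + boundary_index * (int * int))%type.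
HB.instance Definition _ := Choice.on shearlet_index.

Definition shearlet_family {R : realType} (Phi : R * R -> R[i])
    (psi_h psi_v psi_b : nat -> int -> int * int -> R * R -> R[i])
    (i : shearlet_index) : R * R -> R[i] :=
  match i with
  | inl (inl (inl k)) => translate Phi k
  | inl (inl (inr (p, k))) => psi_h (val p).1 (val p).2 k
  | inl (inr (p, k)) => psi_v (val p).1 (val p).2 k
  | inr (p, k) => psi_b (val p).1 (val p).2 k
  end.

(* Taken along the filter [totally], these partial sums give the unordered sum
   of the frame expansion of [T]. *)
Definition frame_sum {R : realType} (I : choiceType)
    (e : I -> R * R -> R[i]) (T : (R * R -> R[i]) -> R[i])
    (A : {fset I}) : R * R -> R[i] :=
  fun x => \sum_(i <- A) pairing T (e i) * e i x.

(* Main.v *)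
(* On the Fourier side the elements of one scale and direction are a window [w]
   times the characters of a lattice, and [w] lives in a fundamental cell of the
   dual lattice.  Hence Fourier series (in Fejer means) give, for a Schwartz
   function [g], that the sum of [<g, e> e] over such a family has Fourier
   transform [w ^ 2] times that of [g].  Summing over the directions at the scales
   below [J], the squares of the windows telescope to [Phihat ^ 2] dilated by
   [2 ^ (2 J)], which tends to 1.

   The expansion of [g] converges absolutely for every Schwartz seminorm.  Indeed
   a coefficient is smaller than any power of the scale, because the Fourier
   transform of [g] is rapidly decreasing on the support of [w], and than any
   power of the position, because [g] and [e] are; whereas the seminorms of [e]
   grow only polynomially in both, because so do the derivatives of [w].  Thus the
   unordered expansion of [g] holds in the Schwartz space, and the theorem is its
   transpose. *)

Require Import Defs.
From HB Require Import structures.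
From mathcomp Require Import all_boot all_order all_algebra finmap complex.
From mathcomp Require Import all_classical all_reals all_analysis.
From mathcomp Require Import measurable_realfun ring lra zify.

Set Implicit Arguments.
Unset Strict Implicit.
Unset Printing Implicit Defensive.

Import Order.TTheory GRing.Theory Num.Theory.
Import numFieldNormedType.Exports.

Local Open Scope classical_set_scope.
Local Open Scope ring_scope.
Local Open Scope complex_scope.


(** * Complex-valued integrals *)

(** The main obstacle is that an element is given as a Schwartz function with a prescribed
    transform, while the formula for its window can be differentiated directly only off the
    diagonals. The transform of a Schwartz function is smooth in any case; its derivatives are
    therefore taken along coordinate lines, where off the diagonals they are those of the formula,
    and the bounds are carried by continuity across the two points at which a line meets the
    diagonals. They are polynomial in [2 ^ j], uniformly in the direction.

    Every limit rests on an explicit majorant, usually a multiple of [rho]. It is integrable, almost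
    invariant under bounded translations, and a rescaled Poisson kernel, which suggests Abel means
    for the inversion formula.

    Fejer means are averages of sums over translated boxes. Most of these boxes contain a given
    finite set of indices, so absolute summability identifies the limit of the means with the
    unordered sum. The windows lie strictly inside a cell, so after recentring at a point of the
    support the kernel meets no lattice point except 0, and a Lipschitz bound is enough for
    convergence. *)

Section ComplexNorm.
Context {R : realType}.
Local Notation C := (R[i]).
Local Notation normc := (@Normc.normc R).

Lemma normcE (z : C) : normc z = Num.sqrt (complex.Re z ^+ 2 + complex.Im z ^+ 2).
Proof. by case: z. Qed.

Lemma normc_ge0 (z : C) : 0 <= normc z.
Proof. by rewrite normcE sqrtr_ge0. Qed.

Lemma normcB (z w : C) : normc (z - w) <= normc z + normc w.
Proof. by rewrite (le_trans (le_normcD _ _))// normcN. Qed.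

Lemma normcBC (z w : C) : normc (z - w) = normc (w - z).
Proof. by rewrite -opprB normcN. Qed.

Lemma normc_Re (z : C) : `|complex.Re z| <= normc z.
Proof.
by rewrite normcE -sqrtr_sqr ler_sqrt ?addr_ge0 ?sqr_ge0// lerDl sqr_ge0.
Qed.

Lemma normc_Im (z : C) : `|complex.Im z| <= normc z.
Proof.
by rewrite normcE -sqrtr_sqr ler_sqrt ?addr_ge0 ?sqr_ge0// lerDr sqr_ge0.
Qed.

Lemma normc_real (a : R) : normc a%:C = `|a|.
Proof. by rewrite normcE /= expr0n addr0 sqrtr_sqr. Qed.

Lemma normc_le (z : C) : normc z <= `|complex.Re z| + `|complex.Im z|.
Proof.
rewrite normcE -[leRHS]ger0_norm ?addr_ge0// -sqrtr_sqr ler_sqrt ?sqr_ge0//.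
rewrite sqrrD !real_normK ?num_real// lerD2r lerDl mulrn_wge0// mulr_ge0.
Qed.

Lemma normc_eq0 (z : C) : (normc z == 0) = (z == 0).
Proof.
by apply/eqP/eqP => [/Normc.eq0_normc//|->]; rewrite Normc.normc0.
Qed.

Lemma normc_conj (z : C) : normc z^* = normc z.
Proof. by rewrite !normcE; case: z => a b /=; rewrite sqrrN. Qed.

Lemma normc_sum (I : Type) (s : seq I) (P : pred I) (F : I -> C) :
  normc (\sum_(i <- s | P i) F i) <= \sum_(i <- s | P i) normc (F i).
Proof.
elim/big_ind2 : _ => //; first by rewrite Normc.normc0.
by move=> x a y b xa yb; rewrite (le_trans (le_normcD _ _))// lerD.
Qed.

Lemma normcX (z : C) n : normc (z ^+ n) = normc z ^+ n.
Proof.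
by elim: n => [|n IH]; rewrite ?expr0 ?Normc.normc1// !exprS Normc.normcM IH.
Qed.

Lemma expiD (a b : R) : expi (a + b) = expi a * expi b.
Proof. by rewrite /expi cosD sinD; apply/eqP; rewrite eq_complex /= eqxx /= [X in X == _]addrC. Qed.

Lemma expi0 : expi (0 : R) = 1.
Proof. by rewrite /expi cos0 sin0. Qed.

Lemma expi_conj (a : R) : (expi a)^* = expi (- a).
Proof. by rewrite /expi cosN sinN. Qed.

Lemma normc_expi (a : R) : normc (expi a) = 1.
Proof. by rewrite normcE /= cos2Dsin2 sqrtr1. Qed.

Lemma complex_eq (z w : C) : complex.Re z = complex.Re w ->
  complex.Im z = complex.Im w -> z = w.
Proof. by case: z w => [a b] [c d] /= -> ->. Qed.

Lemma ReMc (z w : C) : complex.Re (z * w) =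
  complex.Re z * complex.Re w - complex.Im z * complex.Im w.
Proof. by case: z w => [a b] [c d]. Qed.

Lemma ImMc (z w : C) : complex.Im (z * w) =
  complex.Re z * complex.Im w + complex.Im z * complex.Re w.
Proof. by case: z w => [a b] [c d]. Qed.

Lemma ReDc (z w : C) : complex.Re (z + w) = complex.Re z + complex.Re w.
Proof. by case: z w => [a b] [c d]. Qed.

Lemma ImDc (z w : C) : complex.Im (z + w) = complex.Im z + complex.Im w.
Proof. by case: z w => [a b] [c d]. Qed.

Lemma ReNc (z : C) : complex.Re (- z) = - complex.Re z.
Proof. by case: z. Qed.

Lemma ImNc (z : C) : complex.Im (- z) = - complex.Im z.
Proof. by case: z. Qed.

Lemma ReJc (z : C) : complex.Re (z^*) = complex.Re z.
Proof. by case: z. Qed.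

Lemma ImJc (z : C) : complex.Im (z^*) = - complex.Im z.
Proof. by case: z. Qed.

Lemma Rec_sum (I : Type) (s : seq I) (F : I -> C) :
  complex.Re (\sum_(i <- s) F i) = \sum_(i <- s) complex.Re (F i).
Proof. by elim/big_rec2 : _ => // i a b _ <-; rewrite ReDc. Qed.

End ComplexNorm.

Section ComplexIntegral.
Context {R : realType} d (T : measurableType d).
Variable mu : {measure set T -> \bar R}.
Local Notation C := (R[i]).
Local Notation normc := (@Normc.normc R).
Implicit Types (g h : T -> C) (b : T -> R).

Definition cmeas g := measurable_fun setT (fun x => complex.Re (g x)) /\
  measurable_fun setT (fun x => complex.Im (g x)).

Definition cint g : C :=
  Rintegral mu setT (fun x => complex.Re (g x)) +i*
  Rintegral mu setT (fun x => complex.Im (g x)).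

Definition cintble g := mu.-integrable setT (fun x => (complex.Re (g x))%:E) /\
  mu.-integrable setT (fun x => (complex.Im (g x))%:E).

Lemma cintble_cmeas g : cintble g -> cmeas g.
Proof.
by case=> /measurable_int /measurable_EFinP ? /measurable_int /measurable_EFinP.
Qed.

Lemma cmeasD g h : cmeas g -> cmeas h -> cmeas (fun x => g x + h x).
Proof.
move=> [g1 g2] [h1 h2]; split.
  by under eq_fun do rewrite ReDc; apply: measurable_funD.
by under eq_fun do rewrite ImDc; apply: measurable_funD.
Qed.

Lemma cmeasM g h : cmeas g -> cmeas h -> cmeas (fun x => g x * h x).
Proof.
move=> [g1 g2] [h1 h2]; split.
  by under eq_fun do rewrite ReMc; apply: measurable_funB; apply: measurable_funM.
by under eq_fun do rewrite ImMc; apply: measurable_funD; apply: measurable_funM.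
Qed.

Lemma cmeasN g : cmeas g -> cmeas (fun x => - g x).
Proof.
move=> [g1 g2]; split.
  by under eq_fun do rewrite ReNc; apply: measurableT_comp.
by under eq_fun do rewrite ImNc; apply: measurableT_comp.
Qed.

Lemma cmeas_conj g : cmeas g -> cmeas (fun x => (g x)^*).
Proof.
move=> [g1 g2]; split.
  by under eq_fun do rewrite ReJc.
by under eq_fun do rewrite ImJc; apply: measurableT_comp.
Qed.

Lemma cmeas_cst (c : C) : cmeas (fun=> c).
Proof. by split; exact: measurable_cst. Qed.

Lemma cmeas_real b : measurable_fun setT b -> cmeas (fun x => (b x)%:C).
Proof. by move=> mb; split => //; exact: measurable_cst. Qed.

Lemma cmeas_expi b : measurable_fun setT b -> cmeas (fun x => expi (b x)).
Proof.
move=> mb; split => /=.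
  by apply: measurableT_comp => //; apply: continuous_measurable_fun; exact: continuous_cos.
by apply: measurableT_comp => //; apply: continuous_measurable_fun; exact: continuous_sin.
Qed.

Lemma cmeas_sum (I : Type) (s : seq I) (F : I -> T -> C) :
  (forall i, cmeas (F i)) -> cmeas (fun x => \sum_(i <- s) F i x).
Proof.
move=> mF; elim: s => [|i s IH].
  by under eq_fun do rewrite big_nil; exact: cmeas_cst.
by under eq_fun do rewrite big_cons; exact: cmeasD.
Qed.

Lemma le_cintble g b : mu.-integrable setT (EFin \o b) -> cmeas g ->
  (forall x, normc (g x) <= b x) -> cintble g.
Proof.
move=> ib [g1 g2] gb; split; apply: (le_integrable measurableT _ _ ib) => //=.
- exact/measurable_EFinP.
- move=> x _; rewrite lee_fin (le_trans (normc_Re _))// (le_trans (gb _))//.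
  by rewrite ler_norm.
- exact/measurable_EFinP.
- move=> x _; rewrite lee_fin (le_trans (normc_Im _))// (le_trans (gb _))//.
  by rewrite ler_norm.
Qed.

Lemma cintbleD g h : cintble g -> cintble h -> cintble (fun x => g x + h x).
Proof.
move=> [g1 g2] [h1 h2]; split.
  by under eq_fun do rewrite ReDc EFinD; apply: integrableD.
by under eq_fun do rewrite ImDc EFinD; apply: integrableD.
Qed.

Lemma cintbleZ (c : C) g : cintble g -> cintble (fun x => c * g x).
Proof.
move=> [g1 g2]; split.
  under eq_fun do rewrite ReMc EFinB !EFinM.
  by apply: integrableB => //; apply: integrableZl.
under eq_fun do rewrite ImMc EFinD !EFinM.
by apply: integrableD => //; apply: integrableZl.
Qed.

Lemma cintD g h : cintble g -> cintble h ->
  cint (fun x => g x + h x) = cint g + cint h.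
Proof.
move=> [g1 g2] [h1 h2]; apply: complex_eq; rewrite ?ReDc ?ImDc /cint /=.
  by under eq_Rintegral do rewrite ReDc; rewrite RintegralD.
by under eq_Rintegral do rewrite ImDc; rewrite RintegralD.
Qed.

Lemma cintZ (c : C) g : cintble g -> cint (fun x => c * g x) = c * cint g.
Proof.
move=> [g1 g2]; have ig r : mu.-integrable setT (EFin \o (fun x => r * complex.Re (g x))).
  exact: (integrableZl measurableT r g1).
have jg r : mu.-integrable setT (EFin \o (fun x => r * complex.Im (g x))).
  exact: (integrableZl measurableT r g2).
apply: complex_eq; rewrite ?ReMc ?ImMc /cint /=.
  by under eq_Rintegral do rewrite ReMc; rewrite RintegralB// !RintegralZl.
by under eq_Rintegral do rewrite ImMc; rewrite RintegralD// !RintegralZl.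
Qed.

Lemma cintbleN g : cintble g -> cintble (fun x => - g x).
Proof. by move=> ig; under eq_fun do rewrite -mulN1r; exact: cintbleZ. Qed.

Lemma cintN g : cintble g -> cint (fun x => - g x) = - cint g.
Proof. by move=> ig; under eq_fun do rewrite -mulN1r; rewrite cintZ// mulN1r. Qed.

Lemma cintB g h : cintble g -> cintble h ->
  cint (fun x => g x - h x) = cint g - cint h.
Proof. by move=> ig ih; rewrite cintD ?cintN//; exact: cintbleN. Qed.

Lemma cint0 : cint (fun=> 0) = 0.
Proof. by rewrite /cint /=; apply: complex_eq => /=; rewrite /Rintegral integral0. Qed.

Lemma cintble0 : cintble (fun=> 0).
Proof. by split; exact: integrable0. Qed.

Lemma cintble_sum (I : Type) (s : seq I) (F : I -> T -> C) :
  (forall i, cintble (F i)) -> cintble (fun x => \sum_(i <- s) F i x).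
Proof.
move=> mF; elim: s => [|i s IH].
  by under eq_fun do rewrite big_nil; exact: cintble0.
by under eq_fun do rewrite big_cons; exact: cintbleD.
Qed.

Lemma cint_sum (I : Type) (s : seq I) (F : I -> T -> C) :
  (forall i, cintble (F i)) ->
  cint (fun x => \sum_(i <- s) F i x) = \sum_(i <- s) cint (F i).
Proof.
move=> mF; elim: s => [|i s IH].
  by rewrite big_nil -[RHS]cint0; congr cint; apply/funext => x; rewrite big_nil.
rewrite big_cons -IH -cintD//; last exact: cintble_sum.
by congr cint; apply/funext => x; rewrite big_cons.
Qed.

Lemma cint_conj g : cintble g -> cint (fun x => (g x)^*) = (cint g)^*.
Proof.
move=> [g1 g2]; rewrite /cint; apply: complex_eq; rewrite ?ReJc ?ImJc.
  by rewrite /complex.Re; apply: eq_Rintegral => x _; case: (g x).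
rewrite [RHS]/= -mulN1r -RintegralZl//.
by rewrite [LHS]/=; apply: eq_Rintegral => x _; case: (g x) => * /=; rewrite mulN1r.
Qed.

Lemma cint_real b : cint (fun x => (b x)%:C) = (Rintegral mu setT b)%:C.
Proof. by rewrite /cint /=; apply: complex_eq => //=; rewrite /Rintegral integral0. Qed.

(* Rotating the integral onto the positive real axis makes it the integral of
   a real part. *)
Lemma normc_cint g b : cmeas g -> mu.-integrable setT (EFin \o b) ->
  (forall x, normc (g x) <= b x) -> normc (cint g) <= Rintegral mu setT b.
Proof.
move=> mg ib gb; have ig := le_cintble ib mg gb.
have [->|I0] := eqVneq (cint g) 0.
  by rewrite Normc.normc0 Rintegral_ge0// => x _; rewrite (le_trans _ (gb x))// normc_ge0.
set z := cint g; set n := normc z.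
have n0 : 0 < n by rewrite lt_def normc_eq0 I0 normc_ge0.
pose u : C := (n^-1)%:C * z^*.
have nu : normc u = 1.
  by rewrite Normc.normcM normc_real normc_conj ger0_norm ?invr_ge0 ?ltW// mulVf// gt_eqF.
have uz : complex.Re (cint (fun x => u * g x)) = n.
  rewrite cintZ// -/z /u -mulrA ReMc [complex.Re _%:C]/= [complex.Im _%:C]/=.
  rewrite mul0r subr0 ReMc ReJc ImJc mulNr opprK -!expr2.
  rewrite -[X in _ * X]sqr_sqrtr ?addr_ge0 ?sqr_ge0// -normcE -/n expr2 mulrA.
  by rewrite mulVf ?mul1r// gt_eqF.
rewrite -uz /=; apply: le_Rintegral => //.
  by case: (cintbleZ u ig).
move=> x _; rewrite (le_trans (ler_norm _))// (le_trans (normc_Re _))//.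
by rewrite Normc.normcM nu mul1r.
Qed.

(** Convergence is expressed by real norms; dominated convergence is applied to the real and
    imaginary parts, which are recombined through [normc_le]. *)
Lemma cint_dct (g_ : nat -> T -> C) g b : (forall n, cmeas (g_ n)) -> cmeas g ->
  mu.-integrable setT (EFin \o b) ->
  (forall n x, normc (g_ n x) <= b x) ->
  (forall x, normc (g_ n x - g x) @[n --> \oo] --> (0 : R)) ->
  normc (cint (g_ n) - cint g) @[n --> \oo] --> (0 : R).
Proof.
move=> mg_ mg ib gb gg.
have [mG1 mG2] : (forall n, measurable_fun setT (fun x => complex.Re (g_ n x))) /\
  forall n, measurable_fun setT (fun x => complex.Im (g_ n x)).
  by split=> n; case: (mg_ n).
have cvgRe x : complex.Re (g_ n x) @[n --> \oo] --> complex.Re (g x).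
  apply/cvgrPdist_le => e e0; have /cvgrPdist_le /(_ _ e0) := gg x.
  apply: filterS => n; rewrite sub0r normrN ger0_norm ?normc_ge0// => /(le_trans _); apply.
  by rewrite distrC -ReNc -ReDc normc_Re.
have cvgIm x : complex.Im (g_ n x) @[n --> \oo] --> complex.Im (g x).
  apply/cvgrPdist_le => e e0; have /cvgrPdist_le /(_ _ e0) := gg x.
  apply: filterS => n; rewrite sub0r normrN ger0_norm ?normc_ge0// => /(le_trans _); apply.
  by rewrite distrC -ImNc -ImDc normc_Im.
have main (f_ : nat -> T -> R) (f : T -> R) : (forall n, measurable_fun setT (f_ n)) ->
  measurable_fun setT f -> (forall n x, `|f_ n x| <= b x) ->
  (forall x, f_ n x @[n --> \oo] --> f x) ->
  Rintegral mu setT (f_ n) @[n --> \oo] --> Rintegral mu setT f.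
  move=> mf_ mf fb ff.
  have := @dominated_convergence _ _ _ mu setT measurableT
    (fun n x => (f_ n x)%:E) (EFin \o f) (EFin \o b) _ _ _ ib _.
  case.
  - by move=> n; exact/measurable_EFinP.
  - exact/measurable_EFinP.
  - by apply: aeW => x _; apply: cvg_EFin; [exact: nearW|exact: ff].
  - by apply: aeW => x n _ /=; rewrite lee_fin.
  move=> if_ _ cv; apply: fine_cvg; move: cv.
  by rewrite /Rintegral fineK//; exact: integrable_fin_num.
have c1 := main _ _ mG1 mg.1 (fun n x => le_trans (normc_Re _) (gb n x)) cvgRe.
have c2 := main _ _ mG2 mg.2 (fun n x => le_trans (normc_Im _) (gb n x)) cvgIm.
have c12 : `|Rintegral mu setT (fun x => complex.Re (g_ n x)) -
      Rintegral mu setT (fun x => complex.Re (g x))| +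
    `|Rintegral mu setT (fun x => complex.Im (g_ n x)) -
      Rintegral mu setT (fun x => complex.Im (g x))| @[n --> \oo] --> (0 : R).
  have -> : (0 : R) = 0 + 0 by rewrite addr0.
  by apply: cvgD; apply/norm_cvg0P; apply/subr_cvg0.
apply: squeeze_cvgr (cvg_cst 0) c12; apply: nearW => n.
by apply/andP; split; [exact: normc_ge0|exact: normc_le].
Qed.

End ComplexIntegral.

(** * Products, Tonelli and Fubini *)

Section ProductIntegral.
Context {R : realType} d1 d2 (T1 : measurableType d1) (T2 : measurableType d2).
Variables (m1 : {sigma_finite_measure set T1 -> \bar R})
  (m2 : {sigma_finite_measure set T2 -> \bar R}).

Lemma integrable_prod (f : T1 -> R) (g : T2 -> R) :
  m1.-integrable setT (EFin \o f) -> m2.-integrable setT (EFin \o g) ->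
  (m1 \x m2)%E.-integrable setT (fun z => (f z.1 * g z.2)%:E).
Proof.
move=> /integrableP[mf fi] /integrableP[mg gi].
have mf' : measurable_fun setT f by exact/measurable_EFinP.
have mg' : measurable_fun setT g by exact/measurable_EFinP.
apply/integrable12ltyP.
  apply/measurable_EFinP/measurable_funM.
    exact: measurableT_comp measurable_fst.
  exact: measurableT_comp measurable_snd.
under eq_integral => x _.
  under eq_integral do rewrite /= normrM EFinM.
  rewrite ge0_integralZl//.
  - over.
  - by apply/measurable_EFinP; apply: measurableT_comp.
have : (\int[m2]_x `|(g x)%:E| < +oo)%E by [].
move: gi fi; set B := integral m2 _ _ => gi fi _.
have B0 : (0 <= B)%E by apply: integral_ge0.
have Bf : B \is a fin_num by rewrite ge0_fin_numE.
under eq_integral do rewrite muleC.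
rewrite ge0_integralZl//; last by apply/measurable_EFinP; apply: measurableT_comp.
by rewrite -(fineK Bf) lte_mul_pinfty ?lee_fin ?fine_ge0.
Qed.

Lemma Rintegral_prod (f : T1 -> R) (g : T2 -> R) :
  m1.-integrable setT (EFin \o f) -> m2.-integrable setT (EFin \o g) ->
  Rintegral (m1 \x m2)%E setT (fun z => f z.1 * g z.2) =
  Rintegral m1 setT f * Rintegral m2 setT g.
Proof.
move=> fi gi; have pi := integrable_prod fi gi.
rewrite {1}/Rintegral -integral12_prod_meas1//.
have -> : (\int[m1]_x fubini_F m2 (fun z => (f z.1 * g z.2)%:E) x =
   \int[m1]_x ((Rintegral m2 setT g)%:E * (f x)%:E))%E.
  apply: eq_integral => x _; rewrite /fubini_F /=.
  under eq_integral do rewrite EFinM.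
  rewrite integralZl// muleC /Rintegral fineK//.
  exact: integrable_fin_num.
rewrite integralZl// fineM//; last exact: integrable_fin_num.
by rewrite mulrC.
Qed.

Lemma cint_prod (f : T1 -> R[i]) (g : T2 -> R[i]) : cintble m1 f ->
  cintble m2 g ->
  cint (m1 \x m2)%E (fun z => f z.1 * g z.2) = cint m1 f * cint m2 g.
Proof.
move=> [f1 f2] [g1 g2]; apply: complex_eq.
  rewrite ReMc /= -!Rintegral_prod//.
  rewrite -RintegralB//.
  - by apply: eq_Rintegral => z _; rewrite ReMc.
  - exact: integrable_prod f1 g1.
  - exact: integrable_prod f2 g2.
rewrite ImMc /= -!Rintegral_prod//.
rewrite -RintegralD//.
- by apply: eq_Rintegral => z _; rewrite ImMc.
- exact: integrable_prod f1 g2.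
- exact: integrable_prod f2 g1.
Qed.

Lemma Rintegral_Fubini (f : T1 * T2 -> R) :
  (m1 \x m2)%E.-integrable setT (EFin \o f) ->
  (forall x, m2.-integrable setT (fun y => (f (x, y))%:E)) ->
  (forall y, m1.-integrable setT (fun x => (f (x, y))%:E)) ->
  Rintegral m1 setT (fun x => Rintegral m2 setT (fun y => f (x, y))) =
  Rintegral m2 setT (fun y => Rintegral m1 setT (fun x => f (x, y))).
Proof.
move=> fi f1 f2; rewrite {1}/Rintegral [RHS]/Rintegral; congr fine.
transitivity (\int[m1]_x \int[m2]_y (EFin \o f) (x, y))%E.
  by apply: eq_integral => x _; rewrite /Rintegral fineK// integrable_fin_num.
rewrite Fubini//; apply: eq_integral => y _.
by rewrite /Rintegral fineK// integrable_fin_num.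
Qed.

(** The product bound makes every section integrable, not only almost every one, so the inner
    integrals are meaningful at every point and Fubini applies to both parts. *)
Lemma cint_Fubini (f : T1 * T2 -> R[i]) (a : T1 -> R) (b : T2 -> R) :
  @cmeas _ _ (T1 * T2)%type f ->
  m1.-integrable setT (EFin \o a) -> m2.-integrable setT (EFin \o b) ->
  (forall z, Normc.normc (f z) <= a z.1 * b z.2) ->
  cint m1 (fun x => cint m2 (fun y => f (x, y))) =
  cint m2 (fun y => cint m1 (fun x => f (x, y))).
Proof.
move=> mf ai bi fab; have abi := integrable_prod ai bi.
have [fi1 fi2] := le_cintble abi mf fab.
have mf1 x : cmeas (fun y => f (x, y)).
  by case: mf => mfR mfI; split; [apply: (measurableT_comp mfR)|apply: (measurableT_comp mfI)];
    exact: measurable_pair1.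
have mf2 y : cmeas (fun x => f (x, y)).
  by case: mf => mfR mfI; split; [apply: (measurableT_comp mfR)|apply: (measurableT_comp mfI)];
    exact: measurable_pair2.
have f1 x : cintble m2 (fun y => f (x, y)).
  apply: (@le_cintble _ _ _ _ _ (fun y => a x * b y)) => //.
  by exact: (integrableZl measurableT (a x) bi).
have f2 y : cintble m1 (fun x => f (x, y)).
  apply: (@le_cintble _ _ _ _ _ (fun x => b y * a x)) => //.
    exact: (integrableZl measurableT (b y) ai).
  by move=> x; rewrite mulrC; exact: (fab (x, y)).
apply: complex_eq => /=.
  by apply: (@Rintegral_Fubini (fun z => complex.Re (f z))) => // x; [case: (f1 x)|case: (f2 x)].
by apply: (@Rintegral_Fubini (fun z => complex.Im (f z))) => // x; [case: (f1 x)|case: (f2 x)].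
Qed.

End ProductIntegral.

(** * Lebesgue measure of the plane *)

Section Plane.
Context {R : realType}.
Local Notation C := (R[i]).
Local Notation RR := (measurableTypeR R).
Local Notation plane := (measurableTypeR R * measurableTypeR R)%type.
Local Notation l1 := (@lebesgue_measure R).
Local Notation l2 := (@lebesgue_measure R \x @lebesgue_measure R)%E.
Local Notation normc := (@Normc.normc R).

(** The plane carries the product sigma-algebra, so an open set has to be exhibited as a countable
    union of squares: those with rational centre and radius [1 / (n + 1)] that it contains. *)
Lemma open_measurable_plane (U : set (R * R)) : open U ->
  measurable (U : set plane).
Proof.
move=> oU; pose B (q : rat * rat * nat) : set plane :=
  ball (ratr q.1.1 : R) (q.2.+1%:R^-1) `*` ball (ratr q.1.2 : R) (q.2.+1%:R^-1).
have -> : U = \bigcup_q (if `[< B q `<=` U >] then B q else set0).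
  apply/seteqP; split=> [[x y] Uxy|z [q _]]; last by case: asboolP => // BU /BU.
  have /nbhs_ballP[e /= e0 eU] : nbhs (x, y) U by exact: open_nbhs_nbhs.
  have [n ne] : exists n : nat, n.+1%:R^-1 < e / 2.
    have e2 : 0 < e / 2 by rewrite divr_gt0.
    by have [n] := ltr_add_invr e2; rewrite add0r; exists n.
  have n0 : 0 < n.+1%:R^-1 :> R by rewrite invr_gt0.
  have rat_near (t : R) : exists q : rat, `|ratr q - t| < n.+1%:R^-1.
    have tn : t - n.+1%:R^-1 < t by rewrite ltrBlDr ltrDl.
    have [q] := rat_in_itvoo tn.
    rewrite in_itv /= => /andP[q1 q2]; exists q.
    by move: q1; move: n0; set d := _^-1 => *; rewrite ltr_norml; apply/andP; split; lra.
  have [[p px] [q qy]] := (rat_near x, rat_near y).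
  exists (p, q, n) => //; case: asboolP => [_|]; first by split.
  case=> -[a b] [/= pa qb]; apply: eU.
  have near_ball (s t r : R) : `|s - t| < n.+1%:R^-1 -> ball s n.+1%:R^-1 r -> ball t e r.
    rewrite -!ball_normE /= !ltr_norml; move: ne; set d := _^-1.
    by move=> ? /andP[? ?] /andP[? ?]; apply/andP; split; lra.
  by split; [exact: near_ball px pa|exact: near_ball qy qb].
apply: countable_bigcupT_measurable => [|q]; first exact: countableP.
case: asboolP => _; last exact: measurable0.
by apply: measurableX; apply: open_measurable; exact: ball_open.
Qed.

Lemma continuous_measurable_plane (f : R * R -> R) : continuous f ->
  measurable_fun setT (f : plane -> R).
Proof.
move=> cf; apply: (measurability _ (RGenOInfty.measurableE R)).
move=> _ [_ [a ->] <-]; rewrite setTI; apply: open_measurable_plane.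
by move/continuousP : cf; apply; exact: interval_open.
Qed.

(** The Cauchy density without its factor [1 / pi]. The product [rho] is the common majorant of the
    Fourier integrals; it is also the rescaled Poisson kernel of the inversion formula and a
    summable weight on the integer lattice. *)
Definition rho1 (t : R) : R := (1 + t ^+ 2)^-1.
Definition rho (x : R * R) : R := rho1 x.1 * rho1 x.2.

Lemma rho1_gt0 t : 0 < rho1 t.
Proof. by rewrite invr_gt0 ltr_pwDl ?sqr_ge0. Qed.

Lemma rho1_le1 t : rho1 t <= 1.
Proof. by rewrite invf_le1 ?lerDl ?sqr_ge0// ltr_pwDl ?sqr_ge0. Qed.

Lemma continuous_rho1 : continuous rho1.
Proof.
move=> t; apply: cvgV; first by rewrite gt_eqF// ltr_pwDl ?sqr_ge0.
by apply: cvgD; [exact: cvg_cst|exact: exprn_continuous].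
Qed.

Lemma rho_gt0 x : 0 < rho x.
Proof. by rewrite mulr_gt0 ?rho1_gt0. Qed.

Lemma rho_le1 x : rho x <= 1.
Proof. by rewrite mulr_ile1 ?rho1_le1 ?ltW ?rho1_gt0. Qed.

Lemma integral_rho1 : (\int[l1]_x (rho1 x)%:E = pi%:E)%E.
Proof.
rewrite ge0_symfun_integralT.
- rewrite -set_itvcy integral0y_oneDsqr -EFinM; congr EFin; by field.
- by move=> x; exact/ltW/rho1_gt0.
- exact: continuous_rho1.
- by move=> x; rewrite /rho1 /= sqrrN.
Qed.

Lemma integrable_rho1 : l1.-integrable setT (EFin \o rho1).
Proof.
apply/integrableP; split.
  by apply/measurable_EFinP; apply: continuous_measurable_fun; exact: continuous_rho1.
under eq_integral => x _ do rewrite /= ger0_norm ?ltW ?rho1_gt0//.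
by rewrite integral_rho1 ltry.
Qed.

Lemma integrable_rho : l2.-integrable setT (EFin \o rho).
Proof. exact: integrable_prod integrable_rho1 integrable_rho1. Qed.

Lemma Rintegral_rho : Rintegral l2 setT rho = pi ^+ 2.
Proof.
rewrite (Rintegral_prod integrable_rho1 integrable_rho1).
by rewrite /Rintegral integral_rho1 expr2.
Qed.

(** Lebesgue measure is characterised by the lengths of half-open intervals, and [a] times its image
    under the affine map gives them the same lengths. *)
Lemma lebesgue_affine (a b : R) (f : R -> \bar R) : 0 < a ->
  measurable_fun setT (f : RR -> \bar R) -> (forall x, 0 <= f x)%E ->
  (\int[l1]_x f (b + a * x)%R = (a^-1)%:E * \int[l1]_x f x)%E.
Proof.
move=> a0 mf f0; have a1 : 0 <= a by rewrite ltW.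
pose phi (x : RR) : RR := b + a * x.
have mphi : measurable_fun setT phi.
  by apply: measurable_funD; [exact: measurable_cst|apply: measurable_funM].
pose nu : {measure set RR -> \bar R} :=
  measure_function_pushforward__canonical__measure_function_Measure l1 mphi.
pose mu' := mscale (NngNum a1) nu.
have E A : measurable A -> l1 A = mu' A.
  apply: lebesgue_measure_unique => _ [[u v] _ <-] /=.
  rewrite /mu' /mscale /= /pushforward.
  have -> : phi @^-1` `]u, v]%classic = `](u - b) / a, (v - b) / a]%classic.
    apply/seteqP; split=> x /=; rewrite /phi !in_itv /= ltr_pdivrMr// ler_pdivlMr//;
    by move=> /andP[? ?]; apply/andP; split; lra.
  rewrite !lebesgue_measure_itv /= !lte_fin ltr_pM2r ?invr_gt0// ltrD2r.
  case: ifP => _; last by rewrite mule0.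
  by rewrite -!EFinB -EFinM; congr EFin; field; rewrite gt_eqF.
have -> : (\int[l1]_x f x = \int[mu']_x f x)%E.
  by apply: eq_measure_integral => A mA _; exact: E.
rewrite ge0_integral_mscale// ge0_integral_pushforward//.
rewrite preimage_setT /= muleA -EFinM mulVf ?gt_eqF// mul1e.
by apply: eq_integral.
Qed.

Lemma plane_swap_ge0 (f : plane -> \bar R) : measurable_fun setT f ->
  (forall x, 0 <= f x)%E -> (\int[l2]_x f (x.2, x.1) = \int[l2]_x f x)%E.
Proof.
move=> mf f0; rewrite fubini_tonelli2//.
rewrite fubini_tonelli1//.
by apply: measurableT_comp => //; exact: measurable_swap.
Qed.

(** Up to an exchange of coordinates, triangular maps cover the translations, dilations and lattice
    coordinates to come. Their change of variables is Tonelli with one affine substitution per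
    coordinate. *)
Definition shear (a b c : R) (z : R * R) (v : R * R) : R * R :=
  (z.1 + a * v.1, z.2 + c * v.1 + b * v.2).

Lemma measurable_shear a b c z : measurable_fun setT (shear a b c z : plane -> plane).
Proof.
apply/measurable_fun_pairP; split => /=.
  by apply: measurable_funD => //; apply: measurable_funM => //; exact: measurable_fst.
apply: measurable_funD => //.
  by apply: measurable_funD => //; apply: measurable_funM => //; exact: measurable_fst.
by apply: measurable_funM => //; exact: measurable_snd.
Qed.

Lemma plane_shear_ge0 a b c z (f : plane -> \bar R) : 0 < a -> 0 < b ->
  measurable_fun setT f -> (forall x, 0 <= f x)%E ->
  (\int[l2]_x f (shear a b c z x) = ((a * b)^-1)%R%:E * \int[l2]_x f x)%E.
Proof.
move=> a0 b0 mf f0; rewrite fubini_tonelli1//; last first.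
  by apply: (measurableT_comp mf); exact: measurable_shear.
rewrite /fubini_F /shear /=.
under eq_integral => x _.
  rewrite (@lebesgue_affine b _ (fun y => f (z.1 + a * x, y)))//; last first.
    by apply: (measurableT_comp mf); exact: measurable_pair1.
  over.
have mF : measurable_fun setT (fubini_F l1 f) by exact: measurable_fun_fubini_tonelli_F.
have F0 x : (0 <= fubini_F l1 f x)%E by apply: integral_ge0.
rewrite ge0_integralZl ?lee_fin ?invr_ge0 ?ltW//.
- rewrite (@lebesgue_affine a _ (fubini_F l1 f))//.
  by rewrite -fubini_tonelli1// muleA -EFinM invfM mulrC.
- apply: (measurableT_comp mF).
  by apply: measurable_funD => //; apply: measurable_funM.
- by move=> x _; exact: F0.
Qed.

Section linear_change.
Variables (phi : plane -> plane) (k : R).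
Hypotheses (mphi : measurable_fun setT phi) (k0 : 0 <= k).
Hypothesis change : forall f : plane -> \bar R, measurable_fun setT f ->
  (forall x, 0 <= f x)%E -> (\int[l2]_x f (phi x) = k%:E * \int[l2]_x f x)%E.

Lemma integrable_change (f : plane -> R) : l2.-integrable setT (EFin \o f) ->
  l2.-integrable setT (EFin \o (f \o phi)).
Proof.
move=> /integrableP[mf fi]; apply/integrableP; split; first exact: (measurableT_comp mf mphi).
rewrite (change (f := fun x => `|(f x)%:E|%E))//; last exact: measurableT_comp.
by rewrite lte_mul_pinfty.
Qed.

(** The hypothesis [change] speaks of nonnegative functions; it is applied to the positive and the
    negative part. *)
Lemma Rintegral_change (f : plane -> R) : l2.-integrable setT (EFin \o f) ->
  Rintegral l2 setT (f \o phi) = k * Rintegral l2 setT f.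
Proof.
move=> fi; have /integrableP[mf _] := fi.
rewrite /Rintegral -[k]/(fine k%:E) -fineM//; last exact: integrable_fin_num.
congr fine; rewrite -[LHS]/(integral l2 setT ((EFin \o f) \o phi)).
rewrite -[X in (_ * X)%E]/(integral l2 setT (EFin \o f)).
have mfp : measurable_fun setT ((EFin \o f)^\+)%E by exact: measurable_funepos.
have mfn : measurable_fun setT ((EFin \o f)^\-)%E by exact: measurable_funeneg.
have Ep := change mfp (fun=> funepos_ge0 _ _).
have En := change mfn (fun=> funeneg_ge0 _ _).
have -> : (\int[l2]_x ((EFin \o f) \o phi) x =
    \int[l2]_x ((EFin \o f)^\+)%E (phi x) - \int[l2]_x ((EFin \o f)^\-)%E (phi x))%E.
  by rewrite integralE funepos_comp funeneg_comp.
have -> : (\int[l2]_x (EFin \o f) x =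
    \int[l2]_x ((EFin \o f)^\+)%E x - \int[l2]_x ((EFin \o f)^\-)%E x)%E.
  by rewrite integralE.
by rewrite Ep En; apply/esym; apply: muleBr => //; exact: integrable_add_def.
Qed.

Lemma cintble_change (f : plane -> C) : cintble l2 f -> cintble l2 (f \o phi).
Proof.
by move=> [f1 f2]; split; [exact: (integrable_change f1)|exact: (integrable_change f2)].
Qed.

Lemma cint_change (f : plane -> C) : cintble l2 f ->
  cint l2 (f \o phi) = k%:C * cint l2 f.
Proof.
move=> [f1 f2]; rewrite /cint (Rintegral_change f1) (Rintegral_change f2).
by apply: complex_eq; rewrite /= !mul0r ?subr0 ?addr0.
Qed.

End linear_change.

End Plane.

Section PlaneMeasure.
Context {R : realType}.
Local Notation plane := (measurableTypeR R * measurableTypeR R)%type.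

(** A name for the product measure, so that it can carry the sigma-finite structure that Fubini on
    pairs of points of the plane requires. *)
Definition leb2 : set plane -> \bar R :=
  (@lebesgue_measure R \x @lebesgue_measure R)%E.

HB.instance Definition _ := Measure.on leb2.

Let leb2_sigma_finite : sigma_finite setT leb2.
Proof.
pose F n : set (measurableTypeR R) := `[- n%:R, n%:R]%classic.
exists (fun n => F n `*` F n).
  apply/seteqP; split => // -[x y] _.
  have xy0 : 0 <= `|x| + `|y| by rewrite addr_ge0.
  have xn := archi_boundP xy0.
  exists (Num.bound (`|x| + `|y|)) => //; rewrite /F /=.
  have ? := normr_ge0 x; have ? := normr_ge0 y.
  by split; rewrite in_itv /= -ler_norml; lra.
move=> n; split; first by apply: measurableX; exact: measurable_itv.
have Fn : (@lebesgue_measure R (F n) < +oo)%E.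
  by rewrite /F lebesgue_measure_itv /=; case: ifPn => _; rewrite -?EFinB ltry.
have mF : measurable (F n) by exact: measurable_itv.
by rewrite /leb2 product_measure1E// lte_mul_pinfty// ge0_fin_numE.
Qed.

HB.instance Definition _ := Measure_isSigmaFinite.Build _ _ _ leb2
  leb2_sigma_finite.

End PlaneMeasure.

(** * Taylor estimates in one variable and for the complex exponential *)

Section Taylor.
Context {R : realType}.
Local Notation C := (R[i]).
Local Notation normc := (@Normc.normc R).

Lemma taylor1 (f f' : R -> R) (B x t : R) :
  (forall y : R, is_derive y 1 f (f' y)) ->
  (forall y, `|y - x| <= `|t| -> `|f' y| <= B) ->
  `|f (x + t) - f x| <= B * `|t|.
Proof.
move=> df Bf.
have cf (a b : R) : {within `[a, b], continuous f}.
  apply: continuous_subspaceT => y; apply: differentiable_continuous.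
  by apply/derivable1_diffP; case: (df y).
have key (a b : R) : a <= b -> (forall y, a <= y <= b -> `|f' y| <= B) ->
    `|f b - f a| <= B * (b - a).
  move=> ab H; have [c cab ->] := MVT_segment ab (fun y _ => df y) (cf a b).
  rewrite normrM (ger0_norm (_ : 0 <= b - a)) ?subr_ge0// ler_wpM2r ?subr_ge0//.
  by apply: H; move: cab; rewrite in_itv.
have [t0|t0] := leP 0 t.
  have := key x (x + t); rewrite lerDl addrAC subrr add0r (ger0_norm t0); apply=> //.
  by move=> y /andP[xy yt]; apply: Bf; rewrite !ger0_norm ?subr_ge0//; lra.
rewrite distrC; have := key (x + t) x.
rewrite gerDl opprD addrA subrr sub0r (ltr0_norm t0); apply; first exact: ltW.
by move=> y /andP[xy yt]; apply: Bf; rewrite distrC ger0_norm ?subr_ge0// (ltr0_norm t0); lra.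
Qed.

(** [taylor1] is applied to [f] minus its linear part, whose derivative is at most [B |t|] by
    [taylor1] for [f']. This yields the constant [B] instead of [B / 2]. *)
Lemma taylor2 (f f' f'' : R -> R) (B x t : R) :
  (forall y : R, is_derive y 1 f (f' y)) -> (forall y : R, is_derive y 1 f' (f'' y)) ->
  (forall y, `|y - x| <= `|t| -> `|f'' y| <= B) ->
  `|f (x + t) - f x - t * f' x| <= B * t ^+ 2.
Proof.
move=> df df' Bf.
pose g y := f y - y * f' x.
have dg (y : R) : is_derive y 1 g (f' y - f' x).
  have := df y => dfy; rewrite /g.
  have -> : f' y - f' x = f' y - (y * 0 + f' x * 1) by rewrite mulr0 add0r mulr1.
  apply: is_deriveB; have := @is_deriveM R R id (cst (f' x)) y 1 1 0 _ _.
  by rewrite /GRing.scale /= !mulr1; exact.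
have gb y : `|y - x| <= `|t| -> `|f' y - f' x| <= B * `|t|.
  move=> yx; have H := @taylor1 f' f'' B x (y - x) df' _.
  rewrite -[y in f' y](subrK x) [y - x + x]addrC (le_trans (H _))//.
    by move=> z zx; apply: Bf; exact: le_trans zx yx.
  rewrite ler_wpM2l// (le_trans (normr_ge0 (f'' x)))// Bf// subrr normr0//.
have := taylor1 dg gb; rewrite -mulrA -normrM -expr2 ger0_norm ?sqr_ge0//.
by congr (`| _ | <= _); rewrite /g; ring.
Qed.

Lemma cos_taylor (t : R) : `|cos t - 1| <= t ^+ 2.
Proof.
have := @taylor2 cos (fun y => - sin y) (fun y => - cos y) 1 0 t _ _ _.
rewrite add0r cos0 sin0 oppr0 mulr0 subr0 mul1r; apply.
- by move=> y _; rewrite normrN cos_max.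
Qed.

Lemma sin_taylor (t : R) : `|sin t - t| <= t ^+ 2.
Proof.
have := @taylor2 sin cos (fun y => - sin y) 1 0 t _ _ _.
rewrite add0r cos0 sin0 subr0 mulr1 mul1r; apply.
by move=> y _; rewrite normrN sin_max.
Qed.

Lemma sin_le (t : R) : `|sin t| <= `|t|.
Proof.
have := @taylor1 sin cos 1 0 t _ _.
by rewrite add0r sin0 subr0 mul1r; apply=> y _; exact: cos_max.
Qed.

Lemma cos_le (t : R) : `|cos t - 1| <= `|t|.
Proof.
have := @taylor1 cos (fun y => - sin y) 1 0 t _ _.
by rewrite add0r cos0 mul1r; apply=> y _; rewrite normrN; exact: sin_max.
Qed.

Lemma expi_lip (t : R) : normc (expi t - 1) <= 2 * `|t|.
Proof.
rewrite (le_trans (normc_le _))// /expi.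
have -> : complex.Re (cos t +i* sin t - 1) = cos t - 1 by [].
have -> : complex.Im (cos t +i* sin t - 1) = sin t by rewrite /= subr0.
by have := cos_le t; have := sin_le t; lra.
Qed.

Lemma expi_taylor (t : R) : normc (expi t - 1 - (0 +i* t)) <= 2 * t ^+ 2.
Proof.
rewrite (le_trans (normc_le _))// /expi.
have -> : complex.Re (cos t +i* sin t - 1 - (0 +i* t)) = cos t - 1 by rewrite /= subr0.
have -> : complex.Im (cos t +i* sin t - 1 - (0 +i* t)) = sin t - t by rewrite /= subr0.
by have := cos_taylor t; have := sin_taylor t; lra.
Qed.

End Taylor.

(** * The Fourier integral on the plane *)

Section Fourier.
Context {R : realType}.
Local Notation C := (R[i]).
Local Notation plane := (measurableTypeR R * measurableTypeR R)%type.
Local Notation l2 := (@leb2 R).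
Local Notation normc := (@Normc.normc R).
Implicit Types (h k : R * R -> C) (x xi v : R * R).

Definition dot xi x : R := xi.1 * x.1 + xi.2 * x.2.

Lemma dotC x y : dot x y = dot y x.
Proof. by rewrite /dot mulrC [x.2 * _]mulrC. Qed.

Lemma dotDl x y z : dot (x + y) z = dot x z + dot y z.
Proof. by rewrite /dot /=; ring. Qed.

Lemma dotDr x y z : dot z (x + y) = dot z x + dot z y.
Proof. by rewrite /dot /=; ring. Qed.

Lemma dotZl t x z : dot (t *: x) z = t * dot x z.
Proof. by rewrite /dot /= /GRing.scale /=; ring. Qed.

Lemma dotNr x z : dot z (- x) = - dot z x.
Proof. by rewrite /dot /=; ring. Qed.

Lemma measurable_dot xi : measurable_fun setT (dot xi : plane -> R).
Proof.
by apply: measurable_funD; apply: measurable_funM.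
Qed.

Lemma measurable_dot2 :
  measurable_fun setT ((fun z => dot z.1 z.2) : plane * plane -> R).
Proof.
have m11 : measurable_fun setT ((fun z => z.1.1) : plane * plane -> R).
  by apply: (measurableT_comp measurable_fst); exact: measurable_fst.
have m12 : measurable_fun setT ((fun z => z.1.2) : plane * plane -> R).
  by apply: (measurableT_comp measurable_snd); exact: measurable_fst.
have m21 : measurable_fun setT ((fun z => z.2.1) : plane * plane -> R).
  by apply: (measurableT_comp measurable_fst); exact: measurable_snd.
have m22 : measurable_fun setT ((fun z => z.2.2) : plane * plane -> R).
  by apply: (measurableT_comp measurable_snd); exact: measurable_snd.
by apply: measurable_funD; apply: measurable_funM.
Qed.

(** Pointwise domination, rather than integrability alone, gives Fubini its product majorant and
    dominated convergence an explicit one, and it records the constant. *)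
Definition decay (K : R) h := @cmeas _ _ plane h /\
  forall x, normc (h x) <= K * rho x.

Definition FT h xi : C := cint l2 (fun x => h x * expi (- (2 * pi * dot xi x))).
Definition IFT k x : C := cint l2 (fun xi => k xi * expi (2 * pi * dot xi x)).

Lemma integrable_Krho (K : R) : l2.-integrable setT (EFin \o (fun x => K * rho x)).
Proof. exact: (integrableZl measurableT K (@integrable_rho R)). Qed.

Lemma decay_cintble K h : decay K h -> cintble l2 h.
Proof. by move=> [mh hK]; exact: le_cintble (integrable_Krho K) mh hK. Qed.

Lemma normc_cint_decay K h : decay K h -> normc (cint l2 h) <= K * pi ^+ 2.
Proof.
move=> [mh hK]; rewrite (le_trans (normc_cint mh (integrable_Krho K) hK))//.
by rewrite RintegralZl ?Rintegral_rho//; exact: integrable_rho.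
Qed.

Lemma decay_ge0 K h : decay K h -> 0 <= K.
Proof.
move=> [_ /(_ (0, 0)) H]; have := le_trans (normc_ge0 _) H.
by rewrite pmulr_lge0 ?rho_gt0.
Qed.

Lemma decay_bound K h x : decay K h -> normc (h x) <= K.
Proof.
move=> dh; have K0 := decay_ge0 dh; case: dh => _ /(_ x) /le_trans; apply.
by rewrite ler_piMr// rho_le1.
Qed.

Lemma decayM K h k B : decay K h -> @cmeas _ _ plane k -> 
  (forall x, normc (k x) <= B) -> decay (B * K) (fun x => h x * k x).
Proof.
move=> [mh hK] mk kB; split; first exact: cmeasM.
move=> x; rewrite Normc.normcM mulrC -mulrA ler_pM ?normc_ge0//.
Qed.

Lemma decay_expi K h (b : plane -> R) : decay K h -> measurable_fun setT b ->
  decay K (fun x => h x * expi (b x)).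
Proof.
move=> dh mb; rewrite -[K]mul1r; apply: decayM => //; first exact: cmeas_expi.
by move=> x; rewrite normc_expi.
Qed.

Lemma decayZ K h c : decay K h -> decay (normc c * K) (fun x => c * h x).
Proof.
move=> [mh hK]; split; first by apply: cmeasM => //; exact: cmeas_cst.
by move=> x; rewrite Normc.normcM -mulrA ler_wpM2l ?normc_ge0.
Qed.

Lemma decayD K L h k : decay K h -> decay L k -> decay (K + L) (fun x => h x + k x).
Proof.
move=> [mh hK] [mk kL]; split; first exact: cmeasD.
by move=> x; rewrite (le_trans (le_normcD _ _))// mulrDl lerD.
Qed.

Lemma decayN K h : decay K h -> decay K (fun x => - h x).
Proof.
by move=> [mh hK]; split; [exact: cmeasN|move=> x; rewrite normcN].
Qed.

Lemma decay_conj K h : decay K h -> decay K (fun x => (h x)^*).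
Proof.
by move=> [mh hK]; split; [exact: cmeas_conj|move=> x; rewrite normc_conj].
Qed.

Lemma decay_char K h xi : decay K h ->
  decay K (fun x => h x * expi (- (2 * pi * dot xi x))).
Proof.
move=> dh; apply: decay_expi => //; apply: measurableT_comp => //.
by apply: measurable_funM => //; exact: measurable_dot.
Qed.

Lemma decay_ichar K h x : decay K h ->
  decay K (fun xi => h xi * expi (2 * pi * dot xi x)).
Proof.
move=> dh; apply: decay_expi => //.
under eq_fun do rewrite dotC.
by apply: measurable_funM => //; exact: measurable_dot.
Qed.

Lemma FT_bound K h xi : decay K h -> normc (FT h xi) <= K * pi ^+ 2.
Proof. by move=> dh; apply: normc_cint_decay; exact: decay_char. Qed.

Lemma IFT_bound K h x : decay K h -> normc (IFT h x) <= K * pi ^+ 2.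
Proof. by move=> dh; apply: normc_cint_decay; exact: decay_ichar. Qed.

Lemma FTZ K h c xi : decay K h -> FT (fun x => c * h x) xi = c * FT h xi.
Proof.
move=> dh; rewrite /FT -cintZ.
  by congr cint; apply/funext => x; rewrite mulrA.
exact/decay_cintble/decay_char/dh.
Qed.

Lemma FT_kernel_cmeas K h k L : decay K h -> decay L k ->
  @cmeas _ _ (plane * plane)%type
    (fun z => k z.1 * h z.2 * expi (- (2 * pi * dot z.1 z.2))).
Proof.
move=> [[h1 h2] _] [[k1 k2] _]; apply: cmeasM; last first.
  apply: cmeas_expi; apply: measurableT_comp => //.
  by apply: measurable_funM => //; exact: measurable_dot2.
apply: cmeasM.
  by split; [apply: (measurableT_comp k1)|apply: (measurableT_comp k2)]; exact: measurable_fst.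
by split; [apply: (measurableT_comp h1)|apply: (measurableT_comp h2)]; exact: measurable_snd.
Qed.

Lemma FT_kernel_bound K h k L : decay K h -> decay L k -> forall z : plane * plane,
  normc (k z.1 * h z.2 * expi (- (2 * pi * dot z.1 z.2))) <=
    L * rho z.1 * (K * rho z.2).
Proof.
move=> [_ hK] [_ kL] z; rewrite !Normc.normcM normc_expi mulr1.
by rewrite ler_pM ?normc_ge0.
Qed.

(** Both sides are iterated integrals, in the two orders, of the kernel [k xi * h x] times the
    character, which is dominated by a product of two multiples of [rho]. *)
Lemma FT_mult K L h k : decay K h -> decay L k ->
  cint l2 (fun xi => FT h xi * k xi) = cint l2 (fun x => h x * FT k x).
Proof.
move=> dh dk.
have := cint_Fubini (FT_kernel_cmeas dh dk) (integrable_Krho L)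
  (integrable_Krho K) (FT_kernel_bound dh dk).
under eq_fun => xi.
  rewrite (_ : cint _ _ = k xi * FT h xi).
    over.
  rewrite -cintZ; last exact/decay_cintble/decay_char/dh.
  by congr cint; apply/funext => x; rewrite /= mulrA.
under [in RHS]eq_fun => x.
  rewrite (_ : cint _ _ = h x * FT k x).
    over.
  rewrite -cintZ; last exact/decay_cintble/decay_char/dk.
  by congr cint; apply/funext => xi; rewrite /= mulrA [k xi * _]mulrC dotC.
by move=> <-; congr cint; apply/funext => xi; rewrite mulrC.
Qed.

Lemma FT_cmeas K h : decay K h -> @cmeas _ _ plane (FT h).
Proof.
move=> dh.
have mrho : measurable_fun setT (@rho R : plane -> R).
  by have /integrableP[/measurable_EFinP] := @integrable_rho R.
have dr : decay 1 (fun xi => (rho xi)%:C).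
  split; first exact: cmeas_real.
  by move=> x; rewrite normc_real ger0_norm ?mul1r// ltW ?rho_gt0.
(* The Fourier kernel is not integrable in [xi]; the weight [rho] makes it so and is divided out
   again. *)
pose f z := (rho z.1)%:C * h z.2 * expi (- (2 * pi * dot z.1 z.2)).
have [f1 f2] : cintble (l2 \x l2)%E f.
  apply: le_cintble (FT_kernel_bound dh dr); last exact: FT_kernel_cmeas dh dr.
  exact: integrable_prod (integrable_Krho 1) (integrable_Krho K).
have E : FT h = fun xi => ((rho xi)^-1)%:C * cint l2 (fun x => f (xi, x)).
  apply/funext => xi; rewrite /FT -cintZ.
    congr cint; apply/funext => x; rewrite /f /= !mulrA -rmorphM /= mulVf ?gt_eqF ?rho_gt0//.
    by rewrite mul1r.
  have := decay_cintble (decayZ (rho xi)%:C (decay_char xi dh)).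
  by congr (cintble _ _); apply/funext => x; rewrite mulrA.
rewrite E; apply: cmeasM.
  apply: cmeas_real; under eq_fun do rewrite /rho /rho1 invfM !invrK.
  by apply: measurable_funM; apply: measurable_funD => //;
    apply: measurable_funX; [exact: measurable_fst|exact: measurable_snd].
have fine_meas (g : plane * plane -> R) :
    (l2 \x l2)%E.-integrable setT (EFin \o g) ->
    measurable_fun setT (fun x : plane => Rintegral l2 setT (fun y => g (x, y))).
  move=> gi; have := measurable_fubini_F gi.
  by move=> /(measurableT_comp (@fine_measurable R setT measurableT)); apply.
by split; [exact: (fine_meas _ f1)|exact: (fine_meas _ f2)].
Qed.

End Fourier.

Section FourierRules.
Context {R : realType}.
Local Notation C := (R[i]).
Local Notation plane := (measurableTypeR R * measurableTypeR R)%type.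
Local Notation l2 := (@leb2 R).
Local Notation normc := (@Normc.normc R).
Implicit Types (h k : R * R -> C) (x xi v : R * R).

Lemma fourierE h xi : fourier h xi = FT h xi.
Proof.
rewrite -[LHS]/(cint l2 (fun x => h x * expi (- (2 * pi * phase xi 1 x)))).
congr cint; apply/funext => x; have -> : phase xi 1 x = dot xi x => //.
by rewrite /phase mulmx1 /dot !mxE !big_ord_recl big_ord0 addr0 !mxE.
Qed.

Lemma rho1_shift (t s : R) : `|s| <= 1 -> rho1 (t + s) <= 3 * rho1 t.
Proof.
move=> s1; have s2 : s ^+ 2 <= 1 by rewrite -real_normK ?num_real// expr_le1.
have p1 : 0 < 1 + t ^+ 2 by rewrite ltr_pwDl ?sqr_ge0.
have p2 : 0 < 1 + (t + s) ^+ 2 by rewrite ltr_pwDl ?sqr_ge0.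
rewrite /rho1 -ler_pdivrMr ?invr_gt0// invrK mulrC ler_pdivrMr//.
have := sqr_ge0 (t + 2 * s); nra.
Qed.

Lemma rho_shift x s t : `|s| <= 1 -> `|t| <= 1 ->
  rho (x.1 + s, x.2 + t) <= 9 * rho x.
Proof.
move=> s1 t1; have -> : 9 * rho x = (3 * rho1 x.1) * (3 * rho1 x.2) by rewrite /rho; ring.
by rewrite ler_pM ?rho1_shift// ltW// rho1_gt0.
Qed.

Lemma cintble_shear a b c z h : 0 < a -> 0 < b -> cintble l2 h ->
  cintble l2 (fun x => h (shear a b c z x)).
Proof.
move=> a0 b0; apply: (@cintble_change R (shear a b c z) (a * b)^-1).
- exact: measurable_shear.
- by rewrite invr_ge0 mulr_ge0// ltW.
- by move=> f; exact: plane_shear_ge0.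
Qed.

Lemma cint_shear a b c z h : 0 < a -> 0 < b -> cintble l2 h ->
  cint l2 (fun x => h (shear a b c z x)) = ((a * b)^-1)%:C * cint l2 h.
Proof.
by move=> a0 b0; apply: (@cint_change R (shear a b c z)) => f; exact: plane_shear_ge0.
Qed.

Lemma shear1 z x : shear 1 1 0 z x = z + x.
Proof. by rewrite /shear !mul1r mul0r addr0. Qed.

Lemma cint_translate K h z : decay K h ->
  cint l2 (fun x => h (z + x)) = cint l2 h.
Proof.
move=> /decay_cintble ih; have := @cint_shear 1 1 0 z h ltr01 ltr01 ih.
by rewrite mulr1 invr1 mul1r => <-; congr cint; apply/funext => x; rewrite shear1.
Qed.

Lemma FT_translate K h z xi : decay K h ->
  FT (fun x => h (z + x)) xi = expi (2 * pi * dot xi z) * FT h xi.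
Proof.
move=> dh; rewrite /FT -(cint_translate z (decay_char xi dh)) -cintZ.
  congr cint; apply/funext => x; rewrite mulrCA -expiD; congr (_ * expi _).
  by rewrite dotDr; ring.
have := @cintble_shear 1 1 0 z _ ltr01 ltr01 (decay_cintble (decay_char xi dh)).
by congr (cintble _ _); apply/funext => x; rewrite shear1.
Qed.

(** Dividing by [t] bounds [a] by [t K] for arbitrarily small [t]. This recovers an exact identity
    from estimates with a remainder of second order. *)
Lemma scale_small (a : C) (K : R) : (forall t : R, 0 < t <= 1 ->
  t * normc a <= t ^+ 2 * K) -> a = 0.
Proof.
move=> H; apply/eqP; rewrite -normc_eq0 eq_le normc_ge0 andbT leNgt; apply/negP => a0.
have aK t : 0 < t <= 1 -> normc a <= t * K.
  move=> /andP[t0 t1]; rewrite -(ler_pM2l t0) mulrA -expr2; apply: H.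
  by rewrite t0.
have K0 : 0 < K by rewrite (lt_le_trans a0)// (le_trans (aK 1 _)) ?mul1r// ltr01 lexx.
(* At this [t] the bound forces the norm of [a] to be at most half of itself. *)
pose t := Num.min 1 (normc a / (2 * K)).
have t0 : 0 < t by rewrite lt_min ltr01 divr_gt0// mulr_gt0.
have := aK t; rewrite t0 ge_min lexx /= => /(_ isT).
have : t <= normc a / (2 * K) by rewrite ge_min lexx orbT.
rewrite ler_pdivlMr ?mulr_gt0//; nra.
Qed.

(* Differentiating the action of translations on the Fourier transform avoids
   any integration by parts. *)
Lemma FT_deriv (K L B : R) h dh v xi : decay K h -> decay L dh ->
  (forall t x, 0 < t <= 1 ->
     normc (h (t *: v + x) - h x - t%:C * dh x) <= t ^+ 2 * (B * rho x)) ->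
  FT dh xi = (0 +i* (2 * pi * dot xi v)) * FT h xi.
Proof.
move=> dech decdh rem; apply/eqP; rewrite eq_sym -subr_eq0; apply/eqP.
pose d := dot xi v; pose M := normc (FT h xi).
apply: (@scale_small _ (B * pi ^+ 2 + 2 * (2 * pi * d) ^+ 2 * M)) => t t01.
have /andP[t0 t1] := t01.
have mh : @cmeas _ _ plane (fun x => h (t *: v + x)).
  have [[h1 h2] _] := dech; have mz := @measurable_shear R 1 1 0 (t *: v).
  split; under eq_fun do rewrite -shear1; [exact: (measurableT_comp h1)|exact: (measurableT_comp h2)].
pose r x := h (t *: v + x) - h x - t%:C * dh x.
have decr : decay (t ^+ 2 * B) r.
  split; last by move=> x; rewrite -mulrA; exact: rem.
  apply: cmeasD; [apply: cmeasD => //|].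
    by case: (decayN dech).
  by case: (decayN (decayZ t%:C decdh)).
(* The remainder is transformed term by term; the translated copy of [h] contributes a phase. *)
have E : FT r xi = (expi (2 * pi * (t * d)) - 1) * FT h xi - t%:C * FT dh xi.
  rewrite mulrBl mul1r -(FTZ _ _ decdh).
  have -> : expi (2 * pi * (t * d)) * FT h xi = FT (fun x => h (t *: v + x)) xi.
    by rewrite (FT_translate _ _ dech) dotC dotZl dotC.
  have ich := decay_cintble (decay_char xi dech).
  have ir := decay_cintble (decay_char xi decr).
  have idh := decay_cintble (decay_char xi (decayZ t%:C decdh)).
  have -> : FT (fun x => h (t *: v + x)) xi =
      FT r xi + FT h xi + FT (fun x => t%:C * dh x) xi.
    rewrite /FT -!cintD//; last exact: cintbleD.
    by congr cint; apply/funext => x; rewrite -!mulrDl /r; congr (_ * _); ring.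
  by ring.
have nr : normc (FT r xi) <= t ^+ 2 * B * pi ^+ 2 by exact: FT_bound.
have -> : t * normc ((0 +i* (2 * pi * d)) * FT h xi - FT dh xi) =
    normc (FT r xi - (expi (2 * pi * (t * d)) - 1 - (0 +i* (2 * pi * (t * d)))) * FT h xi).
  rewrite E -[t in LHS](ger0_norm (ltW t0)) -normc_real -Normc.normcM; congr normc.
  have -> : (0 +i* (2 * pi * (t * d))) = t%:C * (0 +i* (2 * pi * d)) :> C.
    by apply: complex_eq; rewrite /=; ring.
  by ring.
rewrite (le_trans (normcB _ _))// Normc.normcM.
have := expi_taylor (2 * pi * (t * d)) => /(ler_wpM2r (normc_ge0 (FT h xi))) H.
rewrite (le_trans (lerD nr H))// /M; lra.
Qed.

Lemma FT_Lip (K B : R) h v xi : 0 <= B -> decay K h -> (forall x, normc (h x) * `|dot v x| <= B * rho x) ->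
  normc (FT h (xi + v) - FT h xi) <= 4 * pi * B * pi ^+ 2.
Proof.
move=> K0 dh hv.
have pi0 : 0 <= pi :> R by exact: pi_ge0.
have i1 := decay_cintble (decay_char (xi + v) dh).
have i2 := decay_cintble (decay_char xi dh).
rewrite /FT -cintB//; apply: normc_cint_decay; split.
  by apply: cmeasD; [|apply: cmeasN]; [exact: (cintble_cmeas i1)|exact: (cintble_cmeas i2)].
move=> x; rewrite -mulrBr dotDl.
have -> : - (2 * pi * (dot xi x + dot v x)) = - (2 * pi * dot xi x) + - (2 * pi * dot v x) by ring.
rewrite expiD.
have -> : expi (- (2 * pi * dot xi x)) * expi (- (2 * pi * dot v x)) - expi (- (2 * pi * dot xi x))
  = expi (- (2 * pi * dot xi x)) * (expi (- (2 * pi * dot v x)) - 1) by ring.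
rewrite !Normc.normcM normc_expi mul1r.
rewrite (le_trans (ler_wpM2l (normc_ge0 _) (expi_lip _)))//.
rewrite normrN normrM (ger0_norm (_ : 0 <= 2 * pi)) ?mulr_ge0//.
have := ler_wpM2l (mulr_ge0 (ler0n R 4) pi0) (hv x); lra.
Qed.

(** Dual to [FT_deriv]: differentiation in frequency multiplies by the phase, and the second moment
    of [h] in the direction [v] dominates the quadratic remainder of the exponential. *)
Lemma FT_diff1 (K : R) h v xi (t : R) : decay K h ->
  (forall x, normc (h x) * `|dot v x| <= K * rho x) ->
  (forall x, normc (h x) * dot v x ^+ 2 <= K * rho x) ->
  normc (FT h (t *: v + xi) - FT h xi -
     t%:C * FT (fun x => (0 +i* (- (2 * pi * dot v x))) * h x) xi) <=
    t ^+ 2 * (8 * pi ^+ 2 * K * pi ^+ 2).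
Proof.
move=> dh hv1 hv2; have K0 := decay_ge0 dh.
have pi0 : 0 <= pi :> R by exact: pi_ge0.
have mv : @cmeas _ _ plane (fun x => 0 +i* (- (2 * pi * dot v x))).
  split => //; apply: measurableT_comp => //.
  by apply: measurable_funM => //; exact: measurable_dot.
have dv : decay (2 * pi * K) (fun x => (0 +i* (- (2 * pi * dot v x))) * h x).
  split; first by apply: cmeasM => //; case: dh.
  move=> x; rewrite Normc.normcM /= expr0n add0r sqrtr_sqr normrN normrM.
  rewrite (ger0_norm (_ : 0 <= 2 * pi)) ?mulr_ge0//.
  by rewrite -!mulrA ler_wpM2l// ler_wpM2l// mulrC hv1.
rewrite -(FTZ _ _ dv) /FT.
have i1 := decay_cintble (decay_char (t *: v + xi) dh).
have i2 := decay_cintble (decay_char xi dh).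
have i3 := decay_cintble (decay_char xi (decayZ t%:C dv)).
rewrite -!cintB//; last by apply: cintbleD => //; exact: cintbleN.
rewrite (_ : t ^+ 2 * _ = t ^+ 2 * (8 * pi ^+ 2 * K) * pi ^+ 2); last by ring.
apply: normc_cint_decay; split.
  apply: cmeasD; last by apply: cmeasN; exact: (cintble_cmeas i3).
  apply: cmeasD; first exact: (cintble_cmeas i1).
  by apply: cmeasN; exact: (cintble_cmeas i2).
move=> x; rewrite dotDl dotZl mulrDr opprD expiD.
have -> : h x * (expi (- (2 * pi * (t * dot v x))) * expi (- (2 * pi * dot xi x))) -
   h x * expi (- (2 * pi * dot xi x)) -
   t%:C * ((0 +i* - (2 * pi * dot v x)) * h x) * expi (- (2 * pi * dot xi x)) =
   expi (- (2 * pi * dot xi x)) * (h x * (expi (- (2 * pi * (t * dot v x))) - 1 -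
     (0 +i* - (2 * pi * (t * dot v x))))).
  have -> : (0 +i* - (2 * pi * (t * dot v x))) = t%:C * (0 +i* - (2 * pi * dot v x)) :> C.
    by apply: complex_eq; rewrite /=; ring.
  by ring.
rewrite !Normc.normcM normc_expi mul1r.
rewrite (le_trans (ler_wpM2l (normc_ge0 _) (expi_taylor _)))//.
have := ler_wpM2l (mulr_ge0 (mulr_ge0 (ler0n R 8) (sqr_ge0 pi)) (sqr_ge0 t)) (hv2 x).
nra.
Qed.

End FourierRules.

(** * Fourier inversion *)

Section PoissonKernel.
Context {R : realType}.
Local Notation l1 := (@lebesgue_measure R).
Variable eps : R.
Hypothesis eps0 : 0 < eps.
Implicit Types b t : R.

(** The Abel factor; its Fourier integral is the Poisson kernel [2 eps / (eps ^ 2 + b ^ 2)], a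
    rescaled [rho1]. *)
Definition dexp (t : R) : R := expR (- (eps * `|t|)).

Lemma dexp_gt0 t : 0 < dexp t.
Proof. exact: expR_gt0. Qed.

Lemma continuous_dexp : continuous dexp.
Proof.
move=> t; apply: (@continuous_comp _ _ _ (fun t : R => - (eps * `|t|)) expR); last exact: continuous_expR.
apply: cvgN; apply: cvgM; first exact: cvg_cst.
exact: norm_continuous.
Qed.

(** The integrand contains [1 + cos] and not [cos] in order to be nonnegative, so that its integral
    over the half-line can be read off from the limit of a primitive. The term [- eps^-1] is the
    contribution of the constant 1. *)
Lemma dexp_primitive (b t : R) : 
  is_derive t 1 (fun t : R => expR (- (eps * t)) *
    ((b * sin (b * t) - eps * cos (b * t)) / (eps ^+ 2 + b ^+ 2) - eps^-1))
  (expR (- (eps * t)) * (1 + cos (b * t))).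
Proof.
have e2 : 0 < eps ^+ 2 + b ^+ 2 by rewrite ltr_pwDl ?sqr_ge0// exprn_gt0.
have dlin (c : R) : is_derive t 1 (fun t : R => c * t) c.
  have := @is_deriveZ R R R id c t 1 1 _.
  by rewrite /GRing.scale /= mulr1; exact.
have dN : is_derive t 1 (fun t : R => - (eps * t)) (- eps) by apply: is_deriveN.
have dE : is_derive t 1 (fun t : R => expR (- (eps * t))) (- eps * expR (- (eps * t))).
  by apply: (is_derive_eq (is_derive1_comp (f := expR) (is_derive_expR _) dN)); rewrite mulrC.
have dS : is_derive t 1 (fun t : R => sin (b * t)) (b * cos (b * t)).
  by apply: (is_derive_eq (is_derive1_comp (f := sin) (is_derive_sin _) (dlin b))); rewrite mulrC.
have dC : is_derive t 1 (fun t : R => cos (b * t)) (b * (- sin (b * t))).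
  by apply: (is_derive_eq (is_derive1_comp (f := cos) (is_derive_cos _) (dlin b))); rewrite mulrC.
pose g (t : R) := b * sin (b * t) - eps * cos (b * t).
have dg : is_derive t 1 g (b * (b * cos (b * t)) - eps * (b * - sin (b * t))).
  by apply: is_deriveB.
pose k (t : R) := g t / (eps ^+ 2 + b ^+ 2) - eps^-1.
have dk : is_derive t 1 k ((b * (b * cos (b * t)) - eps * (b * - sin (b * t))) / (eps ^+ 2 + b ^+ 2)).
  rewrite -[X in is_derive _ _ _ X]subr0; apply: is_deriveB.
  have := @is_deriveZ R R R g (eps ^+ 2 + b ^+ 2)^-1 t 1 _ dg.
  by rewrite /GRing.scale /= mulrC; congr (is_derive _ _ _ _); apply/funext => s; rewrite /= mulrC.
have := is_deriveM dE dk; rewrite /GRing.scale /=.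
congr (is_derive _ _ _ _); rewrite /k /g.
by field; rewrite !gt_eqF.
Qed.

Lemma dexp_primitive_cvg b : (fun t : R => expR (- (eps * t)) *
    ((b * sin (b * t) - eps * cos (b * t)) / (eps ^+ 2 + b ^+ 2) - eps^-1))
  t @[t --> +oo] --> (0 : R).
Proof.
have e2 : 0 < eps ^+ 2 + b ^+ 2 by rewrite ltr_pwDl ?sqr_ge0// exprn_gt0.
pose M := (`|b| + eps) / (eps ^+ 2 + b ^+ 2) + eps^-1.
have M0 : 0 < M by rewrite addr_gt0 ?invr_gt0// divr_gt0// ltr_pwDr.
have cE : expR (- (eps * t)) @[t --> +oo] --> (0 : R).
  apply: (@cvg_comp _ _ _ (fun t => eps * t) (fun t => expR (- t)) +oo +oo); last exact: cvgr_expR.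
  apply/cvgryPge => A; near=> t.
  by rewrite mulrC -ler_pdivrMr//; near: t; exact: nbhs_pinfty_ge.
have cME : expR (- (eps * t)) * M @[t --> +oo] --> (0 : R).
  by rewrite -[X in _ --> X](mul0r M); apply: cvgM => //; exact: cvg_cst.
apply/norm_cvg0P; apply: squeeze_cvgr (cvg_cst 0) cME; apply: nearW => t.
rewrite normr_ge0 /= normrM (ger0_norm (expR_ge0 _)) ler_wpM2l ?expR_ge0//.
rewrite (le_trans (ler_normB _ _))// /M lerD//; last by rewrite ger0_norm// invr_ge0 ltW.
have i0 : 0 <= (eps ^+ 2 + b ^+ 2)^-1 by rewrite invr_ge0 ltW.
rewrite normrM (ger0_norm i0) ler_wpM2r// (le_trans (ler_normB _ _))//.
rewrite !normrM (ger0_norm (ltW eps0)) lerD// ?ler_piMr ?sin_max ?cos_max// ltW//.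
Unshelve. all: end_near. Qed.

Lemma integral_dexp_cos1 b : (\int[l1]_t (dexp t * (1 + cos (b * t)))%:E =
  (2 * (eps / (eps ^+ 2 + b ^+ 2) + eps^-1))%:E)%E.
Proof.
have e2 : 0 < eps ^+ 2 + b ^+ 2 by rewrite ltr_pwDl ?sqr_ge0// exprn_gt0.
have c1 (t : R) : 0 <= 1 + cos (b * t) by have := cos_geN1 (b * t); lra.
have cont (c : R) : continuous (fun t : R => cos (c * t)).
  move=> t; apply: (@continuous_comp _ _ _ (fun t : R => c * t) cos); last exact: continuous_cos.
  exact: mulrl_continuous.
rewrite ge0_symfun_integralT.
- rewrite -set_itvcy.
  have -> : (\int[l1]_(t in `[0%R, +oo[) (dexp t * (1 + cos (b * t)))%:E =
      \int[l1]_(t in `[0%R, +oo[) (expR (- (eps * t)) * (1 + cos (b * t)))%:E)%E.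
    apply: eq_integral => t; rewrite inE /= in_itv /= andbT => t0.
    by rewrite /dexp ger0_norm.
  rewrite (@ge0_continuous_FTC2y R (fun t => expR (- (eps * t)) * (1 + cos (b * t)))
    (fun t : R => expR (- (eps * t)) *
    ((b * sin (b * t) - eps * cos (b * t)) / (eps ^+ 2 + b ^+ 2) - eps^-1)) 0 0).
  + rewrite -EFinB -EFinM; congr EFin.
    rewrite !mulr0 sin0 cos0 oppr0 expR0 !mulr0 !mulr1 !mul1r.
    by field; rewrite !gt_eqF.
  + by move=> t _; rewrite mulr_ge0// expR_ge0.
  + apply: continuous_subspaceT => t; apply: cvgM.
      apply: (@continuous_comp _ _ _ (fun t : R => - (eps * t)) expR); last exact: continuous_expR.
      by apply: cvgN; exact: mulrl_continuous.
    by apply: cvgD; [exact: cvg_cst|exact: cont].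
  + exact: dexp_primitive_cvg.
  + by move=> t _; case: (dexp_primitive b t).
  + apply: cvg_at_right_filter; pose F (t : R) := expR (- (eps * t)) *
      ((b * sin (b * t) - eps * cos (b * t)) / (eps ^+ 2 + b ^+ 2) - eps^-1).
    have dF : differentiable F 0 by apply/derivable1_diffP; case: (dexp_primitive b 0).
    exact: (differentiable_continuous dF).
  + by move=> t _; rewrite derive1E; case: (dexp_primitive b t) => _ ->.
- by move=> t; rewrite mulr_ge0// ltW ?dexp_gt0.
- move=> t; apply: cvgM; first exact: continuous_dexp.
  by apply: cvgD; [exact: cvg_cst|exact: cont].
- by move=> t; rewrite /dexp /= normrN mulrN cosN.
Qed.

Lemma integrable_dexp : l1.-integrable setT (EFin \o dexp).
Proof.
apply/integrableP; split.
  by apply/measurable_EFinP; apply: continuous_measurable_fun; exact: continuous_dexp.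
have := integral_dexp_cos1 0; under eq_integral do rewrite mul0r cos0 mulrC EFinM.
rewrite ge0_integralZl//; last 2 first.
- by apply/measurable_EFinP; apply: continuous_measurable_fun; exact: continuous_dexp.
- by move=> t _; rewrite lee_fin ltW ?dexp_gt0.
move=> H; under eq_integral do rewrite /= (ger0_norm (ltW (dexp_gt0 _))).
rewrite ltNge; apply/negP; rewrite leye_eq => /eqP E; move: H; rewrite E.
by rewrite mulry gtr0_sg ?mul1e.
Qed.

Lemma integrable_dexpM (f : R -> R) : measurable_fun setT f ->
  (forall t, `|f t| <= 2) -> l1.-integrable setT (EFin \o (fun t => dexp t * f t)).
Proof.
move=> mf f2; apply: (@le_integrable _ _ _ l1 setT measurableT _ (fun t => (2 * dexp t)%:E)).
- apply/measurable_EFinP; apply: measurable_funM => //.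
  by apply: continuous_measurable_fun; exact: continuous_dexp.
- move=> t _; rewrite /= lee_fin !normrM (ger0_norm (ler0n R 2)) mulrC.
  by rewrite ler_wpM2r.
- exact: (integrableZl measurableT 2 integrable_dexp).
Qed.

Lemma measurable_coslin b : measurable_fun setT (fun t : R => cos (b * t)).
Proof.
apply: (measurableT_comp (f := cos)).
  by apply: continuous_measurable_fun; exact: continuous_cos.
exact: measurable_funM.
Qed.

Lemma measurable_sinlin b : measurable_fun setT (fun t : R => sin (b * t)).
Proof.
apply: (measurableT_comp (f := sin)).
  by apply: continuous_measurable_fun; exact: continuous_sin.
exact: measurable_funM.
Qed.

Lemma Rintegral_dexp : Rintegral l1 setT dexp = 2 / eps.
Proof.
have := integral_dexp_cos1 0; under eq_integral do rewrite mul0r cos0 mulrC EFinM.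
rewrite (integralZl measurableT integrable_dexp) => H.
rewrite /Rintegral; have fi := integrable_fin_num measurableT integrable_dexp.
move: H; rewrite -(fineK fi) -EFinM => -[].
set I := fine _ => H.
apply: (@mulfI _ 2) => //.
rewrite (_ : 1 + 1 = 2)// in H; rewrite H expr0n addr0.
by field; rewrite gt_eqF.
Qed.

Lemma Rintegral_dexp_cos b :
  Rintegral l1 setT (fun t => dexp t * cos (b * t)) = 2 * eps / (eps ^+ 2 + b ^+ 2).
Proof.
have e2 : 0 < eps ^+ 2 + b ^+ 2 by rewrite ltr_pwDl ?sqr_ge0// exprn_gt0.
have ic : l1.-integrable setT (EFin \o (fun t => dexp t * cos (b * t))).
  apply: integrable_dexpM; first exact: measurable_coslin.
  by move=> t; rewrite (le_trans (cos_max _))// ler1n.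
have := RintegralD measurableT integrable_dexp ic; rewrite Rintegral_dexp.
under eq_Rintegral do rewrite -{1}[dexp _]mulr1 -mulrDr.
rewrite {1}/Rintegral integral_dexp_cos1 /= => H.
have -> : Rintegral l1 setT (fun t => dexp t * cos (b * t)) =
  2 * (eps / (eps ^+ 2 + b ^+ 2) + eps^-1) - 2 / eps by rewrite H; ring.
by field; rewrite !gt_eqF.
Qed.

Lemma ge0_integralN (f : R -> \bar R) : measurable_fun setT (f : measurableTypeR R -> _) ->
  (forall t, 0 <= f t)%E -> (\int[l1]_t f (- t)%R = \int[l1]_t f t)%E.
Proof.
move=> mf f0.
have mN : measurable_fun setT (-%R : measurableTypeR R -> measurableTypeR R).
  exact: oppr_measurable.
have := @ge0_integral_pushforward _ _ _ _ _ (-%R : measurableTypeR R -> measurableTypeR R) mN l1 setT f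
  measurableT mf (fun t _ => f0 t).
rewrite preimage_setT => <-.
by apply: eq_measure_integral => A mA _; exact: lebesgue_measureN.
Qed.

(** Reflection invariance is at hand for nonnegative functions, so it is applied to [dexp] times
    [1 + sin]; comparison with the mirror image makes the sine part equal to its opposite. *)
Lemma Rintegral_dexp_sin b : Rintegral l1 setT (fun t => dexp t * sin (b * t)) = 0.
Proof.
have is1 : l1.-integrable setT (EFin \o (fun t => dexp t * sin (b * t))).
  apply: integrable_dexpM; first exact: measurable_sinlin.
  by move=> t; rewrite (le_trans (sin_max _))// ler1n.
have E1 := RintegralD measurableT integrable_dexp is1.
have E2 := RintegralB measurableT integrable_dexp is1.
have : Rintegral l1 setT (fun t => dexp t + dexp t * sin (b * t)) =
  Rintegral l1 setT (fun t => dexp t - dexp t * sin (b * t)).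
  rewrite /Rintegral; congr fine.
  rewrite -(@ge0_integralN (fun t => (dexp t + dexp t * sin (b * t))%:E)).
  - by apply: eq_integral => t _; rewrite /dexp normrN !mulrN sinN mulrN.
  - have := measurable_int l1 (integrableD measurableT integrable_dexp is1).
    by congr (measurable_fun _ _).
  - move=> t; rewrite lee_fin -{1}[dexp t]mulr1 -mulrDr.
    by rewrite mulr_ge0 ?(ltW (dexp_gt0 t))// -lerBlDl sub0r sin_geN1.
rewrite E1 E2 => H; lra.
Qed.

Lemma cintble_dexp_expi b : cintble l1 (fun t => (dexp t)%:C * expi (b * t)).
Proof.
split.
  under eq_fun do rewrite ReMc /= mul0r subr0.
  apply: integrable_dexpM; first exact: measurable_coslin.
  by move=> t; rewrite (le_trans (cos_max _))// ler1n.
under eq_fun do rewrite ImMc /= mul0r addr0.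
apply: integrable_dexpM; first exact: measurable_sinlin.
by move=> t; rewrite (le_trans (sin_max _))// ler1n.
Qed.

Lemma cint_dexp_expi b : cint l1 (fun t => (dexp t)%:C * expi (b * t)) =
  (2 * eps / (eps ^+ 2 + b ^+ 2))%:C.
Proof.
apply: complex_eq => /=.
  rewrite -Rintegral_dexp_cos; apply: eq_Rintegral => t _.
  by rewrite mul0r subr0.
rewrite -[RHS](Rintegral_dexp_sin b); apply: eq_Rintegral => t _.
by rewrite mul0r addr0.
Qed.

(** With [s = eps |t|] the exponential of [s] is at least [(1 + s / 2) ^ 2], hence at least
    [1 + s ^ 2 / 4]; the assumption [eps <= 1] takes care of the constant term. *)
Lemma dexp_le t : eps <= 1 -> dexp t <= 4 / eps ^+ 2 * rho1 t.
Proof.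
move=> e1; rewrite /dexp expRN /rho1.
have p : 0 < 1 + t ^+ 2 by rewrite ltr_pwDl ?sqr_ge0.
have -> : 4 / eps ^+ 2 * (1 + t ^+ 2)^-1 = (eps ^+ 2 / 4 * (1 + t ^+ 2))^-1.
  by field; rewrite !gt_eqF.
rewrite lef_pV2 ?posrE ?expR_gt0//; last by rewrite mulr_gt0 ?divr_gt0 ?exprn_gt0.
have -> : eps * `|t| = (eps * `|t| / 2) * 2%:R by field.
rewrite expRM_natr.
have s0 : 0 <= eps * `|t| / 2 by rewrite divr_ge0// mulr_ge0// ltW.
have H := expR_ge1Dx (eps * `|t| / 2).
apply: (@le_trans _ _ ((1 + eps * `|t| / 2) ^+ 2)); last first.
  by rewrite lerXn2r// nnegrE ?expR_ge0// addr_ge0.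
rewrite -[t ^+ 2]real_normK ?num_real//.
have e3 : eps ^+ 2 <= 1 by rewrite expr_le1// ltW.
have := sqr_ge0 (eps * `|t|); nra.
Qed.

End PoissonKernel.

Section Inversion.
Context {R : realType}.
Local Notation C := (R[i]).
Local Notation l1 := (@lebesgue_measure R).
Local Notation l2 := (@leb2 R).
Local Notation plane := (measurableTypeR R * measurableTypeR R)%type.
Local Notation normc := (@Normc.normc R).
Implicit Types (h k : R * R -> C) (x xi v : R * R) (eps : R).

Definition abel eps x xi : C :=
  ((dexp eps xi.1)%:C * expi (2 * pi * x.1 * xi.1)) *
  ((dexp eps xi.2)%:C * expi (2 * pi * x.2 * xi.2)).

Lemma abelE eps x xi :
  abel eps x xi = (dexp eps xi.1 * dexp eps xi.2)%:C * expi (2 * pi * dot xi x).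
Proof.
rewrite /abel mulrACA -expiD -rmorphM /=; congr (_ * expi _).
by rewrite /dot; ring.
Qed.

Lemma measurable_dexp2 eps : 0 < eps ->
  measurable_fun setT ((fun xi => dexp eps xi.1 * dexp eps xi.2) : plane -> R).
Proof.
move=> e0; have md : measurable_fun setT (dexp eps : measurableTypeR R -> R).
  by apply: continuous_measurable_fun; exact: continuous_dexp.
apply: measurable_funM; apply: (measurableT_comp md).
  exact: measurable_fst.
exact: measurable_snd.
Qed.

Lemma dexp_le1 eps t : 0 < eps -> dexp eps t <= 1.
Proof. by move=> e0; rewrite /dexp -expR0 ler_expR oppr_le0 mulr_ge0// ltW. Qed.

Lemma decay_abel eps x : 0 < eps <= 1 -> decay ((4 / eps ^+ 2) ^+ 2) (abel eps x).
Proof.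
move=> /andP[e0 e1]; split.
  have -> : abel eps x = (fun xi => (dexp eps xi.1 * dexp eps xi.2)%:C * expi (2 * pi * dot xi x)).
    by apply/funext => xi; rewrite abelE.
  apply: cmeasM; first by apply: cmeas_real; exact: measurable_dexp2.
  apply: cmeas_expi; under eq_fun do rewrite dotC.
  by apply: measurable_funM => //; exact: measurable_dot.
move=> xi; rewrite abelE Normc.normcM normc_expi mulr1 normc_real.
rewrite ger0_norm; last by rewrite mulr_ge0// ltW// dexp_gt0.
rewrite expr2 /rho mulrACA ler_pM ?dexp_le ?(ltW (dexp_gt0 _ _))//.
Qed.

Lemma FT_abel eps x y : 0 < eps <= 1 ->
  FT (abel eps x) y = (2 * eps / (eps ^+ 2 + (2 * pi * (x.1 - y.1)) ^+ 2))%:C *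
    (2 * eps / (eps ^+ 2 + (2 * pi * (x.2 - y.2)) ^+ 2))%:C.
Proof.
move=> /andP[e0 e1]; rewrite -!(cint_dexp_expi e0).
rewrite -(cint_prod (cintble_dexp_expi e0 _) (cintble_dexp_expi e0 _)).
congr cint; apply/funext => xi; rewrite abelE [RHS]mulrACA -expiD -rmorphM /= -mulrA -expiD.
congr (_ * expi _); rewrite /dot; ring.
Qed.

(** The substitution [y = x + eps / (2 pi) w] turns the Poisson kernel into [rho w], whose integral
    [pi ^ 2] explains the factor in front. *)
Lemma abel_mean K h x eps : 0 < eps <= 1 -> decay K h ->
  cint l2 (fun y => h y * FT (abel eps x) y) =
  (pi ^- 2)%:C * cint l2 (fun w => h (shear (eps / (2 * pi)) (eps / (2 * pi)) 0 x w) * (rho w)%:C).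
Proof.
move=> e01 dh; have /andP[e0 e1] := e01.
have pi0 : 0 < pi :> R := pi_gt0 R.
pose a : R := eps / (2 * pi); have a0 : 0 < a by rewrite divr_gt0// mulr_gt0.
have dF : decay ((4 / eps ^+ 2) ^+ 2 * pi ^+ 2 * K) (fun y => h y * FT (abel eps x) y).
  apply: decayM => //; first exact: FT_cmeas (decay_abel x e01).
  by move=> y; apply: FT_bound; exact: decay_abel.
have := cint_shear 0 x a0 a0 (decay_cintble dF).
set I := cint l2 (fun y => h y * FT _ y) => H.
have -> : I = (a * a)%:C * (((a * a)^-1)%:C * I).
  by rewrite mulrA -rmorphM /= mulfV ?mul1r// mulf_neq0 ?gt_eqF.
rewrite -H; have ih := cintble_shear 0 x a0 a0 (decay_cintble dF).
rewrite -cintZ//.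
have E : (fun z => (a * a)%:C * (h (shear a a 0 x z) * FT (abel eps x) (shear a a 0 x z))) =
    (fun z => (pi ^- 2)%:C * (h (shear a a 0 x z) * (rho z)%:C)).
  apply/funext => z; rewrite mulrCA [RHS]mulrCA; congr (_ * _).
  rewrite FT_abel// -!rmorphM /=; congr (_%:C).
  have p1 : 0 < 1 + z.1 ^+ 2 by rewrite ltr_pwDl ?sqr_ge0.
  have p2 : 0 < 1 + z.2 ^+ 2 by rewrite ltr_pwDl ?sqr_ge0.
  have key (s t : R) : s = - (a * t) -> 2 * eps / (eps ^+ 2 + (2 * pi * s) ^+ 2) = 2 / eps * (1 + t ^+ 2)^-1.
    move=> ->; have p : 0 < 1 + t ^+ 2 by rewrite ltr_pwDl ?sqr_ge0.
    have -> : eps ^+ 2 + (2 * pi * - (a * t)) ^+ 2 = eps ^+ 2 * (1 + t ^+ 2).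
      have pa : 2 * pi * a = eps by rewrite /a mulrC divfK// mulf_neq0 ?gt_eqF.
      by rewrite -{1}pa -[in RHS]pa; ring.
    by field; rewrite !gt_eqF.
  rewrite (key _ z.1) ?(key _ z.2) /rho /rho1 /a /shear /=; [|by ring|by ring].
  move: (1 + z.1 ^+ 2)^-1 (1 + z.2 ^+ 2)^-1 => u w.
  have -> : eps / (2 * pi) * (eps / (2 * pi)) * (2 / eps * u * (2 / eps * w)) =
    (eps / eps) ^+ 2 * (2 / 2) ^+ 2 * pi^-1 ^+ 2 * (u * w) by rewrite invfM; ring.
  by rewrite !divff ?gt_eqF// !expr1n !mul1r exprVn.
rewrite -[X in cint l2 X = _]/(fun z => _ ) E cintZ//.
have : cintble l2 (fun z => (pi ^+ 2)%:C * ((pi ^- 2)%:C * (h (shear a a 0 x z) * (rho z)%:C))).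
  by apply: cintbleZ; rewrite -E; exact: cintbleZ.
congr (cintble _ _); apply/funext => z; rewrite mulrA -rmorphM /= mulfV ?mul1r//.
by rewrite expf_neq0 ?gt_eqF.
Qed.

Lemma ge0_cvg_le (a : R) (u : nat -> R) : (forall n, a <= u n) ->
  u n @[n --> \oo] --> (0 : R) -> a <= 0.
Proof.
move=> au cu; rewrite -(cvg_lim (@Rhausdorff R) cu); apply: limr_ge; last exact: nearW.
by apply/cvg_ex; exists 0.
Qed.

Lemma eq_seq_cvg (T : topologicalType) (u w : nat -> T) (l : T) : u =1 w ->
  w n @[n --> \oo] --> l -> u n @[n --> \oo] --> l.
Proof. by move=> /funext ->. Qed.

(** Abel summation, with [FT_mult] relating the two sides. As [eps] tends to 0, the frequency side
    tends to [IFT (FT h)], dominated by the decay of [FT h], and the space side, an average of [h]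
    around [x], tends to [h x] by continuity and boundedness. *)
Theorem FT_inversion K L h x : decay K h -> decay L (FT h) ->
  continuous (re h) -> continuous (im h) -> IFT (FT h) x = h x.
Proof.
move=> dh dF cre cim; have pi0 : 0 < pi :> R := pi_gt0 R.
pose eps n : R := n.+1%:R^-1.
have e01 n : 0 < eps n <= 1.
  by rewrite /eps invr_gt0 ltr0n /= invf_le1 ?ler1n ?ltr0n.
have e0 n : 0 < eps n by case/andP: (e01 n).
have ecvg : eps n @[n --> \oo] --> (0 : R) by exact: cvg_harmonic.
have mrho : @cmeas _ _ plane (fun w : R * R => (rho w)%:C).
  apply: cmeas_real; have /integrableP[/measurable_EFinP] := @integrable_rho R.
  by [].
have lhs : normc (cint l2 (fun xi => FT h xi * abel (eps n) x xi) - IFT (FT h) x) @[n --> \oo] --> (0 : R).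
  apply: (@cint_dct R _ plane l2 (fun n xi => FT h xi * abel (eps n) x xi)
    (fun xi => FT h xi * expi (2 * pi * dot xi x)) (fun xi => L * rho xi)).
  - by move=> n; apply: cmeasM; [exact: FT_cmeas dh|case: (decay_abel x (e01 n))].
  - exact: (decay_ichar x dF).1.
  - exact: integrable_Krho.
  - move=> n xi; rewrite Normc.normcM abelE Normc.normcM normc_expi mulr1 normc_real.
    have := dF.2 xi; have := dexp_le1 xi.1 (e0 n); have := dexp_le1 xi.2 (e0 n).
    have := dexp_gt0 (eps n) xi.1; have := dexp_gt0 (eps n) xi.2 => p1 p2 q1 q2 H.
    rewrite ger0_norm; last by rewrite mulr_ge0// ltW.
    rewrite (le_trans _ H)// ler_piMr ?normc_ge0// mulr_ile1 ?(ltW p1) ?(ltW p2)//.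
  - move=> xi.
    have E n : normc (FT h xi * abel (eps n) x xi - FT h xi * expi (2 * pi * dot xi x)) =
        normc (FT h xi) * `|dexp (eps n) xi.1 * dexp (eps n) xi.2 - 1|.
      rewrite abelE -mulrBr -{2}[expi _]mul1r -mulrBl !Normc.normcM normc_expi mulr1.
      by rewrite -normc_real rmorphB.
    apply: (eq_seq_cvg E).
    rewrite -[X in _ --> X](mulr0 (normc (FT h xi))); apply: cvgM; first exact: cvg_cst.
    apply/norm_cvg0P; apply/subr_cvg0.
    have ce (t : R) : dexp (eps n) t @[n --> \oo] --> (1 : R).
      have cl : - (eps n * `|t|) @[n --> \oo] --> (0 : R).
        rewrite -oppr0 -[X in _ --> - X](mul0r `|t|); apply: cvgN; apply: cvgM => //.
        exact: cvg_cst.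
      by rewrite -expR0; exact: (cvg_comp _ _ cl (@continuous_expR R 0)).
    by rewrite -[X in _ --> X](mulr1 1); apply: cvgM.
have rhs : normc (cint l2 (fun w => h (shear (eps n / (2 * pi)) (eps n / (2 * pi)) 0 x w) * (rho w)%:C) -
    cint l2 (fun w => h x * (rho w)%:C)) @[n --> \oo] --> (0 : R).
  apply: (@cint_dct R _ plane l2
    (fun n w => h (shear (eps n / (2 * pi)) (eps n / (2 * pi)) 0 x w) * (rho w)%:C)
    (fun w => h x * (rho w)%:C) (fun xi => K * rho xi)).
  - move=> n; apply: cmeasM => //; case: dh => -[h1 h2] _.
    by split; [apply: (measurableT_comp h1)|apply: (measurableT_comp h2)]; exact: measurable_shear.
  - by apply: cmeasM => //; exact: cmeas_cst.
  - exact: integrable_Krho.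
  - move=> n w; rewrite Normc.normcM normc_real (ger0_norm (ltW (rho_gt0 _))).
    by rewrite ler_wpM2r ?(ltW (rho_gt0 _))// (decay_bound _ dh).
  - move=> w; apply: (@eq_seq_cvg _ _ (fun n => normc (h (shear (eps n / (2 * pi))
       (eps n / (2 * pi)) 0 x w) - h x) * normc (rho w)%:C)).
      by move=> n; rewrite -mulrBl Normc.normcM.
    rewrite -[X in _ --> X](mul0r (normc (rho w)%:C)); apply: cvgM; last exact: cvg_cst.
    have cs : shear (eps n / (2 * pi)) (eps n / (2 * pi)) 0 x w @[n --> \oo] --> x.
      have ce : eps n / (2 * pi) @[n --> \oo] --> (0 : R).
        by rewrite -[X in _ --> X](mul0r (2 * pi)^-1); apply: cvgM => //; exact: cvg_cst.
      have cw (y t : R) : y + eps n / (2 * pi) * t @[n --> \oo] --> y.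
        rewrite -[X in _ --> X]addr0; apply: cvgD; first exact: cvg_cst.
        by rewrite -[X in _ --> X](mul0r t); apply: cvgM => //; exact: cvg_cst.
      apply/cvg_ballP => e ep.
      have /cvg_ballP /(_ _ ep) c1 := cw x.1 w.1; have /cvg_ballP /(_ _ ep) c2 := cw x.2 w.2.
      by near=> n; split; rewrite /= ?mul0r ?addr0; near: n.
    have c1 := cvg_comp _ _ cs (cre x); have c2 := cvg_comp _ _ cs (cim x).
    have c12 : `|re h (shear (eps n / (2 * pi)) (eps n / (2 * pi)) 0 x w) - re h x| +
       `|im h (shear (eps n / (2 * pi)) (eps n / (2 * pi)) 0 x w) - im h x| @[n --> \oo] --> (0 : R).
      by rewrite -[X in _ --> X]addr0; apply: cvgD; apply/norm_cvg0P; apply/subr_cvg0.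
    apply: squeeze_cvgr (cvg_cst 0) c12; apply: nearW => n; apply/andP; split; first exact: normc_ge0.
    by rewrite (le_trans (normc_le _))// !(ReDc, ImDc, ReNc, ImNc).
have hx : h x = (pi ^- 2)%:C * cint l2 (fun w => h x * (rho w)%:C).
  rewrite cintZ; last first.
    have := decay_cintble (K := 1) (h := fun w : R * R => (rho w)%:C); apply; split => // w.
    by rewrite normc_real mul1r ger0_norm// ltW// rho_gt0.
  rewrite cint_real Rintegral_rho mulrCA -rmorphM /= mulVf ?mulr1//.
  by rewrite expf_neq0 ?gt_eqF.
apply/eqP; rewrite -subr_eq0 -normc_eq0 eq_le normc_ge0 andbT.
set u := (X in X @ \oo --> _) in lhs; set w := (X in X @ \oo --> _) in rhs.
have uw : u n + pi ^- 2 * w n @[n --> \oo] --> (0 : R).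
  rewrite -[X in _ --> X]addr0 -[X in _ + X](mulr0 (pi ^- 2)); apply: cvgD => //.
  by apply: cvgM => //; exact: cvg_cst.
apply: (ge0_cvg_le _ uw) => n; rewrite /u /w.
rewrite (FT_mult dh (decay_abel x (e01 n))) (abel_mean x (e01 n) dh).
have p2 : 0 <= pi ^- 2 :> R by rewrite invr_ge0 exprn_ge0 ?(ltW pi0).
rewrite -[X in _ + X * _](ger0_norm p2).
rewrite -normc_real -Normc.normcM mulrBr -hx.
have tri (A B c : C) : normc (B - c) <= normc (A - B) + normc (A - c).
  have -> : B - c = (A - c) - (A - B) by ring.
  by rewrite (le_trans (normcB _ _))// addrC.
exact: tri.
Unshelve. all: end_near. Qed.

End Inversion.

(** * Smooth functions of two variables along lines *)

Section Smooth2.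
Context {R : realType}.
Implicit Types (f : R * R -> R) (x y v : R * R) (s : seq 'I_2).

(** Directional derivatives become ordinary derivatives along a line, the form in which the Taylor
    estimates are made. *)
Lemma line_derive f x v (t : R) : derivable f (t *: v + x) v ->
  is_derive t 1 (fun t : R => f (t *: v + x)) ('D_v f (t *: v + x)).
Proof.
move=> df; have E : (fun h : R => h^-1 *: ((f \o shift (t *: v + x)) (h *: v) - f (t *: v + x))) =
  (fun h : R => h^-1 *: (((fun t : R => f (t *: v + x)) \o shift t) (h *: (1 : R)) - f (t *: v + x))).
  apply/funext => h /=; congr (_ *: (f _ - _)).
  by rewrite addrA -scalerDl [h *: 1]mulr1.
by apply: DeriveDef; [move: df; rewrite /derivable E|rewrite /derive E].
Qed.

Lemma smooth2_line f s i x (t : R) : smooth2 f ->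
  is_derive t 1 (fun t : R => pderivs s f (t *: axis i + x))
    (pderivs (i :: s) f (t *: axis i + x)).
Proof. by move=> sf; apply: line_derive; case: (sf s). Qed.

Lemma pderivs_lin f g (a : R) s : smooth2 f -> smooth2 g ->
  pderivs s (fun x => a * f x + g x) = (fun x => a * pderivs s f x + pderivs s g x).
Proof.
move=> sf sg; elim: s => [//|i s IH]; rewrite /= IH; apply/funext => x.
rewrite /pderiv; have df := (sf s).2 i x; have dg := (sg s).2 i x.
have -> : (fun x => a * pderivs s f x + pderivs s g x) = (a \*: pderivs s f + pderivs s g) by [].
by rewrite deriveD ?deriveZ//; exact: derivableZ.
Qed.

Lemma smooth2_lin f g (a : R) : smooth2 f -> smooth2 g ->
  smooth2 (fun x => a * f x + g x).
Proof.
move=> sf sg s; rewrite pderivs_lin//; split.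
  move=> x; apply: cvgD; last exact: ((sg s).1 x).
  by apply: cvgM; [exact: cvg_cst|exact: ((sf s).1 x)].
move=> i x; have -> : (fun x => a * pderivs s f x + pderivs s g x) = (a \*: pderivs s f + pderivs s g) by [].
by apply: derivableD; [apply: derivableZ; exact: ((sf s).2 i x)|exact: ((sg s).2 i x)].
Qed.

Lemma pderivs_shift f y s :
  pderivs s (fun x => f (x - y)) = (fun x => pderivs s f (x - y)).
Proof.
elim: s => [//|i s IH]; rewrite /= IH; apply/funext => x.
rewrite /pderiv /derive.
have -> : (fun h : R => h^-1 *: (((fun x0 => pderivs s f (x0 - y)) \o shift x) (h *: axis i) -
    pderivs s f (x - y))) =
  (fun h : R => h^-1 *: ((pderivs s f \o shift (x - y)) (h *: axis i) - pderivs s f (x - y))).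
  by apply/funext => h /=; rewrite addrA.
by [].
Qed.

Lemma smooth2_shift f y : smooth2 f -> smooth2 (fun x => f (x - y)).
Proof.
move=> sf s; rewrite pderivs_shift; split.
  move=> x; apply: (@continuous_comp _ _ _ (fun x => x - y) (pderivs s f)).
    by apply: cvgB; [exact: cvg_id|exact: cvg_cst].
  exact: (sf s).1.
move=> i x; have := (sf s).2 i (x - y); rewrite /derivable.
have -> : (fun h : R => h^-1 *: (((fun x0 => pderivs s f (x0 - y)) \o shift x) (h *: axis i) -
    pderivs s f (x - y))) =
  (fun h : R => h^-1 *: ((pderivs s f \o shift (x - y)) (h *: axis i) - pderivs s f (x - y))).
  by apply/funext => h /=; rewrite addrA.
by [].
Qed.

End Smooth2.

(** * Schwartz functions *)

Section Schwartz.
Context {R : realType}.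
Local Notation C := (R[i]).
Local Notation l2 := (@leb2 R).
Local Notation plane := (measurableTypeR R * measurableTypeR R)%type.
Local Notation normc := (@Normc.normc R).
Implicit Types (g h : R * R -> C) (x xi v y : R * R) (a b : nat * nat).

Definition bword b : seq 'I_2 := nseq b.1 (0 : 'I_2) ++ nseq b.2 (1 : 'I_2).

Lemma cderivE b g x : cderiv b g x =
  pderivs (bword b) (re g) x +i* pderivs (bword b) (im g) x.
Proof. by []. Qed.

Lemma cderiv00 g : cderiv (0%N, 0%N) g = g.
Proof. by apply/funext => x; rewrite cderivE /=; apply: complex_eq. Qed.

Lemma seminorm_le a b g (K : R) :
  (forall x, `|x.1 ^+ a.1 * x.2 ^+ a.2| * normc (cderiv b g x) <= K) ->
  (seminorm a b g <= K%:E)%E.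
Proof. by move=> H; apply: ge_ereal_sup => _ [x _ <-]; rewrite lee_fin. Qed.

Lemma seminorm_ub a b g x :
  ((`|x.1 ^+ a.1 * x.2 ^+ a.2| * normc (cderiv b g x))%:E <= seminorm a b g)%E.
Proof. by apply: ereal_sup_ubound; exists x. Qed.

Lemma schwartz_bound g a b : schwartz g -> exists K : R,
  forall x, `|x.1 ^+ a.1 * x.2 ^+ a.2| * normc (cderiv b g x) <= K.
Proof.
case=> _ _ /(_ a b) fin; exists (fine (seminorm a b g)) => x.
rewrite -lee_fin fineK; first exact: seminorm_ub.
rewrite ge0_fin_numE//; apply: le_trans (seminorm_ub a b g (0, 0)).
by rewrite lee_fin mulr_ge0// normc_ge0.
Qed.

Lemma re_lin (c : C) g h : re (fun x => c * g x + h x) =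
  (fun x => complex.Re c * re g x + ((- complex.Im c) * im g x + re h x)).
Proof. by apply/funext => x; rewrite /re /im ReDc ReMc mulNr addrA. Qed.

Lemma im_lin (c : C) g h : im (fun x => c * g x + h x) =
  (fun x => complex.Re c * im g x + (complex.Im c * re g x + im h x)).
Proof. by apply/funext => x; rewrite /re /im ImDc ImMc addrA. Qed.

Lemma cderiv_lin (c : C) g h b : smooth2 (re g) -> smooth2 (im g) ->
  smooth2 (re h) -> smooth2 (im h) ->
  cderiv b (fun x => c * g x + h x) = (fun x => c * cderiv b g x + cderiv b h x).
Proof.
move=> g1 g2 h1 h2; apply/funext => x; rewrite !cderivE re_lin im_lin.
rewrite (pderivs_lin _ _ g1 (smooth2_lin _ g2 h1)) (pderivs_lin _ _ g2 h1).
rewrite (pderivs_lin _ _ g2 (smooth2_lin _ g1 h2)) (pderivs_lin _ _ g1 h2).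
by apply: complex_eq; rewrite ?ReDc ?ImDc ?ReMc ?ImMc /= ?mulNr addrA.
Qed.

Lemma schwartz_lin (c : C) g h : schwartz g -> schwartz h ->
  schwartz (fun x => c * g x + h x).
Proof.
move=> sg sh; have [g1 g2 _] := sg; have [h1 h2 _] := sh; split.
- by rewrite re_lin; exact: (smooth2_lin _ g1 (smooth2_lin _ g2 h1)).
- by rewrite im_lin; exact: (smooth2_lin _ g2 (smooth2_lin _ g1 h2)).
move=> a b; have [K HK] := schwartz_bound a b sg; have [L HL] := schwartz_bound a b sh.
apply: le_lt_trans (ltry (normc c * K + L)); apply: seminorm_le => x.
rewrite cderiv_lin// (le_trans (ler_wpM2l (normr_ge0 _) (le_normcD _ _)))//.
by rewrite mulrDr lerD// Normc.normcM mulrCA ler_wpM2l// normc_ge0.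
Qed.

Lemma schwartz0 g : schwartz g -> schwartz (fun _ : R * R => 0 : C).
Proof.
move=> sg; have := schwartz_lin (-1) sg sg; congr schwartz.
by apply/funext => x; rewrite mulN1r addNr.
Qed.

Lemma schwartz_sum (I : Type) (s : seq I) (c : I -> C) (e : I -> R * R -> C) g :
  schwartz g -> (forall i, schwartz (e i)) ->
  schwartz (fun x => \sum_(i <- s) c i * e i x).
Proof.
move=> sg se; elim: s => [|i s IH].
  by under eq_fun do rewrite big_nil; exact: schwartz0 sg.
by under eq_fun do rewrite big_cons; exact: schwartz_lin.
Qed.

Lemma cderiv_sum (I : Type) (s : seq I) (c : I -> C) (e : I -> R * R -> C) g b :
  schwartz g -> (forall i, schwartz (e i)) ->
  cderiv b (fun x => \sum_(i <- s) c i * e i x) =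
  (fun x => \sum_(i <- s) c i * cderiv b (e i) x).
Proof.
move=> sg se; elim: s => [|i s IH].
  have [z1 z2 _] := schwartz0 sg.
  have E : (fun x => \sum_(i <- [::]) c i * e i x) = (fun x : R * R => (-1) * (fun=> 0) x + (fun=> 0) x).
    by apply/funext => x; rewrite big_nil mulr0 addr0.
  rewrite E cderiv_lin//; apply/funext => x; rewrite big_nil mulN1r addNr//.
have [i1 i2 _] := se i; have [s1 s2 _] := schwartz_sum s c sg se.
under eq_fun do rewrite big_cons.
rewrite cderiv_lin// IH; apply/funext => x.
by rewrite big_cons.
Qed.

Lemma schwartz_conj g : schwartz g -> schwartz (fun x => (g x)^*).
Proof.
move=> sg; have [g1 g2 _] := sg; have [z1 z2 _] := schwartz0 sg.
have Er : re (fun x => (g x)^*) = re g.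
  by apply/funext => x; rewrite /re ReJc.
have Ei : im (fun x => (g x)^*) = (fun x => (-1) * im g x + re (fun=> 0 : C) x).
  by apply/funext => x; rewrite /im /re ImJc /= mulN1r addr0.
have s2 : smooth2 (im (fun x => (g x)^*)) by rewrite Ei; exact: (smooth2_lin _ g2 z1).
split; rewrite ?Er// => a b.
have [K HK] := schwartz_bound a b sg.
apply: le_lt_trans (ltry K); apply: seminorm_le => x.
rewrite (_ : normc _ = normc (cderiv b g x))//.
rewrite !cderivE Er Ei (pderivs_lin _ _ g2 z1) -normc_conj; congr normc.
apply: complex_eq => //=.
have := congr1 (fun f => f x) (pderivs_lin (-1) (bword b) z1 z1).
rewrite (_ : (fun x => -1 * re (fun=> 0 : C) x + re (fun=> 0) x) = re (fun=> 0 : C)); last first.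
  by apply/funext => z; rewrite /re /= mulr0 addr0.
by rewrite mulN1r addNr => ->; rewrite addr0 mulN1r opprK.
Qed.

Lemma cderiv_conj g b x : schwartz g ->
  cderiv b (fun x => (g x)^*) x = (cderiv b g x)^*.
Proof.
move=> sg; have [g1 g2 _] := sg; have [z1 z2 _] := schwartz0 sg.
have Er : re (fun x => (g x)^*) = re g.
  by apply/funext => z; rewrite /re ReJc.
have Ei : im (fun x => (g x)^*) = (fun x => (-1) * im g x + re (fun=> 0 : C) x).
  by apply/funext => z; rewrite /im /re ImJc /= mulN1r addr0.
rewrite !cderivE Er Ei (pderivs_lin _ _ g2 z1); apply: complex_eq => //=.
have := congr1 (fun f => f x) (pderivs_lin (-1) (bword b) z1 z1).
rewrite (_ : (fun x => -1 * re (fun=> 0 : C) x + re (fun=> 0) x) = re (fun=> 0 : C)); last first.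
  by apply/funext => z; rewrite /re /= mulr0 addr0.
by rewrite mulN1r addNr => ->; rewrite addr0 mulN1r.
Qed.

Lemma cderiv_shift g y b : cderiv b (fun x => g (x - y)) =
  (fun x => cderiv b g (x - y)).
Proof.
apply/funext => x; rewrite !cderivE.
have -> : re (fun x => g (x - y)) = (fun x => re g (x - y)) by [].
have -> : im (fun x => g (x - y)) = (fun x => im g (x - y)) by [].
by rewrite !pderivs_shift.
Qed.

Lemma cderiv_continuous g b : schwartz g ->
  continuous (re (cderiv b g)) /\ continuous (im (cderiv b g)).
Proof. by case=> g1 g2 _; split; [exact: (g1 (bword b)).1|exact: (g2 (bword b)).1]. Qed.

(** Four seminorms enter because the reciprocal of [rho] expands into four monomials. *)
Lemma schwartz_decay g b m n : schwartz g -> exists2 K : R, 0 <= K &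
  decay K (fun x => (x.1 ^+ m * x.2 ^+ n)%:C * cderiv b g x).
Proof.
move=> sg.
have [K0 H0] := schwartz_bound (m, n) b sg.
have [K1 H1] := schwartz_bound (m.+2, n) b sg.
have [K2 H2] := schwartz_bound (m, n.+2) b sg.
have [K3 H3] := schwartz_bound (m.+2, n.+2) b sg.
suff : decay (K0 + K1 + K2 + K3) (fun x => (x.1 ^+ m * x.2 ^+ n)%:C * cderiv b g x).
  by move=> d; exists (K0 + K1 + K2 + K3) => //; exact: decay_ge0 d.
split.
  have [c1 c2] := cderiv_continuous b sg; apply: cmeasM.
    apply: cmeas_real; apply: measurable_funM; apply: measurable_funX.
      exact: measurable_fst.
    exact: measurable_snd.
  by split; apply: continuous_measurable_plane.
move=> x; rewrite Normc.normcM normc_real /rho /rho1 -invfM ler_pdivlMr; last first.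
  by rewrite mulr_gt0// ltr_pwDl ?sqr_ge0.
have E (p q : nat) : `|x.1 ^+ (p + m) * x.2 ^+ (q + n)| = `|x.1| ^+ p * `|x.2| ^+ q * `|x.1 ^+ m * x.2 ^+ n|.
  by rewrite !normrM !normrX !exprD; ring.
move: (H0 x) (H1 x) (H2 x) (H3 x); set N := normc (cderiv b g x) => /=.
rewrite (E 2 2)%N (E 2 0)%N (E 0 2)%N !real_normK ?num_real// !expr0 !mul1r !mulr1.
move: (`|x.1 ^+ m * x.2 ^+ n|) N (x.1 ^+ 2) (x.2 ^+ 2) => A B s t *.
lra.
Qed.

Lemma cderiv_decay g b : schwartz g -> exists2 K : R, 0 <= K & decay K (cderiv b g).
Proof.
move=> sg; have [K K0 dK] := schwartz_decay b 0 0 sg; exists K => //.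
move: dK; congr (decay K _); apply/funext => x.
by rewrite !expr0 mulr1 mul1r.
Qed.

End Schwartz.

(** * The Fourier transform of Schwartz functions *)

Section SchwartzFourier.
Context {R : realType}.
Local Notation C := (R[i]).
Local Notation l2 := (@leb2 R).
Local Notation plane := (measurableTypeR R * measurableTypeR R)%type.
Local Notation normc := (@Normc.normc R).
Implicit Types (g h : R * R -> C) (x xi v y : R * R) (a b : nat * nat).

Definition nextb (i : 'I_2) b : nat * nat :=
  if i == 0 then (b.1.+1, b.2) else (b.1, b.2.+1).

(* The words of [cderiv] put the derivatives in the first variable outside. *)
Definition nextable (i : 'I_2) b : Prop := i = 0 \/ b.1 = 0%N.

Lemma bword_next i b : nextable i b -> bword (nextb i b) = i :: bword b.
Proof.
rewrite /nextable /nextb; case: eqP => [->//|i0 [//|]].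
case: b => b1 b2 /= ->; rewrite /bword /=; congr (_ :: _).
by apply/val_inj; move: i i0 => [[|[|i]] Hi] //= i0; case: i0; apply/val_inj.
Qed.

Lemma cderiv_line g b i x (t : R) : schwartz g -> nextable i b ->
  is_derive t 1 (fun t : R => re (cderiv b g) (t *: axis i + x))
    (re (cderiv (nextb i b) g) (t *: axis i + x)) /\
  is_derive t 1 (fun t : R => im (cderiv b g) (t *: axis i + x))
    (im (cderiv (nextb i b) g) (t *: axis i + x)).
Proof.
move=> [g1 g2 _] ib.
have E1 c : re (cderiv c g) = pderivs (bword c) (re g) by [].
have E2 c : im (cderiv c g) = pderivs (bword c) (im g) by [].
by rewrite !E1 !E2 bword_next//; split; exact: smooth2_line.
Qed.

Lemma nextable_next i b : nextable i b -> nextable i (nextb i b).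
Proof.
rewrite /nextable /nextb; case: eqP => [->|i0]; first by left.
by case=> [//|b0]; right.
Qed.

Lemma axis_line i x (t : R) : t *: axis i + x =
  (if i == 0 then (x.1 + t, x.2 + 0) else (x.1 + 0, x.2 + t)) :> R * R.
Proof.
rewrite /axis; case: eqP => [->|i0].
  by apply: injective_projections; rewrite /= /GRing.scale /= ?mulr1 ?mulr0; ring.
have -> : (i == 1) = true.
  by apply/eqP/val_inj; move: i i0 => [[|[|i]] Hi] //= i0; case: i0; apply/val_inj.
by apply: injective_projections; rewrite /= /GRing.scale /= ?mulr1 ?mulr0; ring.
Qed.

(** The remainder in the form required by [FT_deriv]. In the constant 18, a factor 9 pays for moving
    the argument of [rho] by at most 1 and a factor 2 for adding the real and imaginary parts. *)
Lemma cderiv_taylor g b i : schwartz g -> nextable i b -> exists B : R,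
  forall (t : R) x, 0 < t <= 1 ->
    normc (cderiv b g (t *: axis i + x) - cderiv b g x - t%:C * cderiv (nextb i b) g x) <=
      t ^+ 2 * (B * rho x).
Proof.
move=> sg ib; have [K K0 [_ dK]] := cderiv_decay (nextb i (nextb i b)) sg.
exists (18 * K) => t x /andP[t0 t1].
have bnd (s : R) : `|s| <= `|t| ->
    normc (cderiv (nextb i (nextb i b)) g (s *: axis i + x)) <= 9 * K * rho x.
  rewrite (gtr0_norm t0) => st; have s1 : `|s| <= 1 by exact: le_trans st t1.
  rewrite (le_trans (dK _))// [9 * K]mulrC -mulrA ler_wpM2l// axis_line.
  by case: ifP => _; apply: rho_shift; rewrite ?normr0.
have main (f f' f'' : R * R -> R) :
   (forall s : R, is_derive s 1 (fun t : R => f (t *: axis i + x)) (f' (s *: axis i + x))) ->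
   (forall s : R, is_derive s 1 (fun t : R => f' (t *: axis i + x)) (f'' (s *: axis i + x))) ->
   (forall s : R, `|s| <= `|t| -> `|f'' (s *: axis i + x)| <= 9 * K * rho x) ->
   `|f (t *: axis i + x) - f x - t * f' x| <= 9 * K * rho x * t ^+ 2.
  move=> d1 d2 H.
  have := @taylor2 R (fun t : R => f (t *: axis i + x)) (fun t : R => f' (t *: axis i + x))
    (fun t : R => f'' (t *: axis i + x)) (9 * K * rho x) 0 t d1 d2 _.
  rewrite add0r scale0r add0r; apply => s; rewrite subr0; exact: H.
have nb := nextable_next ib.
rewrite (le_trans (normc_le _))//.
have -> : t ^+ 2 * (18 * K * rho x) = 9 * K * rho x * t ^+ 2 + 9 * K * rho x * t ^+ 2 by ring.
apply: lerD.
  rewrite !ReDc !ReNc ReMc /= mul0r subr0.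
  apply: (main (re (cderiv b g)) (re (cderiv (nextb i b) g)) (re (cderiv (nextb i (nextb i b)) g))).
  - by move=> s; case: (cderiv_line x s sg ib).
  - by move=> s; case: (cderiv_line x s sg nb).
  - by move=> s /bnd; apply: le_trans; exact: normc_Re.
rewrite !ImDc !ImNc ImMc /= mul0r addr0.
apply: (main (im (cderiv b g)) (im (cderiv (nextb i b) g)) (im (cderiv (nextb i (nextb i b)) g))).
- by move=> s; case: (cderiv_line x s sg ib).
- by move=> s; case: (cderiv_line x s sg nb).
- by move=> s /bnd; apply: le_trans; exact: normc_Im.
Qed.

Lemma dot_axis i xi : dot xi (axis i) = if i == 0 then xi.1 else xi.2.
Proof.
rewrite /dot /axis /=; case: eqP => [->|i0]; first by rewrite mulr1 mulr0 addr0.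
have -> : (i == 1) = true.
  by apply/eqP/val_inj; move: i i0 => [[|[|i]] Hi] //= i0; case: i0; apply/val_inj.
by rewrite mulr1 mulr0 add0r.
Qed.

Definition tpi (t : R) : C := 0 +i* (2 * pi * t).
Definition fpow b xi : C := tpi xi.1 ^+ b.1 * tpi xi.2 ^+ b.2.

Lemma FT_cderiv g b xi : schwartz g -> FT (cderiv b g) xi = fpow b xi * FT g xi.
Proof.
move=> sg.
have step i c : nextable i c -> FT (cderiv (nextb i c) g) xi =
    tpi (if i == 0 then xi.1 else xi.2) * FT (cderiv c g) xi.
  move=> ic; have [K _ dK] := cderiv_decay c sg.
  have [L _ dL] := cderiv_decay (nextb i c) sg; have [B HB] := cderiv_taylor sg ic.
  by rewrite (FT_deriv xi dK dL HB) dot_axis.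
case: b => m n; rewrite /fpow /=; elim: m => [|m IH].
  rewrite expr0 mul1r; elim: n => [|n IH]; first by rewrite cderiv00 expr0 mul1r.
  have := step 1 (0%N, n); rewrite /nextb /= => ->; last by right.
  by rewrite IH exprS mulrA.
have := step 0 (m, n); rewrite /nextb /= => ->; last by left.
by rewrite IH exprS !mulrA.
Qed.

Lemma normc_tpi t : normc (tpi t) = 2 * pi * `|t|.
Proof.
rewrite normcE /tpi /= expr0n add0r sqrtr_sqr normrM ger0_norm//.
by rewrite mulr_ge0// pi_ge0.
Qed.

Lemma FT_schwartz_cmeas g : schwartz g -> @cmeas _ _ plane (FT g).
Proof. by move=> sg; have [K _ dK] := cderiv_decay (0%N, 0%N) sg; move: dK; rewrite cderiv00 => /FT_cmeas. Qed.

Lemma FT_schwartz_bound g m n : schwartz g -> exists K : R,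
  forall xi, `|xi.1| ^+ m * `|xi.2| ^+ n * normc (FT g xi) <= K.
Proof.
move=> sg; have [K K0 dK] := cderiv_decay (m, n) sg; exists (K * pi ^+ 2) => xi.
have := FT_bound xi dK; rewrite FT_cderiv// /fpow !Normc.normcM !normcX !normc_tpi.
apply: le_trans; rewrite ler_wpM2r ?normc_ge0// !exprMn.
have p : 1 <= 2 * pi :> R by have := pi_ge2 R; lra.
have pm : 1 <= 2 ^+ m * pi ^+ m :> R by rewrite -exprMn exprn_ege1.
have pn : 1 <= 2 ^+ n * pi ^+ n :> R by rewrite -exprMn exprn_ege1.
by rewrite ler_pM ?exprn_ge0// ler_peMl ?exprn_ge0.
Qed.

Lemma FT_schwartz_decay g m n : schwartz g -> exists2 K : R, 0 <= K &
  forall xi, `|xi.1| ^+ m * `|xi.2| ^+ n * normc (FT g xi) <= K * rho xi.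
Proof.
move=> sg.
have [K0 H0] := FT_schwartz_bound m n sg.
have [K1 H1] := FT_schwartz_bound m.+2 n sg.
have [K2 H2] := FT_schwartz_bound m n.+2 sg.
have [K3 H3] := FT_schwartz_bound m.+2 n.+2 sg.
have H xi : `|xi.1| ^+ m * `|xi.2| ^+ n * normc (FT g xi) <= (K0 + K1 + K2 + K3) * rho xi.
  rewrite /rho /rho1 -invfM ler_pdivlMr; last by rewrite mulr_gt0// ltr_pwDl ?sqr_ge0.
  move: (H0 xi) (H1 xi) (H2 xi) (H3 xi).
  have E k (t : R) : `|t| ^+ k.+2 = t ^+ 2 * `|t| ^+ k.
    by rewrite -[t ^+ 2]real_normK ?num_real// -exprD.
  rewrite !E; set N := normc _.
  move: (`|xi.1| ^+ m) (`|xi.2| ^+ n) (xi.1 ^+ 2) (xi.2 ^+ 2) => A B s t.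
  lra.
exists (K0 + K1 + K2 + K3) => //.
have := H (0, 0); have : 0 <= `|0 : R| ^+ m * `|0 : R| ^+ n * normc (FT g (0, 0)).
  by rewrite !mulr_ge0 ?exprn_ge0// normc_ge0.
by move=> /le_trans H' /H'; rewrite pmulr_lge0 ?rho_gt0.
Qed.

Lemma measurable_fpow b : @cmeas _ _ plane (fpow b).
Proof.
have mt (f : plane -> R) : measurable_fun setT f -> forall n, cmeas (fun x => tpi (f x) ^+ n).
  move=> mf; elim=> [|n IH]; first by under eq_fun do rewrite expr0; exact: cmeas_cst.
  under eq_fun do rewrite exprS; apply: cmeasM => //; split; first exact: measurable_cst.
  exact: measurable_funM.
by apply: cmeasM; apply: mt; [exact: measurable_fst|exact: measurable_snd].
Qed.

Lemma FT_fpow_decay g b : schwartz g -> exists K : R, decay K (fun xi => fpow b xi * FT g xi).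
Proof.
move=> sg; have [K K0 H] := FT_schwartz_decay b.1 b.2 sg.
exists ((2 * pi) ^+ b.1 * (2 * pi) ^+ b.2 * K); split.
  by apply: cmeasM; [exact: measurable_fpow|exact: FT_schwartz_cmeas].
move=> xi; rewrite /fpow !Normc.normcM !normcX !normc_tpi !exprMn.
have p0 : 0 <= 2 * pi :> R by rewrite mulr_ge0// pi_ge0.
have := ler_wpM2l (mulr_ge0 (exprn_ge0 b.1 p0) (exprn_ge0 b.2 p0)) (H xi).
rewrite !exprMn; lra.
Qed.

(** Inversion is applied to the derivative itself, whose transform is known from [FT_cderiv];
    nothing is differentiated under the integral sign. *)
Lemma schwartz_inversion g b x : schwartz g ->
  cderiv b g x = IFT (fun xi => fpow b xi * FT g xi) x.
Proof.
move=> sg; have [K _ dK] := cderiv_decay b sg; have [L dL] := FT_fpow_decay b sg.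
have E : FT (cderiv b g) = (fun xi => fpow b xi * FT g xi).
  by apply/funext => xi; exact: FT_cderiv.
have [c1 c2] := cderiv_continuous b sg.
by move: dL; rewrite -E => dL; rewrite (FT_inversion x dK dL c1 c2).
Qed.

Lemma schwartz_moment g : schwartz g -> exists2 K : R, 0 <= K & decay K g /\
  forall v x, normc (g x) * `|dot v x| <= (`|v.1| + `|v.2|) * K * rho x.
Proof.
move=> sg.
have [K1 K10 [m1 H1]] := schwartz_decay (0%N, 0%N) 0 0 sg.
have [K2 K20 [_ H2]] := schwartz_decay (0%N, 0%N) 2 0 sg.
have [K3 K30 [_ H3]] := schwartz_decay (0%N, 0%N) 0 2 sg.
exists (K1 + K2 + K3); first by rewrite !addr_ge0.
have H x : normc (g x) * (1 + x.1 ^+ 2 + x.2 ^+ 2) <= (K1 + K2 + K3) * rho x.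
  move: (H1 x) (H2 x) (H3 x); rewrite !cderiv00 !Normc.normcM !normc_real !expr0 !mul1r !mulr1.
  rewrite normr1 !ger0_norm ?sqr_ge0//; lra.
split.
  split; first by have [K K0 dK] := cderiv_decay (0%N, 0%N) sg; move: dK; rewrite cderiv00 => -[].
  move=> x; apply: le_trans (H x); rewrite ler_peMr ?normc_ge0//.
  by rewrite -addrA lerDl addr_ge0 ?sqr_ge0.
move=> v x; set s := `|v.1| + `|v.2|; have s0 : 0 <= s by rewrite addr_ge0.
have d1 : `|dot v x| <= s * (`|x.1| + `|x.2|).
  rewrite /dot (le_trans (ler_normD _ _))// !normrM /s.
  have := mulr_ge0 (normr_ge0 v.1) (normr_ge0 x.2); have := mulr_ge0 (normr_ge0 v.2) (normr_ge0 x.1).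
  lra.
have q1 : x.1 ^+ 2 = `|x.1| ^+ 2 by rewrite real_normK ?num_real.
have q2 : x.2 ^+ 2 = `|x.2| ^+ 2 by rewrite real_normK ?num_real.
have d2 : `|dot v x| <= s * (1 + x.1 ^+ 2 + x.2 ^+ 2).
  apply: le_trans d1 _; rewrite ler_wpM2l// q1 q2.
  have := sqr_ge0 (`|x.1| - 1 / 2); have := sqr_ge0 (`|x.2| - 1 / 2); lra.
have := ler_wpM2l s0 (H x); have := ler_wpM2l (normc_ge0 (g x)) d2; lra.
Qed.

(** Boundedness and a global Lipschitz bound are the regularity on which the convergence of the
    Fejer means will rest. *)
Lemma FT_schwartz_lip g : schwartz g -> exists2 K : R, 0 <= K &
  (forall xi, normc (FT g xi) <= K) /\
  forall v xi, normc (FT g (xi + v) - FT g xi) <= (`|v.1| + `|v.2|) * K.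
Proof.
move=> sg; have [K K0 [dK H]] := schwartz_moment sg.
have p0 : 0 <= pi :> R := pi_ge0 R.
have p2 : 0 <= pi ^+ 2 :> R := sqr_ge0 _.
have p1 : 1 <= pi :> R by have := pi_ge2 R; lra.
exists (8 * pi ^+ 2 * K * pi ^+ 2); first by rewrite !mulr_ge0.
have Kp : 0 <= K * pi ^+ 2 by rewrite mulr_ge0.
have pp : pi <= pi ^+ 2 :> R by rewrite expr2 ler_peMl.
split.
- move=> xi; rewrite (le_trans (FT_bound xi dK))//.
  have := ler_wpM2r Kp pp; have := ler_wpM2r Kp p1; lra.
- move=> v xi; have s0 : 0 <= `|v.1| + `|v.2| by rewrite addr_ge0.
  have B0 : 0 <= (`|v.1| + `|v.2|) * K by rewrite mulr_ge0.
  rewrite (le_trans (FT_Lip xi B0 dK (H v)))//.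
  have := ler_wpM2r (mulr_ge0 s0 Kp) pp; have := mulr_ge0 (mulr_ge0 s0 Kp) p2; lra.
Qed.

End SchwartzFourier.

(** * Derivatives bounded by a power of the scale *)

Section Jets.
Context {R : realType}.
Implicit Types (f : nat -> R -> R) (phi psi : R -> R).

(** A quadratic remainder pins down the derivative; this converts the estimates of the Fourier
    calculus into derivatives. *)
Lemma is_derive_quad (f : R -> R) (t l B : R) :
  (forall s, `|f (s + t) - f t - s * l| <= s ^+ 2 * B) -> is_derive t 1 f l.
Proof.
move=> H; have B0 : 0 <= B by have := le_trans (normr_ge0 _) (H 1); rewrite expr1n mul1r.
have cv : h^-1 *: ((f \o shift t) (h *: (1 : R)) - f t) @[h --> 0^'] --> l.
  apply/cvgrPdist_le => e e0; rewrite near_withinE.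
  have e1 : 0 < e / (B + 1) by rewrite divr_gt0// ltr_pwDr.
  near=> s => s0.
  rewrite /= [s *: 1]mulr1 distrC.
  have -> : s^-1 *: (f (s + t) - f t) - l = s^-1 * (f (s + t) - f t - s * l).
    by rewrite /GRing.scale /=; field.
  rewrite normrM normfV ler_pdivrMl ?normr_gt0// (le_trans (H s))//.
  rewrite -[s ^+ 2]real_normK ?num_real// expr2 -mulrA ler_wpM2l//.
  have se : `|s| <= e / (B + 1).
    near: s; apply/nbhs_ballP; exists (e / (B + 1)) => // z.
    by rewrite -ball_normE /= sub0r normrN; exact: ltW.
  rewrite (le_trans (ler_wpM2r B0 se))// -mulrA ler_piMr ?(ltW e0)//.
  by rewrite mulrC ler_pdivrMr ?mul1r ?lerDl// ltr_pwDr.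
apply: DeriveDef; first by apply/cvg_ex; exists l.
exact: cvg_lim cv.
Unshelve. all: end_near. Qed.

(** A function with a chosen sequence of successive derivatives. Parts of Fourier integrals come in
    this form, each entry being an explicit integral, so no derivative operator has to be
    iterated. *)
Definition jet f := forall m (t : R), is_derive t 1 (f m) (f m.+1 t).

Lemma is_derive_continuous phi (t l : R) : is_derive t 1 phi l -> {for t, continuous phi}.
Proof.
by move=> d; apply: differentiable_continuous; apply/derivable1_diffP; case: d.
Qed.

Lemma eq_on_open_derive (S : set R) (f g : R -> R) (t df dg : R) : open S -> S t ->
  (forall t, S t -> f t = g t) -> is_derive t 1 f df -> is_derive t 1 g dg -> df = dg.
Proof.
move=> oS St fg [_ <-] [_ <-]; apply: near_eq_derive.
by near=> s; apply: fg; near: s; exact: open_nbhs_nbhs.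
Unshelve. all: end_near. Qed.

Lemma jet_eq0 (S : set R) f m : open S -> jet f -> (forall t, S t -> f 0%N t = 0) ->
  forall t, S t -> f m t = 0.
Proof.
move=> oS; elim: m f => [//|m IH] f jf f0; apply: (IH (fun n => f n.+1)).
  by move=> n; exact: jf.
move=> t St.
exact: (eq_on_open_derive oS St f0 (jf 0%N t) (is_derive_cst _ _ _)).
Qed.

(** On a coordinate line the two exceptional points will be its crossings with the diagonals, where
    the formula for the windows changes. *)
Lemma bounded_punctured (f : R -> R) (a b t B : R) : {for t, continuous f} ->
  (forall s, s != a -> s != b -> `|f s| <= B) -> `|f t| <= B.
Proof.
move=> cf H; have cn : `|f s| @[s --> t^'] --> `|f t|.
  by apply: cvg_norm; apply: cvg_within_filter; exact: cf.
apply: (@closed_cvg _ _ (t^') _ (fun s => `|f s|) (fun x => x <= B) _ _ _ cn).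
  exact: closed_le.
have na c : \forall s \near t^', s != c.
  have [->|ct] := eqVneq c t; first exact: nbhs_dnbhs_neq.
  apply: cvg_within; apply: open_nbhs_nbhs; split; first exact: open_neq.
  by rewrite /= eq_sym.
by near=> s; apply: H; near: s; exact: na.
Unshelve. all: end_near. Qed.

End Jets.

Section Tame.
Context {R : realType} (I : Type) (X : I -> R).
Hypothesis X1 : forall p, 1 <= X p.
Implicit Types (S : I -> set R) (phi psi q : I -> R -> R).

Definition pbounded S phi := exists (K : R) (M : nat), 0 <= K /\
  forall p t, S p t -> `|phi p t| <= K * X p ^+ M.

(* [m] times differentiable on the sets [S p], with all derivatives bounded by
   a power of [X p], uniformly in [p]. *)
Fixpoint tame S m phi : Prop := pbounded S phi /\
  match m with
  | 0 => True
  | m'.+1 => exists2 phi', (forall p t, S p t -> is_derive t 1 (phi p) (phi' p t)) &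
      tame S m' phi'
  end.

Lemma tameS S m phi : tame S m.+1 phi -> tame S m phi.
Proof.
elim: m phi => [|m IH] phi [pb [phi' d t]]; split=> //.
by exists phi' => //; exact: IH.
Qed.

Lemma pboundedM S phi psi : pbounded S phi -> pbounded S psi ->
  pbounded S (fun p t => phi p t * psi p t).
Proof.
move=> [K [M [K0 HK]]] [L [N [L0 HL]]]; exists (K * L), (M + N)%N; split; first exact: mulr_ge0.
by move=> p t St; rewrite normrM exprD mulrACA ler_pM// ?HK// HL.
Qed.

Lemma pboundedD S phi psi : pbounded S phi -> pbounded S psi ->
  pbounded S (fun p t => phi p t + psi p t).
Proof.
move=> [K [M [K0 HK]]] [L [N [L0 HL]]]; exists (K + L), (M + N)%N; split; first exact: addr_ge0.
move=> p t St; rewrite (le_trans (ler_normD _ _))// mulrDl lerD//.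
  rewrite (le_trans (HK p t St))// ler_wpM2l// exprD ler_peMr ?exprn_ege1//.
  by rewrite exprn_ge0// (le_trans ler01).
rewrite (le_trans (HL p t St))// ler_wpM2l// exprD ler_peMl ?exprn_ege1//.
by rewrite exprn_ge0// (le_trans ler01).
Qed.

Lemma tameD S m phi psi : tame S m phi -> tame S m psi ->
  tame S m (fun p t => phi p t + psi p t).
Proof.
elim: m phi psi => [|m IH] phi psi [pb1 h1] [pb2 h2]; split=> //; try exact: pboundedD.
case: h1 h2 => [phi' d1 t1] [psi' d2 t2].
exists (fun p t => phi' p t + psi' p t); last exact: IH.
by move=> p t St; apply: is_deriveD; [exact: d1|exact: d2].
Qed.

Lemma tameM S m phi psi : tame S m phi -> tame S m psi ->
  tame S m (fun p t => phi p t * psi p t).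
Proof.
elim: m phi psi => [|m IH] phi psi T1 T2.
  by split=> //; apply: pboundedM; [exact: T1.1|exact: T2.1].
split; first by apply: pboundedM; [exact: T1.1|exact: T2.1].
have s1 := tameS T1; have s2 := tameS T2.
case: T1 => _ [phi' d1 t1]; case: T2 => _ [psi' d2 t2].
exists (fun p t => phi p t * psi' p t + psi p t * phi' p t).
  by move=> p t St; have e1 := d1 p t St; have e2 := d2 p t St; exact: (is_deriveM e1 e2).
by apply: tameD; exact: IH.
Qed.

Lemma tame_const S m (c : I -> R) : pbounded S (fun p _ => c p) -> tame S m (fun p _ => c p).
Proof.
elim: m c => [|m IH] c pc; split=> //; exists (fun _ _ => 0).
  by move=> p t _; exact: is_derive_cst.
by apply: (IH (fun=> 0)); exists 0, 0%N; split=> // p t _; rewrite normr0 mul0r.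
Qed.

Lemma pbounded_const1 S (c : I -> R) (B : R) : (forall p t, S p t -> `|c p| <= B) ->
  pbounded S (fun p _ => c p).
Proof.
move=> H; exists `|B|, 0%N; split=> // p t St; rewrite expr0 mulr1.
by rewrite (le_trans (H p t St))// ler_norm.
Qed.

Lemma tame_id S m : pbounded S (fun p t => t) -> tame S m (fun p t => t).
Proof.
case: m => [|m] pb; split=> //; exists (fun _ _ => 1).
  by move=> p t _; exact: is_derive_id.
by apply: tame_const; apply: (@pbounded_const1 _ _ 1) => p t _; rewrite normr1.
Qed.

Lemma tameX S m n phi : tame S m phi -> tame S m (fun p t => phi p t ^+ n).
Proof.
move=> T; elim: n => [|n IH].
  under eq_fun => p do under eq_fun => t do rewrite expr0.
  by apply: tame_const; apply: (@pbounded_const1 _ _ 1) => p t _; rewrite normr1.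
under eq_fun => p do under eq_fun => t do rewrite exprS.
exact: tameM.
Qed.

Lemma tame_inv S m : (forall p t, S p t -> t != 0) -> pbounded S (fun p t => t^-1) ->
  tame S m (fun p t => t^-1).
Proof.
move=> S0 pb; elim: m => [|m IH]; split=> //; exists (fun p t => (-1) * (t^-1 * t^-1)).
  move=> p t St; apply: (is_derive_eq (is_deriveV (f := id) (S0 p t St) (is_derive_id t 1))).
  by rewrite /GRing.scale /= mulr1 -invfM expr2 mulN1r.
by apply: tameM; [apply: tame_const; apply: (@pbounded_const1 _ _ 1) => *; rewrite normrN normr1|exact: tameM].
Qed.

(** Only the derivative of the inner function [q] has to be tame. In the applications [q] contains
    the direction [l], which no power of the scale is assumed to bound; its derivative does not
    contain it. *)
Lemma tame_comp S m (V : I -> nat -> R -> R) (B : nat -> R) q q' r :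
  (forall p, jet (V p)) -> (forall p n t, `|V p n t| <= B n) ->
  (forall p t, S p t -> is_derive t 1 (q p) (q' p t)) -> tame S m q' ->
  tame S m (fun p t => V p r (q p t)).
Proof.
move=> jV VB dq; have pb n : pbounded S (fun p t => V p n (q p t)).
  exists `|B n|, 0%N; split=> // p t _; rewrite expr0 mulr1.
  by rewrite (le_trans (VB _ _ _))// ler_norm.
elim: m r => [|m IH] r tq; split=> //.
exists (fun p t => V p r.+1 (q p t) * q' p t).
  by move=> p t St; have dqt := dq p t St; have dV := jV p r (q p t); exact: is_derive1_comp.
by apply: tameM; [exact: IH (tameS tq)|exact: tameS].
Qed.

(** On an open set the derivatives depend only on the values, so the constants found for [phi] serve
    for every jet that agrees with it there. *)
Lemma tame_jet S m phi : (forall p, open (S p)) -> tame S m phi ->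
  exists (K : R) (M : nat), 0 <= K /\ forall p f, jet f ->
    (forall t, S p t -> f 0%N t = phi p t) ->
    forall t, S p t -> `|f m t| <= K * X p ^+ M.
Proof.
move=> oS; elim: m phi => [|m IH] phi [[K [M [K0 H]]] T].
  by exists K, M; split=> // p f jf E t St; rewrite E//; exact: H.
case: T => phi' d T; have [L [N [L0 HL]]] := IH _ T.
exists L, N; split=> // p f jf E; apply: (HL p (fun n => f n.+1)).
  by move=> n; exact: jf.
move=> t St; exact: (eq_on_open_derive (oS p) St E (jf 0%N t) (d p t St)).
Qed.

End Tame.

(** * The windows *)

Section Windows.
Context {R : realType}.
Variables (phihat v : R -> R) (W : R * R -> R).
Hypotheses (hphi : coarse_window phihat) (hW : radial_window phihat W)
  (hv : angular_window v).
Implicit Types (x xi : R * R) (u t c : R).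

Lemma smooth1_jet (f : R -> R) : smooth1 f -> jet (fun n => derive1n n f).
Proof.
move=> sf n t; have := sf n t => df; rewrite derive1nS derive1E.
exact: DeriveDef.
Qed.

Lemma v_supp u : 1 < `|u| -> v u = 0.
Proof.
move=> u1; apply/eqP; apply: contraT => vu.
have : `[-1, 1]%classic u.
  by apply: (angular_supp hv); apply: subset_closure.
by rewrite /= in_itv /= -ler_norml leNgt u1.
Qed.

(** At [u = 0] the quadratic identity has the middle term 1, which forces the outer two to vanish.
    The end points matter where the argument of [v] may have absolute value exactly 1, as on the
    diagonals. *)
Lemma v_ends : v 1 = 0 /\ v (-1) = 0.
Proof.
have := angular_sqr hv (_ : `|0 : R| <= 1); rewrite normr0 => /(_ ler01).
rewrite sub0r add0r (angular_one hv) normr1 expr1n.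
have := sqr_ge0 `|v 1|; have := sqr_ge0 `|v (-1)| => a b c.
have /eqP : `|v 1| ^+ 2 = 0 by lra.
have /eqP : `|v (-1)| ^+ 2 = 0 by lra.
by rewrite !expf_eq0 /= !normr_eq0 => /eqP -> /eqP ->.
Qed.

Lemma v_supp1 u : 1 <= `|u| -> v u = 0.
Proof.
rewrite le_eqVlt => /orP[/eqP|]; last exact: v_supp.
case: v_ends => v1 v2; case: (lerP 0 u) => u0.
  by rewrite ger0_norm// => <-.
by rewrite ltr0_norm// => /eqP; rewrite eq_sym eqr_oppLR => /eqP ->.
Qed.

Lemma v_le1 u : `|v u| <= 1.
Proof.
have [u1|u1] := leP `|u| 1; last by rewrite v_supp// normr0.
have := angular_sqr hv u1; have := sqr_ge0 `|v (u - 1)|; have := sqr_ge0 `|v (u + 1)| => a b c.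
by rewrite -(expr_le1 (n := 2))//; lra.
Qed.

Lemma jet_bounded (f : nat -> R -> R) (r : R) : jet f ->
  (forall t, r < `|t| -> f 0%N t = 0) -> forall n, exists B, forall t, `|f n t| <= B.
Proof.
move=> jf f0 n.
have oS : open [set t : R | r < `|t|].
  by apply: (@open_comp _ _ (fun t : R => `|t|) [set s | r < s]); [move=> t _; exact: norm_continuous|exact: open_gt].
have cf : continuous (f n) by move=> t; exact: is_derive_continuous (jf n t).
have cpt : compact (f n @` `[- `|r|, `|r|]%classic).
  by apply: continuous_compact; [exact: continuous_subspaceT|exact: segment_compact].
have [M [_ HM]] := compact_bounded cpt.
 exists (`|M| + 1) => t.
have [tr|tr] := leP `|t| `|r|.
  apply: (HM (`|M| + 1)); first by rewrite (le_lt_trans (ler_norm M))// ltrDl.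
  by exists t => //=; rewrite in_itv /= -ler_norml.
rewrite (jet_eq0 n oS jf f0) ?normr0 ?addr_ge0//=.
by rewrite (le_lt_trans (ler_norm r)).
Qed.

Lemma v_jet_bounded n : exists B, forall t, `|derive1n n v t| <= B.
Proof.
apply: (@jet_bounded _ 1); first exact/smooth1_jet/(angular_smooth hv).
by move=> t; exact: v_supp.
Qed.

(** The end points follow by continuity, along the sequence [(1 + 1 / (n + 1)) t] outside the
    support. *)
Lemma phihat_supp t : 1 / 8 <= `|t| -> phihat t = 0.
Proof.
have zero s : 1 / 8 < `|s| -> phihat s = 0.
  by move=> s8; apply: (coarse_zero hphi); rewrite in_itv /= -ler_norml -ltNge.
rewrite le_eqVlt => /orP[/eqP t8|]; last exact: zero.
have cp : {for t, continuous phihat}.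
  exact: is_derive_continuous (smooth1_jet (coarse_smooth hphi) 0%N t).
have t0 : t != 0 by rewrite -normr_gt0 -t8 divr_gt0.
have cs : phihat ((1 + n.+1%:R^-1) * t) @[n --> \oo] --> phihat t.
  have ct : (1 + n.+1%:R^-1) * t @[n --> \oo] --> t.
    rewrite -[X in _ --> X]mul1r; apply: cvgM; last exact: cvg_cst.
    by rewrite -[X in _ --> X]addr0; apply: cvgD; [exact: cvg_cst|exact: cvg_harmonic].
  exact: (cvg_comp _ _ ct cp).
have c0 : phihat ((1 + n.+1%:R^-1) * t) @[n --> \oo] --> (0 : R).
  apply: (@eq_seq_cvg _ _ (fun=> 0)); last exact: cvg_cst.
  move=> n; apply: zero; rewrite normrM t8 ltr_pMl ?normr_gt0//.
  have p : 0 < n.+1%:R^-1 :> R by rewrite invr_gt0.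
  by rewrite ger0_norm ?ltrDl// addr_ge0// ltW.
exact: (cvg_unique _ cs c0).
Qed.

Lemma Phihat_01 xi : 0 <= Phihat phihat xi <= 1.
Proof.
have /andP[a0 a1] := coarse_range hphi xi.1; have /andP[b0 b1] := coarse_range hphi xi.2.
by rewrite /Phihat mulr_ge0// mulr_ile1.
Qed.

(** At [1 / 2] even the argument divided by 4 has reached [1 / 8], where [phihat] vanishes. *)
Lemma W_far xi : 1 / 2 <= `|xi.1| \/ 1 / 2 <= `|xi.2| -> W xi = 0.
Proof.
move=> H; suff : W xi ^+ 2 = 0 by move/eqP; rewrite expf_eq0 /= => /eqP.
rewrite (radial_sqr hW).
have q t : 1 / 2 <= `|t| -> phihat (2 ^- 2 * t) = 0 /\ phihat t = 0.
  move=> t2; split; apply: phihat_supp; last by lra.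
  rewrite normrM ger0_norm ?invr_ge0 ?exprn_ge0//.
  have -> : (2 ^+ 2 : R) = 4 by ring. lra.
rewrite /Phihat /= /GRing.scale /=.
by case: H => /q[-> ->]; rewrite ?mul0r ?mulr0 expr0n subrr.
Qed.

Lemma W_near xi : `|xi.1| <= 1 / 16 -> `|xi.2| <= 1 / 16 -> W xi = 0.
Proof.
move=> x1 x2; suff : W xi ^+ 2 = 0 by move/eqP; rewrite expf_eq0 /= => /eqP.
rewrite (radial_sqr hW).
have q t : `|t| <= 1 / 16 -> phihat (2 ^- 2 * t) = 1 /\ phihat t = 1.
  move=> t2; split; apply: (coarse_one hphi); rewrite in_itv /= -ler_norml//.
  rewrite normrM ger0_norm ?invr_ge0 ?exprn_ge0//.
  have -> : (2 ^+ 2 : R) = 4 by ring. have := normr_ge0 t; lra.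
rewrite /Phihat /= /GRing.scale /=.
by have [-> ->] := q _ x1; have [-> ->] := q _ x2; rewrite subrr.
Qed.

Lemma W_le1 xi : `|W xi| <= 1.
Proof.
rewrite -(expr_le1 (n := 2))// real_normK ?num_real// (radial_sqr hW).
have /andP[a0 a1] := Phihat_01 ((2 ^- 2 : R) *: xi).
rewrite lerBlDr (le_trans (_ : _ <= 1)) ?expr_le1//.
by rewrite lerDl sqr_ge0.
Qed.

Lemma open_line (i : 'I_2) x (O : set (R * R)) : open O ->
  open [set t : R | O (t *: axis i + x)].
Proof.
move=> oO; apply: (@open_comp _ _ (fun t : R => t *: axis i + x) O) => // t _.
by apply: cvgD; [apply: cvgZr_tmp|exact: cvg_cst].
Qed.

Lemma open_norm_gt (r : R) : open [set xi : R * R | r < `|xi.1| \/ r < `|xi.2|].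
Proof.
apply: openU.
  apply: (@open_comp _ _ (fun xi : R * R => `|xi.1|) [set s | r < s]); last exact: open_gt.
  by move=> t _; apply: cvg_norm; exact: cvg_fst.
apply: (@open_comp _ _ (fun xi : R * R => `|xi.2|) [set s | r < s]); last exact: open_gt.
by move=> t _; apply: cvg_norm; exact: cvg_snd.
Qed.

Lemma open_norm_lt (r : R) : open [set xi : R * R | `|xi.1| < r /\ `|xi.2| < r].
Proof.
apply: openI.
  apply: (@open_comp _ _ (fun xi : R * R => `|xi.1|) [set s | s < r]); last exact: open_lt.
  by move=> t _; apply: cvg_norm; exact: cvg_fst.
apply: (@open_comp _ _ (fun xi : R * R => `|xi.2|) [set s | s < r]); last exact: open_lt.
by move=> t _; apply: cvg_norm; exact: cvg_snd.
Qed.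

Lemma W_line_jet i x : jet (fun n t => pderivs (nseq n i) W (t *: axis i + x)).
Proof. by move=> n t; exact: (smooth2_line (nseq n i) i x t (radial_smooth hW)). Qed.

(** Only pure derivatives along one axis occur. Off the square [[-1, 1] ^ 2] they vanish because [W]
    does so on an open set there; on the square they are bounded by compactness. *)
Lemma W_jet_bounded i n : exists B, forall xi, `|pderivs (nseq n i) W xi| <= B.
Proof.
have cf : continuous (pderivs (nseq n i) W) by exact: (radial_smooth hW (nseq n i)).1.
have cpt : compact (pderivs (nseq n i) W @` (`[-1, 1] `*` `[-1, 1])).
  apply: continuous_compact; first exact: continuous_subspaceT.
  by apply: compact_setX; exact: segment_compact.
have [M [_ HM]] := compact_bounded cpt.
 exists (`|M| + 1) => xi.
have [/andP[x1 x2]|] := boolP ((`|xi.1| <= 1) && (`|xi.2| <= 1)).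
  apply: (HM (`|M| + 1)); first by rewrite (le_lt_trans (ler_norm M))// ltrDl.
  by exists xi => //; split; rewrite /= in_itv /= -ler_norml.
rewrite negb_and -!ltNge => xi1.
have oS := @open_line i xi _ (@open_norm_gt (1 / 2)).
have := @jet_eq0 _ _ _ n oS (@W_line_jet i xi) _ 0; rewrite scale0r add0r => ->.
- by rewrite normr0 addr_ge0.
- move=> t /= H; apply: W_far.
  by case: H => H; [left|right]; exact: ltW.
- have E : 0 *: axis i + xi = xi by rewrite scale0r add0r.
  by rewrite /mkset E; case/orP: xi1 => H; [left|right]; lra.
Qed.

(* [(al, be)] is [(1, 0)] for the horizontal, [(0, 1)] for the vertical and
   [(1, 1)] for the boundary windows.  The vertical window vanishes on the
   diagonal when [`|l| < 2 ^ j], so that giving [D_h] priority is harmless. *)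
Definition wedge (al be : R) (j : nat) (l : int) xi : R :=
  if D_h xi then
    al * (W ((2 ^- (2 * j) : R) *: xi) * v (2 ^+ j * (xi.2 / xi.1) - l%:~R))
  else if D_v xi then
    be * (W ((2 ^- (2 * j) : R) *: xi) * v (2 ^+ j * (xi.1 / xi.2) - l%:~R))
  else 0.

(** The point with moving coordinate [t], along the axis [i], and fixed coordinate [c]; it lets both
    axes be treated at once. *)
Definition pt (i : 'I_2) t c : R * R := if i == 0 then (t, c) else (c, t).

Lemma ptE i xi : xi = pt i (if i == 0 then xi.1 else xi.2) (if i == 0 then xi.2 else xi.1).
Proof. by rewrite /pt; case: (i == 0); case: xi. Qed.

Lemma pt_line i t c : t *: axis i + pt i 0 c = pt i t c.
Proof.
by rewrite axis_line /pt; case: (i == 0); rewrite /= !(add0r, addr0).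
Qed.

Lemma pt_scale i (a : R) t c : a *: pt i t c = pt i (a * t) (a * c).
Proof. by rewrite /pt; case: ifP. Qed.

(** Along a coordinate line the slope is proportional to [1 / t] where the moving coordinate is the
    larger one; where it is the smaller one, as in [wedge_sub], the slope is linear in [t]. *)
Lemma wedge_dom i al be j l t c : `|c| < `|t| -> wedge al be j l (pt i t c) =
  (if i == 0 then al else be) *
    (W (pt i (2 ^- (2 * j) * t) (2 ^- (2 * j) * c)) * v (2 ^+ j * (c * t^-1) - l%:~R)).
Proof.
move=> ct; have t0 : t != 0 by rewrite -normr_gt0 (le_lt_trans _ ct).
rewrite /wedge pt_scale /D_h /D_v /pt; case: (i == 0) => /=; first by rewrite (ltW ct) t0.
by rewrite leNgt ct /= (ltW ct) t0.
Qed.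

Lemma wedge_sub i al be j l t c : `|t| < `|c| -> wedge al be j l (pt i t c) =
  (if i == 0 then be else al) *
    (W (pt i (2 ^- (2 * j) * t) (2 ^- (2 * j) * c)) * v (2 ^+ j * (t * c^-1) - l%:~R)).
Proof.
move=> tc; have c0 : c != 0 by rewrite -normr_gt0 (le_lt_trans _ tc).
rewrite /wedge pt_scale /D_h /D_v /pt; case: (i == 0) => /=; last by rewrite (ltW tc) c0.
by rewrite leNgt tc /= (ltW tc) c0.
Qed.

Lemma W_scale_far j xi : 2 ^+ (2 * j) / 2 <= `|xi.1| \/ 2 ^+ (2 * j) / 2 <= `|xi.2| ->
  W ((2 ^- (2 * j) : R) *: xi) = 0.
Proof.
have X0 : 0 < 2 ^+ (2 * j) :> R by rewrite exprn_gt0.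
move=> H; apply: W_far; rewrite /= /GRing.scale /= !normrM !(ger0_norm (_ : 0 <= 2 ^- (2 * j))) ?invr_ge0 ?(ltW X0)//.
by case: H => H; [left|right]; rewrite ler_pdivlMl// mulrA mulr1.
Qed.

Lemma W_scale_near j xi : `|xi.1| <= 2 ^+ (2 * j) / 16 -> `|xi.2| <= 2 ^+ (2 * j) / 16 ->
  W ((2 ^- (2 * j) : R) *: xi) = 0.
Proof.
have X0 : 0 < 2 ^+ (2 * j) :> R by rewrite exprn_gt0.
move=> H1 H2; apply: W_near; rewrite /= /GRing.scale /= normrM (ger0_norm (_ : 0 <= 2 ^- (2 * j))) ?invr_ge0 ?(ltW X0)//.
  by rewrite ler_pdivrMl// mulrA mulr1.
by rewrite ler_pdivrMl// mulrA mulr1.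
Qed.

Lemma wedge_far al be j l xi : 2 ^+ (2 * j) / 2 <= `|xi.1| \/ 2 ^+ (2 * j) / 2 <= `|xi.2| ->
  wedge al be j l xi = 0.
Proof. by move=> H; rewrite /wedge W_scale_far// !mul0r !mulr0; case: ifP => // _; case: ifP. Qed.

Lemma wedge_near al be j l xi : `|xi.1| <= 2 ^+ (2 * j) / 16 -> `|xi.2| <= 2 ^+ (2 * j) / 16 ->
  wedge al be j l xi = 0.
Proof. by move=> H1 H2; rewrite /wedge W_scale_near// !mul0r !mulr0; case: ifP => // _; case: ifP. Qed.

Lemma wedge_le1 al be j l xi : `|al| <= 1 -> `|be| <= 1 -> `|wedge al be j l xi| <= 1.
Proof.
move=> a1 b1; rewrite /wedge.
by case: ifP => _; [|case: ifP => _]; rewrite ?normr0// !normrM mulr_ile1 ?mulr_ge0//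
   mulr_ile1 ?W_le1 ?v_le1.
Qed.

End Windows.

(** * Derivatives of the windows along coordinate lines *)

Section WedgeJets.
Context {R : realType}.
Variables (phihat v : R -> R) (W : R * R -> R).
Hypotheses (hphi : coarse_window phihat) (hW : radial_window phihat W)
  (hv : angular_window v).
Implicit Types (x xi : R * R) (u t c : R).

(* The parameters are [(j, k, c, l)] with [k] a constant factor and [c] the
   coordinate kept fixed. *)
Let P : Type := (nat * (R * R * R))%type.
Let X (p : P) : R := 2 ^+ p.1.
Let kk (p : P) : R := p.2.1.1.
Let cc (p : P) : R := p.2.1.2.
Let ll (p : P) : R := p.2.2.

Let X1 p : 1 <= X p.
Proof. by rewrite exprn_ege1// ler1n. Qed.

Let X0 p : 0 < X p.
Proof. by rewrite exprn_gt0. Qed.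

Let XX (p : P) : 2 ^+ (2 * p.1) = X p ^+ 2.
Proof. by rewrite mulnC exprM. Qed.

Section one_region.
Variables (i : 'I_2) (n1 n2 : nat) (S : P -> set R) (q q' : P -> R -> R).
Hypothesis Sk : forall p t, S p t -> `|kk p| <= 1.
Hypothesis St : forall p t, S p t -> `|t| <= X p ^+ 2.
Hypothesis Sc : forall p t, S p t -> `|cc p| <= X p ^+ 2.
Hypothesis dq : forall p t, S p t -> is_derive t 1 (q p) (q' p t).

(** The monomial is what a derivative in space leaves on the frequency side; on the sets considered
    it is at most a power of the scale. *)
Lemma tame_wedge m : tame X S m q' ->
  tame X S m (fun p t => kk p * (t ^+ n1 * cc p ^+ n2) *
    (W (pt i (X p ^- 2 * t) (X p ^- 2 * cc p)) * v (q p t))).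
Proof.
move=> tq.
have tk : tame X S m (fun p t => kk p) by apply: tame_const; exact: (pbounded_const1 X Sk).
have tt : tame X S m (fun p t => t).
  by apply: tame_id; exists 1, 2%N; split=> // p t /St; rewrite mul1r.
have tc : tame X S m (fun p t => cc p).
  by apply: tame_const; exists 1, 2%N; split=> // p t /Sc; rewrite mul1r.
apply: (tameM X1); first by apply: (tameM X1) => //; apply: (tameM X1); exact: (tameX X1).
apply: (tameM X1); last first.
  have /boolp.choice[B HB] := v_jet_bounded hv.
  have jv : jet (fun n => derive1n n v) by exact/smooth1_jet/(angular_smooth hv).
  exact: (@tame_comp R P X X1 S m (fun _ n => derive1n n v) B q q' 0 (fun=> jv) (fun=> HB) dq tq).
have /boolp.choice[B HB] := W_jet_bounded hphi hW i.
have -> : (fun p t => W (pt i (X p ^- 2 * t) (X p ^- 2 * cc p))) =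
    (fun p t => pderivs (nseq 0 i) W ((X p ^- 2 * t) *: axis i + pt i 0 (X p ^- 2 * cc p))).
  by apply/funext => p; apply/funext => t; rewrite pt_line.
apply: (@tame_comp R P X X1 S m (fun p n t => pderivs (nseq n i) W (t *: axis i + pt i 0 (X p ^- 2 * cc p))) B
   (fun p t => X p ^- 2 * t) (fun p t => X p ^- 2) 0).
- by move=> p; exact: W_line_jet hW i _.
- by move=> p n t; exact: HB.
- move=> p t _; apply: (is_derive_eq (is_deriveZ (X p ^- 2) (is_derive_id t 1))).
  by rewrite /GRing.scale /= mulr1.
- apply: tame_const; apply: (@pbounded_const1 _ _ _ _ _ 1) => p t _.
  by rewrite ger0_norm ?invr_ge0 ?exprn_ge0 ?(ltW (X0 p))// invf_le1 ?exprn_gt0// exprn_ege1.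
Qed.

End one_region.

(** [inner] and [outer] are the parts of a line on which the moving coordinate is the larger or the
    smaller one. The bounds [X ^ 2 / 32] and [X ^ 2] leave room around the thresholds [X ^ 2 / 16]
    and [X ^ 2 / 2] of the window, so that these open sets and the regions of vanishing cover the
    line except for its crossings with the diagonals. *)
Let inner (p : P) : set R := [set t | `|kk p| <= 1 /\
  (`|cc p| < `|t| /\ (X p ^+ 2 / 32 < `|t| /\ `|t| < X p ^+ 2))].

Let outer (p : P) : set R := [set t | (`|kk p| <= 1 /\
  (X p ^+ 2 / 32 < `|cc p| /\ `|cc p| < X p ^+ 2)) /\ `|t| < `|cc p|].

Let open_const (Q : Prop) : open [set _ : R | Q].
Proof.
have [q|nq] := pselect Q.
  by rewrite (_ : [set _ | _] = setT); [exact: openT|apply/seteqP; split].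
by rewrite (_ : [set _ | _] = set0); [exact: open0|apply/seteqP; split].
Qed.

Let open_absgt (r : R) : open [set t : R | r < `|t|].
Proof.
by apply: (@open_comp _ _ (fun t : R => `|t|) [set s | r < s]); [move=> t _; exact: norm_continuous|exact: open_gt].
Qed.

Let open_abslt (r : R) : open [set t : R | `|t| < r].
Proof.
by apply: (@open_comp _ _ (fun t : R => `|t|) [set s | s < r]); [move=> t _; exact: norm_continuous|exact: open_lt].
Qed.

Let open_inner p : open (inner p).
Proof.
apply: openI; first exact: open_const.
by apply: openI; [exact: open_absgt|apply: openI; [exact: open_absgt|exact: open_abslt]].
Qed.

Let open_outer p : open (outer p).
Proof. by apply: openI; [exact: open_const|exact: open_abslt]. Qed.

Let inv_le (p : P) (t : R) : X p ^+ 2 / 32 < `|t| -> `|t^-1| <= 32.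
Proof.
move=> H; have X2 : 1 <= X p ^+ 2 by rewrite exprn_ege1.
have t0 : 0 < `|t| by rewrite (le_lt_trans _ H)// divr_ge0// (le_trans ler01).
rewrite normfV invf_ple ?posrE// (le_trans _ (ltW H))//.
by rewrite -[leLHS]mul1r ler_wpM2r.
Qed.

Lemma tame_inner i n1 n2 m : tame X inner m (fun p t => kk p * (t ^+ n1 * cc p ^+ n2) *
    (W (pt i (X p ^- 2 * t) (X p ^- 2 * cc p)) * v (X p * (cc p * t^-1) - ll p))).
Proof.
have pX : pbounded X inner (fun p t => X p).
  by exists 1, 1%N; split=> // p t _; rewrite mul1r expr1 ger0_norm// (ltW (X0 p)).
have pc : pbounded X inner (fun p t => cc p).
  exists 1, 2%N; split=> // p t [_ [ct [_ tX]]]; rewrite mul1r ltW//.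
  exact: lt_trans ct tX.
have ti : tame X inner m (fun p t => t^-1).
  apply: (tame_inv X1).
    by move=> p t [_ [ct _]]; rewrite -normr_gt0 (le_lt_trans _ ct).
  exists 32, 0%N; split=> // p t [_ [_ [tX _]]]; rewrite mulr1; exact: inv_le tX.
apply: (@tame_wedge i n1 n2 inner (fun p t => X p * (cc p * t^-1) - ll p)
  (fun p t => X p * (cc p * (-1 * (t^-1 * t^-1)))) _ _ _ _ m).
- by move=> p t [].
- by move=> p t [_ [_ [_ tX]]]; exact: ltW.
- by move=> p t [_ [ct [_ tX]]]; rewrite ltW// (lt_trans ct).
- move=> p t [_ [ct _]].
  have t0 : t != 0 by rewrite -normr_gt0 (le_lt_trans _ ct).
  have d1 := is_deriveV (f := id) t0 (is_derive_id t 1).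
  have d2 := is_deriveZ (X p) (is_deriveZ (cc p) d1).
  have d3 := is_deriveB d2 (is_derive_cst (ll p) t 1).
  apply: (is_derive_eq d3); rewrite /GRing.scale /= subr0 mulr1.
  by rewrite -invfM -expr2 mulN1r.
apply: (tameM X1); first exact: tame_const.
apply: (tameM X1); first exact: tame_const.
apply: (tameM X1); last by apply: (tameM X1).
by apply: tame_const; apply: (@pbounded_const1 _ _ _ _ _ 1) => *; rewrite normrN normr1.
Qed.

Lemma tame_outer i n1 n2 m : tame X outer m (fun p t => kk p * (t ^+ n1 * cc p ^+ n2) *
    (W (pt i (X p ^- 2 * t) (X p ^- 2 * cc p)) * v (X p * (t * (cc p)^-1) - ll p))).
Proof.
have pX : pbounded X outer (fun p t => X p).
  by exists 1, 1%N; split=> // p t _; rewrite mul1r expr1 ger0_norm// (ltW (X0 p)).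
apply: (@tame_wedge i n1 n2 outer (fun p t => X p * (t * (cc p)^-1) - ll p)
  (fun p t => X p * (cc p)^-1) _ _ _ _ m).
- by move=> p t [[]].
- by move=> p t [[_ [_ cX]] tc]; rewrite ltW// (lt_trans tc).
- by move=> p t [[_ [_ cX]] tc]; exact: ltW.
- move=> p t _.
  have d2 := is_deriveZ (X p * (cc p)^-1) (is_derive_id t 1).
  have d3 := is_deriveB d2 (is_derive_cst (ll p) t 1).
  have -> : (fun t => X p * (t / cc p) - ll p) = (X p / cc p) \*: id - cst (ll p).
    by apply/funext => s; rewrite -[RHS]/(X p / cc p * s - ll p); ring.
  by apply: (is_derive_eq d3); rewrite /GRing.scale /= subr0 mulr1.
apply: (tameM X1); first exact: tame_const.
apply: tame_const; apply: (@pbounded_const1 _ _ _ _ _ 32) => p t [[_ [cX _]] _].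
exact: inv_le cX.
Qed.

(** The function is assumed smooth along every line, while its formula is differentiated only off
    the diagonals. There either the formula is tame or the function vanishes on a neighbourhood, and
    continuity of [f m] fills in the remaining points. The constants do not depend on [l]. *)
Lemma wedge_jet_bound i b m : exists (K : R) (M : nat), 0 <= K /\
  forall (j : nat) (l : int) (al be s : R) (f : nat -> R * R -> R),
  `|al| <= 1 -> `|be| <= 1 -> `|s| <= 1 ->
  (forall x, jet (fun n t => f n (t *: axis i + x))) ->
  (forall xi, f 0%N xi = xi.1 ^+ b.1 * xi.2 ^+ b.2 * (s * wedge v W al be j l xi)) ->
  forall xi, `|f m xi| <= K * (2 ^+ j) ^+ M /\
    (2 ^+ (2 * j) / 2 < `|xi.1| \/ 2 ^+ (2 * j) / 2 < `|xi.2| -> f m xi = 0).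
Proof.
pose n1 := if i == 0 then b.1 else b.2; pose n2 := if i == 0 then b.2 else b.1.
have [K [M [K0 HK]]] := tame_jet open_inner (tame_inner i n1 n2 m).
have [L [N [L0 HL]]] := tame_jet open_outer (tame_outer i n1 n2 m).
exists (K + L), (M + N)%N; split; first exact: addr_ge0.
move=> j l al be s f al1 be1 s1 jf f0 xi.
have far eta : 2 ^+ (2 * j) / 2 < `|eta.1| \/ 2 ^+ (2 * j) / 2 < `|eta.2| -> f m eta = 0.
  move=> Heta; have oS := @open_line _ i eta _ (@open_norm_gt _ (2 ^+ (2 * j) / 2)).
  have := @jet_eq0 _ _ _ m oS (jf eta) _ 0; rewrite scale0r add0r => ->//.
    move=> t /= H; rewrite f0 (wedge_far v hphi hW)//.
      by rewrite !mulr0.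
    by case: H => H; [left|right]; exact: ltW.
  by rewrite /mkset scale0r add0r.
have near eta : `|eta.1| < 2 ^+ (2 * j) / 16 /\ `|eta.2| < 2 ^+ (2 * j) / 16 -> f m eta = 0.
  move=> Heta; have oS := @open_line _ i eta _ (@open_norm_lt _ (2 ^+ (2 * j) / 16)).
  have := @jet_eq0 _ _ _ m oS (jf eta) _ 0; rewrite scale0r add0r => ->//.
    move=> t /= [H1 H2]; rewrite f0 (wedge_near v hphi hW) ?(ltW H1) ?(ltW H2)//.
    by rewrite !mulr0.
  by rewrite /mkset scale0r add0r.
split; last exact: far.
pose Y : R := 2 ^+ j.
have Y1 : 1 <= Y by rewrite exprn_ege1// ler1n.
have Y0 : 0 < Y by rewrite exprn_gt0.
have YY : 2 ^+ (2 * j) = Y ^+ 2 by rewrite mulnC exprM.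
have Y2 : 1 <= Y ^+ 2 by rewrite exprn_ege1.
have KLge0 : 0 <= (K + L) * Y ^+ (M + N) by rewrite mulr_ge0 ?addr_ge0 ?exprn_ge0// ltW.
rewrite [xi](ptE i) -pt_line.
set t0 := (if _ then _ else _); set c := (if _ then _ else _).
have ptn t : pt i t c = pt i t c -> (`|(pt i t c).1| = `|t| /\ `|(pt i t c).2| = `|c|) \/
    (`|(pt i t c).1| = `|c| /\ `|(pt i t c).2| = `|t|).
  by move=> _; rewrite /pt; case: (i == 0); [left|right].
pose g n t := f n (t *: axis i + pt i 0 c).
have jg : jet g by exact: jf.
have powE t : (pt i t c).1 ^+ b.1 * (pt i t c).2 ^+ b.2 = t ^+ n1 * c ^+ n2.
  by rewrite /pt /n1 /n2; case: (i == 0) => //=; rewrite mulrC.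
(* At [t = c] and [t = - c] the line meets the diagonals. *)
apply: (bounded_punctured (f := g m) (a := c) (b := - c) (is_derive_continuous (jg m t0))).
move=> t tc tNc; have tcn : `|t| != `|c|.
  by rewrite eqr_norm2 negb_or tc tNc.
have gE : g m t = f m (pt i t c) by rewrite /g pt_line.
case: (ltgtP `|t| `|c|) => [lt_tc|lt_ct|E]; last by rewrite E eqxx in tcn.
- have [cn|cf] := leP `|c| (Y ^+ 2 / 32).
    rewrite gE near ?normr0//; rewrite YY.
    by case: (ptn t erefl) => -[-> ->]; split; lra.
  have [cX|cX] := leP (Y ^+ 2) `|c|.
    rewrite gE far ?normr0//; rewrite YY.
    by case: (ptn t erefl) => -[-> ->]; [right|left]; lra.
  pose p : P := (j, (s * (if i == 0 then be else al), c, l%:~R)).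
  have kp : `|kk p| <= 1.
    by rewrite /kk /= normrM mulr_ile1//; case: ifP.
  rewrite (le_trans (HL p g jg _ t _))//.
  + move=> r [_ rc]; rewrite /g pt_line f0 powE wedge_sub// YY /kk /X /cc /ll /=.
    by rewrite -/Y; ring.
  + rewrite /X /= -/Y ler_pM ?exprn_ge0 ?(ltW Y0) ?lerDr//.
    by rewrite ler_weXn2l// leq_addl.
- have [tn|tf] := leP `|t| (Y ^+ 2 / 32).
    rewrite gE near ?normr0//; rewrite YY.
    by case: (ptn t erefl) => -[-> ->]; split; lra.
  have [tX|tX] := leP (Y ^+ 2) `|t|.
    rewrite gE far ?normr0//; rewrite YY.
    by case: (ptn t erefl) => -[-> ->]; [left|right]; lra.
  pose p : P := (j, (s * (if i == 0 then al else be), c, l%:~R)).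
  have kp : `|kk p| <= 1.
    by rewrite /kk /= normrM mulr_ile1//; case: ifP.
  rewrite (le_trans (HK p g jg _ t _))//.
  + move=> r [_ [rc _]]; rewrite /g pt_line f0 powE wedge_dom// YY /kk /X /cc /ll /=.
    by rewrite -/Y; ring.
  + rewrite /X /= -/Y ler_pM ?exprn_ge0 ?(ltW Y0) ?lerDl//.
    by rewrite ler_weXn2l// leq_addr.
Qed.

End WedgeJets.

(** * Derivatives in frequency as transforms of moments *)

Section Moments.
Context {R : realType}.
Local Notation C := (R[i]).
Local Notation l2 := (@leb2 R).
Local Notation plane := (measurableTypeR R * measurableTypeR R)%type.
Local Notation normc := (@Normc.normc R).
Implicit Types (g h : R * R -> C) (x xi v y : R * R) (a b : nat * nat) (i : 'I_2).

Definition moment i b m g x : C := (dot (axis i) x ^+ m)%:C * cderiv b g x.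

Lemma moment_decay i b m g : schwartz g -> exists2 K : R, 0 <= K & decay K (moment i b m g).
Proof.
move=> sg; have [K K0 dK] := schwartz_decay b m 0 sg; have [L L0 dL] := schwartz_decay b 0 m sg.
have E : moment i b m g = if i == 0 then (fun x => (x.1 ^+ m * x.2 ^+ 0)%:C * cderiv b g x)
    else (fun x => (x.1 ^+ 0 * x.2 ^+ m)%:C * cderiv b g x).
  apply/funext => x; rewrite /moment dotC dot_axis; case: (i == 0).
    by rewrite expr0 mulr1.
  by rewrite expr0 mul1r.
by rewrite E; case: (i == 0); [exists K|exists L].
Qed.

Lemma normc_moment i b m g x :
  normc (moment i b m g x) = `|dot (axis i) x| ^+ m * normc (cderiv b g x).
Proof. by rewrite /moment Normc.normcM normc_real normrX. Qed.

Lemma moment_cont i b m g : schwartz g ->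
  continuous (re (moment i b m g)) /\ continuous (im (moment i b m g)).
Proof.
move=> sg; have [c1 c2] := cderiv_continuous b sg.
have cd : continuous (fun x => dot (axis i) x ^+ m).
  move=> x; apply: (@continuous_comp _ _ _ (dot (axis i)) (fun t => t ^+ m)); last exact: exprn_continuous.
  apply: cvgD; apply: cvgM; [exact: cvg_cst|exact: cvg_fst|exact: cvg_cst|exact: cvg_snd].
have -> : re (moment i b m g) = (fun x => dot (axis i) x ^+ m * re (cderiv b g) x).
  by apply/funext => x; rewrite /re /moment ReMc [complex.Re _%:C]/= [complex.Im _%:C]/= mul0r subr0.
have -> : im (moment i b m g) = (fun x => dot (axis i) x ^+ m * im (cderiv b g) x).
  by apply/funext => x; rewrite /im /moment ImMc [complex.Re _%:C]/= [complex.Im _%:C]/= mul0r addr0.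
split=> x; apply: cvgM; [exact: cd|exact: c1|exact: cd|exact: c2].
Qed.

(* The [m]-th derivative of [fpow b * FT g] in the direction [axis i]. *)
Definition fjet i b g m xi : C := tpi (-1) ^+ m * FT (moment i b m g) xi.

Lemma fjet_taylor i b g m : schwartz g -> exists B : R, forall (t : R) xi,
  normc (fjet i b g m (t *: axis i + xi) - fjet i b g m xi - t%:C * fjet i b g m.+1 xi) <=
    t ^+ 2 * B.
Proof.
move=> sg; have [K0 K00 d0] := moment_decay i b m sg.
have [K1 K10 d1] := moment_decay i b m.+1 sg; have [K2 K20 d2] := moment_decay i b m.+2 sg.
pose K := K0 + K1 + K2.
have r0 x := ltW (@rho_gt0 R x).
have dK : decay K (moment i b m g).
  by case: d0 => m0 H; split=> // x; rewrite (le_trans (H x))// ler_wpM2r// /K -addrA lerDl addr_ge0.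
have hv1 x : normc (moment i b m g x) * `|dot (axis i) x| <= K * rho x.
  have := d1.2 x; rewrite !normc_moment exprSr mulrAC => /le_trans; apply.
  by rewrite ler_wpM2r// /K addrAC lerDr addr_ge0.
have hv2 x : normc (moment i b m g x) * dot (axis i) x ^+ 2 <= K * rho x.
  have := d2.2 x; rewrite !normc_moment -[dot _ _ ^+ 2]real_normK ?num_real// -addn2 exprD mulrAC => /le_trans; apply.
  by rewrite ler_wpM2r// /K lerDr addr_ge0.
exists (normc (tpi (-1 : R) ^+ m) * (8 * pi ^+ 2 * K * pi ^+ 2)) => t xi.
have := FT_diff1 xi t dK hv1 hv2.
have -> : FT (fun x => (0 +i* - (2 * pi * dot (axis i) x)) * moment i b m g x) xi =
    tpi (-1) * FT (moment i b m.+1 g) xi.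
  rewrite -(FTZ _ _ d1); congr (FT _ xi); apply/funext => x.
  rewrite /moment exprS rmorphM /= !mulrA; congr (_ * _ * _).
  by rewrite /tpi; apply: complex_eq => /=; ring.
move=> H; rewrite [leRHS]mulrCA; apply: le_trans (ler_wpM2l (normc_ge0 _) H).
rewrite -Normc.normcM le_eqVlt; apply/orP; left; apply/eqP; congr normc.
by rewrite /fjet exprSr; ring.
Qed.

(** The factor [c] serves to extract either part of a complex function: multiplication by [- 'i]
    turns the imaginary part into the real one. *)
Lemma fjet_re_jet i b g (c : C) x : schwartz g ->
  jet (fun n t => complex.Re (c * fjet i b g n (t *: axis i + x))).
Proof.
move=> sg n t; have [B HB] := fjet_taylor i b n sg.
apply: (@is_derive_quad _ _ _ _ (normc c * B)) => s.
have -> : (s + t) *: axis i + x = s *: axis i + (t *: axis i + x) by rewrite scalerDl addrA.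
rewrite [leRHS]mulrCA; apply: le_trans (ler_wpM2l (normc_ge0 c) (HB s (t *: axis i + x))).
rewrite -Normc.normcM; apply: le_trans (normc_Re _).
rewrite le_eqVlt; apply/orP; left; apply/eqP; congr (`| _ |).
have reZ (r : R) (z : C) : complex.Re (r%:C * z) = r * complex.Re z by case: z => p q /=; ring.
by rewrite !mulrBr [c * (s%:C * _)]mulrCA !ReDc !ReNc reZ.
Qed.

Lemma fjet0 i b g xi : schwartz g -> fjet i b g 0 xi = fpow b xi * FT g xi.
Proof.
move=> sg; rewrite /fjet expr0 mul1r -FT_cderiv//; congr (FT _ _).
by apply/funext => x; rewrite /moment expr0 mul1r.
Qed.

Lemma tpiM (t : R) : tpi t = tpi 1 * t%:C.
Proof. by rewrite /tpi; apply: complex_eq => /=; ring. Qed.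

Lemma fpowE b xi : fpow b xi = tpi 1 ^+ (b.1 + b.2) * (xi.1 ^+ b.1 * xi.2 ^+ b.2)%:C.
Proof.
rewrite /fpow (tpiM xi.1) (tpiM xi.2) !exprMn exprD rmorphM !rmorphXn /=; ring.
Qed.

Lemma tpi1_neq0 : tpi 1 != 0 :> C.
Proof.
rewrite -normc_eq0 normc_tpi normr1 mulr1 gt_eqF// mulr_gt0//; exact: pi_gt0.
Qed.

End Moments.

(** * Schwartz seminorms of an element at the origin *)

Section WedgeSeminorm.
Context {R : realType}.
Variables (phihat v : R -> R) (W : R * R -> R).
Hypotheses (hphi : coarse_window phihat) (hW : radial_window phihat W)
  (hv : angular_window v).
Local Notation C := (R[i]).
Local Notation normc := (@Normc.normc R).
Implicit Types (x xi : R * R) (a b : nat * nat) (i : 'I_2).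

(** A moment of a derivative of [u] is, up to constants, the inverse transform of a derivative of
    [fpow b] times the window. The latter is bounded by a power of [2 ^ j] and supported in a square
    of side [2 ^ (2 j)]; a support of this size is exchanged for the majorant [rho] at the price of
    the eighth power of [2 ^ j]. *)
Lemma wedge_moment i b m : exists (K : R) (M : nat), 0 <= K /\
  forall (j : nat) (l : int) (al be s : R) (u : R * R -> C),
  `|al| <= 1 -> `|be| <= 1 -> `|s| <= 1 -> schwartz u ->
  (forall xi, FT u xi = (s * wedge v W al be j l xi)%:C) ->
  forall x, `|dot (axis i) x| ^+ m * normc (cderiv b u x) <= K * (2 ^+ j) ^+ M.
Proof.
have [K [M [K0 HK]]] := wedge_jet_bound hphi hW hv i b m.
(* Dividing by the power of [2 pi i] contained in [fpow b] leaves a real function, a monomial times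
   the window. *)
pose k : C := tpi 1 ^+ (b.1 + b.2).
have k0 : k != 0 by rewrite expf_neq0// tpi1_neq0.
exists (normc k * (2 * K) * 4 * pi ^+ 2), (M + 8)%N.
split.
  apply: mulr_ge0; last exact: sqr_ge0.
  by apply: mulr_ge0 => //; apply: mulr_ge0; [exact: normc_ge0|apply: mulr_ge0].
move=> j l al be s u al1 be1 s1 su Fu x.
pose Y : R := 2 ^+ j.
have Y1 : 1 <= Y by rewrite exprn_ege1// ler1n.
have Y0 : 0 < Y by rewrite exprn_gt0.
have YY : 2 ^+ (2 * j) = Y ^+ 2 by rewrite mulnC exprM.
have Y2 : 1 <= Y ^+ 2 by rewrite exprn_ege1.
have F0 xi : k^-1 * fjet i b u 0 xi = (xi.1 ^+ b.1 * xi.2 ^+ b.2 * (s * wedge v W al be j l xi))%:C.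
  by rewrite fjet0// fpowE Fu -/k !mulrA mulVf// mul1r -!rmorphM /= !mulrA.
have bRe xi := HK j l al be s (fun n xi => complex.Re (k^-1 * fjet i b u n xi)) al1 be1 s1
  (fun x => fjet_re_jet i b k^-1 x su) (fun xi => congr1 (fun z : C => complex.Re z) (F0 xi)) xi.
(* The imaginary part of that function is zero, so its jet is the case [s = 0] of the same bound. *)
have bIm xi := HK j l al be 0 (fun n xi => complex.Re (- 'i * k^-1 * fjet i b u n xi)) al1 be1 
  (_ : `|0 : R| <= 1) (fun x => fjet_re_jet i b (- 'i * k^-1) x su) _ xi.
have E xi : complex.Re (- 'i * k^-1 * fjet i b u m xi) = complex.Im (k^-1 * fjet i b u m xi).
  by rewrite -mulrA; set z := k^-1 * _; case: z => z1 z2 /=; ring.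
have cpt xi : normc (fjet i b u m xi) <= normc k * (2 * K) * Y ^+ M /\
   (Y ^+ 2 / 2 < `|xi.1| \/ Y ^+ 2 / 2 < `|xi.2| -> normc (fjet i b u m xi) = 0).
  have [r1 r2] := bRe xi.
  have /(_ _ _ xi)[||i1 i2] := bIm.
  - by rewrite normr0.
  - move=> eta; rewrite -mulrA F0 mul0r mulr0 /=; ring.
  rewrite E in i1 i2; rewrite YY in r2 i2.
  have fE : fjet i b u m xi = k * (k^-1 * fjet i b u m xi) by rewrite mulrA mulfV ?mul1r.
  rewrite fE Normc.normcM; split.
    rewrite -mulrA ler_wpM2l ?normc_ge0// (le_trans (normc_le _))//.
    by rewrite -/Y in r1 i1; lra.
  move=> H; have -> : k^-1 * fjet i b u m xi = 0 by apply: complex_eq; [exact: r2|exact: i2].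
  by rewrite Normc.normc0 mulr0.
have [Km Km0 dm] := moment_decay i b m su.
have fm xi : normc (fjet i b u m xi) = (2 * pi) ^+ m * normc (FT (moment i b m u) xi).
  by rewrite /fjet Normc.normcM normcX normc_tpi normrN normr1 mulr1.
have p2 : 1 <= (2 * pi) ^+ m :> R by rewrite exprn_ege1//; have := pi_ge2 R; lra.
have dF : decay (normc k * (2 * K) * 4 * Y ^+ (M + 8)) (FT (moment i b m u)).
  split; first exact: FT_cmeas dm.
  move=> xi; have [c1 c2] := cpt xi.
  apply: (@le_trans _ _ (normc (fjet i b u m xi))).
    by rewrite fm ler_peMl ?normc_ge0.
  have [H|] := boolP ((Y ^+ 2 / 2 < `|xi.1|) || (Y ^+ 2 / 2 < `|xi.2|)).
    rewrite c2; last by case/orP: H => H; [left|right].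
    apply: mulr_ge0; last exact: ltW (rho_gt0 _).
    apply: mulr_ge0; last exact: exprn_ge0 (ltW Y0).
    by apply: mulr_ge0 => //; apply: mulr_ge0; [exact: normc_ge0|apply: mulr_ge0].
  rewrite negb_or -!leNgt => /andP[x1 x2].
  apply: (le_trans c1); rewrite exprD.
  have q t : `|t| <= Y ^+ 2 / 2 -> 1 + t ^+ 2 <= 2 * Y ^+ 4.
    move=> ht; have : t ^+ 2 <= (Y ^+ 2 / 2) ^+ 2.
      by rewrite -[t ^+ 2]real_normK ?num_real// lerXn2r// nnegrE divr_ge0// exprn_ge0// ltW.
    have : 1 <= Y ^+ 4 by rewrite exprn_ege1.
    have -> : (Y ^+ 2 / 2) ^+ 2 = Y ^+ 4 / 4 by field.
    lra.
  have qq : 1 <= 4 * Y ^+ 8 * rho xi.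
    rewrite /rho /rho1 -invfM ler_pdivlMr ?mul1r; last by rewrite mulr_gt0// ltr_pwDl ?sqr_ge0.
    have -> : 4 * Y ^+ 8 = (2 * Y ^+ 4) * (2 * Y ^+ 4) by ring.
    by rewrite ler_pM ?q// addr_ge0 ?sqr_ge0.
  have A0 : 0 <= normc k * (2 * K) * Y ^+ M.
    by rewrite !mulr_ge0 ?normc_ge0 ?exprn_ge0 ?(ltW Y0).
  have := ler_wpM2l A0 qq; rewrite mulr1; lra.
have [m1 m2] := moment_cont i b m su.
rewrite -normc_moment -(FT_inversion x dm dF m1 m2).
rewrite (le_trans (IFT_bound x dF))//.
by rewrite -/Y; lra.
Qed.

(** A mixed monomial is at most the sum of the two pure powers of the same degree, for which the
    moments along the axes are bounded. *)
Lemma wedge_seminorm a b : exists (K : R) (M : nat), 0 <= K /\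
  forall (j : nat) (l : int) (al be s : R) (u : R * R -> C),
  `|al| <= 1 -> `|be| <= 1 -> `|s| <= 1 -> schwartz u ->
  (forall xi, FT u xi = (s * wedge v W al be j l xi)%:C) ->
  forall x, `|x.1 ^+ a.1 * x.2 ^+ a.2| * normc (cderiv b u x) <= K * (2 ^+ j) ^+ M.
Proof.
pose m := (a.1 + a.2)%N.
have [K [M [K0 HK]]] := wedge_moment 0 b m; have [L [N [L0 HL]]] := wedge_moment 1 b m.
exists (K + L), (M + N)%N; split; first exact: addr_ge0.
move=> j l al be s u al1 be1 s1 su Fu x.
move: (HK j l al be s u al1 be1 s1 su Fu x) (HL j l al be s u al1 be1 s1 su Fu x).
set Nx := normc (cderiv b u x); have N0 : 0 <= Nx by exact: normc_ge0.
rewrite ![dot (axis _) _]dotC !dot_axis /=.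
have pw (p q : R) n r : 0 <= p -> 0 <= q -> p ^+ n * q ^+ r <= p ^+ (n + r) + q ^+ (n + r).
  move=> p0 q0; have [pq|pq] := leP p q.
    rewrite exprD [q ^+ (n + r)]exprD (le_trans (_ : _ <= q ^+ n * q ^+ r))//.
      by rewrite ler_wpM2r ?exprn_ge0// lerXn2r// nnegrE.
    by rewrite lerDr mulr_ge0// exprn_ge0.
  rewrite exprD [q ^+ (n + r)]exprD (le_trans (_ : _ <= p ^+ n * p ^+ r))//.
    by rewrite ler_wpM2l ?exprn_ge0// lerXn2r// ?nnegrE// ltW.
  by rewrite lerDl mulr_ge0// exprn_ge0.
pose Y : R := 2 ^+ j; rewrite -/Y.
have Y1 : 1 <= Y by rewrite exprn_ege1// ler1n.
have Y0 : 0 <= Y by rewrite exprn_ge0.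
have := ler_wpM2r N0 (pw `|x.1| `|x.2| a.1 a.2 (normr_ge0 _) (normr_ge0 _)).
rewrite -/m normrM !normrX => H1 H3 H2.
apply: (le_trans H1); rewrite mulrDl mulrDl lerD//.
  rewrite (le_trans H3)// ler_wpM2l// exprD ler_peMr ?exprn_ege1 ?exprn_ge0 ?ler1n//.
rewrite (le_trans H2)// ler_wpM2l// exprD ler_peMl ?exprn_ege1 ?exprn_ge0 ?ler1n//.
Qed.

End WedgeSeminorm.

(** * The Fejer kernel *)

Section Fejer.
Context {R : realType}.
Local Notation C := (R[i]).
Local Notation normc := (@Normc.normc R).
Local Notation l1 := (@lebesgue_measure R).
Local Notation plane := (measurableTypeR R * measurableTypeR R)%type.
Implicit Types (a c t : R) (N : nat).

Definition cell a t : R := if `|t| <= a then 1 else 0.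

Lemma cell_ge0 a t : 0 <= cell a t.
Proof. by rewrite /cell; case: ifP. Qed.

Lemma cellE a t : cell a t = \1_(`[- a, a]%classic) t.
Proof. by rewrite /cell indicE mem_setE /= in_itv /= -ler_norml; case: (`|t| <= a). Qed.

Lemma measurable_cell a : measurable_fun setT (cell a : measurableTypeR R -> R).
Proof.
rewrite (_ : cell a = \1_(`[- a, a]%classic)); last by apply/funext => t; rewrite cellE.
exact: measurable_indic.
Qed.

Lemma continuous_cosM c : continuous (fun t => cos (c * t)).
Proof.
move=> t; apply: (@continuous_comp _ _ _ (fun t : R => c * t) cos); last exact: continuous_cos.
exact: mulrl_continuous.
Qed.

Lemma integrable_cell_cos a c : l1.-integrable setT (EFin \o (fun t => cell a t * cos (c * t))).
Proof.
have i1 : l1.-integrable setT (EFin \o cell a).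
  have ir := integrableZl measurableT (1 + a ^+ 2) (@integrable_rho1 R).
  apply: (le_integrable measurableT _ _ ir) => /=; first by apply/measurable_EFinP; exact: measurable_cell.
  move=> t _; rewrite lee_fin !ger0_norm ?cell_ge0//; last first.
    by rewrite mulr_ge0 ?(ltW (rho1_gt0 _))// addr_ge0 ?sqr_ge0.
  rewrite /cell; case: ifP => ta; last first.
    by rewrite mulr_ge0 ?(ltW (rho1_gt0 _))// addr_ge0 ?sqr_ge0.
  rewrite ler_pdivlMr ?mul1r; last by rewrite ltr_pwDl ?sqr_ge0.
  by rewrite lerD2l -[t ^+ 2]real_normK ?num_real// lerXn2r// nnegrE (le_trans _ ta).
apply: (le_integrable measurableT _ _ i1) => /=.
  apply/measurable_EFinP; apply: measurable_funM; first exact: measurable_cell.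
  by apply: continuous_measurable_fun; exact: continuous_cosM.
by move=> t _; rewrite lee_fin normrM ler_piMr ?normr_ge0// cos_max.
Qed.

Lemma Rintegral_cell_cos a c : 0 < a ->
  Rintegral l1 setT (fun t => cell a t * cos (c * t)) =
  if c == 0 then 2 * a else 2 * sin (c * a) / c.
Proof.
move=> a0.
have -> : Rintegral l1 setT (fun t => cell a t * cos (c * t)) =
    fine (\int[l1]_(t in `[(- a)%R, a%R]) (cos (c * t))%:E)%E.
  rewrite /Rintegral [in RHS]integral_mkcond; congr fine; apply: eq_integral => t _.
  rewrite patchE cellE indicE; case: ifPn => _; rewrite ?mul1r ?mul0r//.
have aa : - a < a by lra.
have fc (f : R -> R) (F : R -> R) : (forall t, is_derive t 1 F (f t)) -> continuous f ->
    (\int[l1]_(t in `[(- a)%R, a]) (f t)%:E)%E = (F a - F (- a))%:E.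
  move=> dF cf; rewrite (@continuous_FTC2 R f F _ _ aa)//.
  - by apply: continuous_subspaceT.
  - have cF : continuous F.
      move=> t; have /derivable1_diffP /differentiable_continuous : derivable F t 1 by case: (dF t).
      by [].
    split; first by move=> t _; case: (dF t).
      by apply: cvg_at_right_filter; exact: cF.
    by apply: cvg_at_left_filter; exact: cF.
  - by move=> t _; rewrite derive1E; case: (dF t).
case: eqVneq => [->|c0].
  rewrite (_ : (fun t => _) = fun=> 1%:E); last by apply/funext => t; rewrite mul0r cos0.
  rewrite (fc (fun=> 1) id) /=; [by lra|by move=> t; exact: cvg_cst].
have d t : is_derive t 1 (fun t : R => c^-1 * sin (c * t)) (cos (c * t)).
  have dl : is_derive t 1 (fun t : R => c * t) c.
    have := @is_deriveZ R R R id c t 1 1 _.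
    by rewrite /GRing.scale /= mulr1; exact.
  have dS := is_derive1_comp (f := sin) (is_derive_sin (c * t)) dl.
  have := @is_deriveZ R R R _ c^-1 t 1 _ dS.
  by rewrite /GRing.scale /= mulrC mulfK.
rewrite (fc _ _ d (@continuous_cosM c)) /= mulrN sinN; by field.
Qed.

Lemma sin_pi_nat n : sin (pi * n%:R) = 0 :> R.
Proof.
elim: n => [|n IH]; first by rewrite mulr0 sin0.
by rewrite -natr1 mulrDr mulr1 sinDpi IH oppr0.
Qed.

Definition fejer N t : R := N%:R^-1 * normc (\sum_(n < N) expi (2 * pi * (n%:R * t))) ^+ 2.

Lemma fejer_ge0 N t : 0 <= fejer N t.
Proof. by rewrite mulr_ge0 ?invr_ge0// sqr_ge0. Qed.

Lemma normc_sqr (z : C) : (normc z ^+ 2)%:C = z * z^*.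
Proof.
case: z => x y; apply: complex_eq; rewrite ?ReMc ?ImMc/=; last by ring.
by rewrite sqr_sqrtr ?addr_ge0 ?sqr_ge0//; ring.
Qed.

Lemma fejer_expi N t : (fejer N t)%:C =
  (N%:R^-1)%:C * \sum_(n < N) \sum_(m < N) expi (2 * pi * ((n%:R - m%:R) * t)).
Proof.
transitivity ((N%:R^-1)%:C * (normc (\sum_(n < N) expi (2 * pi * (n%:R * t))) ^+ 2)%:C).
  exact: rmorphM.
rewrite normc_sqr; congr (_ * _).
rewrite rmorph_sum big_distrl /=; apply: eq_bigr => n _.
rewrite big_distrr /=; apply: eq_bigr => m _.
by rewrite [X in _ * X]expi_conj -expiD; congr expi; ring.
Qed.

Lemma fejer_cos N t : fejer N t =
  N%:R^-1 * \sum_(n < N) \sum_(m < N) cos (2 * pi * (n%:R - m%:R) * t).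
Proof.
have := congr1 (fun z : C => complex.Re z) (fejer_expi N t).
rewrite ReMc [complex.Re _%:C]/= [complex.Re _%:C]/= [complex.Im _%:C]/= mul0r subr0 Rec_sum => ->.
by congr (_ * _); apply: eq_bigr => n _; rewrite Rec_sum; apply: eq_bigr => m _ /=; rewrite mulrA.
Qed.

Lemma measurable_fejer N : measurable_fun setT (fejer N : measurableTypeR R -> R).
Proof.
rewrite (_ : fejer N = fun t => N%:R^-1 * \sum_(n < N) \sum_(m < N) cos (2 * pi * (n%:R - m%:R) * t)).
  apply: measurable_funM => //; apply: measurable_sum => n; apply: measurable_sum => m.
  by apply: continuous_measurable_fun; exact: continuous_cosM.
by apply/funext => t; rewrite fejer_cos.
Qed.

(* Multiplying the geometric sum by [expi (2 pi t) - 1] makes it telescope. *)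
Lemma fejer_tail N t : fejer N t * normc (expi (2 * pi * t) - 1) ^+ 2 <= 4 * N%:R^-1.
Proof.
rewrite /fejer -[leLHS]mulrA -exprMn -Normc.normcM mulrC ler_wpM2r ?invr_ge0//.
have -> : (\sum_(n < N) expi (2 * pi * (n%:R * t))) * (expi (2 * pi * t) - 1) =
    expi (2 * pi * (N%:R * t)) - 1.
  elim: N => [|N IH]; first by rewrite big_ord0 mul0r mul0r mulr0 expi0 subrr.
  rewrite big_ord_recr /= mulrDl IH mulrBr mulr1 -expiD -[N.+1%:R]natr1.
  have -> : 2 * pi * (N%:R * t) + 2 * pi * t = 2 * pi * ((N%:R + 1) * t) by ring.
  by ring.
have -> : 4 = (2 : R) ^+ 2 by rewrite expr2; lra.
rewrite lerXn2r ?nnegrE ?normc_ge0// (le_trans (normcB _ _))// normc_expi Normc.normc1; lra.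
Qed.

Lemma integrable_cell_fejer a N :
  l1.-integrable setT (EFin \o (fun t => cell a t * fejer N t)).
Proof.
rewrite (_ : (fun t => _) = fun t => N%:R^-1 * \sum_(n < N) \sum_(m < N)
    (cell a t * cos (2 * pi * (n%:R - m%:R) * t))).
  have H : l1.-integrable setT (fun t => (\sum_(n < N) \sum_(m < N)
      (cell a t * cos (2 * pi * (n%:R - m%:R) * t))%:E)%E).
    apply: integrable_sum => // n _; apply: integrable_sum => // m _; exact: integrable_cell_cos.
  have := integrableZl measurableT N%:R^-1 H; congr (_.-integrable _ _); apply/funext => t /=.
  by rewrite EFinM -sumEFin; congr (_ * _)%E; apply: eq_bigr => n _; rewrite -sumEFin.
apply/funext => t; rewrite fejer_cos mulrCA; congr (_ * _).
by rewrite mulr_sumr; apply: eq_bigr => n _; rewrite mulr_sumr.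
Qed.

(** Over an interval of integer length the diagonal terms of the double sum contribute [q] each and
    the others nothing. Length 1 normalises the kernel; length 2 gives its mass on [[-1, 1]], which
    contains the recentred cells. *)
Lemma Rintegral_cell_fejer (q N : nat) : (0 < q)%N -> (0 < N)%N ->
  Rintegral l1 setT (fun t => cell (q%:R / 2) t * fejer N t) = q%:R.
Proof.
move=> q0 N0; set a := q%:R / 2.
have a0 : 0 < a by rewrite divr_gt0// ltr0n.
have N0' : N%:R != 0 :> R by rewrite pnatr_eq0 -lt0n.
transitivity (N%:R^-1 * \sum_(n < N) \sum_(m < N)
    Rintegral l1 setT (fun t => cell a t * cos (2 * pi * (n%:R - m%:R) * t))).
  have E t : (cell a t * fejer N t)%:C = (N%:R^-1)%:C * \sum_(n < N) \sum_(m < N)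
      (cell a t * cos (2 * pi * (n%:R - m%:R) * t))%:C.
    rewrite fejer_cos mulrCA rmorphM; congr (_ * _).
    rewrite mulr_sumr rmorph_sum; apply: eq_bigr => n _.
    by rewrite mulr_sumr rmorph_sum.
  have ic c : cintble l1 (fun t => (cell a t * cos (c * t))%:C).
    by split; [exact: integrable_cell_cos|exact: integrable0].
  have := @cint_real _ _ _ l1 (fun t => cell a t * fejer N t).
  rewrite (_ : (fun t => _%:C) = fun t => (N%:R^-1)%:C * \sum_(n < N) \sum_(m < N)
      (cell a t * cos (2 * pi * (n%:R - m%:R) * t))%:C); last exact/funext.
  rewrite cintZ; last by do 2!apply: cintble_sum => ?; exact: ic.
  rewrite cint_sum; last by move=> ?; apply: cintble_sum => ?; exact: ic.
  rewrite (eq_bigr (fun n : 'I_N => (\sum_(m < N) Rintegral l1 setT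
      (fun t => cell a t * cos (2 * pi * (n%:R - m%:R) * t)))%:C)); last first.
    move=> n _; rewrite cint_sum; last by move=> ?; exact: ic.
    by rewrite rmorph_sum; apply: eq_bigr => m _; exact: cint_real.
  by rewrite -rmorph_sum -rmorphM => /(congr1 (fun z : C => complex.Re z)) /= ->.
rewrite (eq_bigr (fun=> q%:R)); first by rewrite sumr_const card_ord -[q%:R *+ N]mulr_natr mulrCA mulVf ?mulr1.
move=> n _; rewrite (bigD1 n)//= big1 ?addr0.
  by rewrite Rintegral_cell_cos// subrr mulr0 eqxx /a; field.
move=> m nm; rewrite Rintegral_cell_cos//.
have c0 : n%:R - m%:R != 0 :> R by rewrite subr_eq0 eqr_nat eq_sym.
rewrite ifF; last by rewrite mulf_eq0 (negbTE c0) orbF mulf_eq0 pnatr_eq0 (gt_eqF (pi_gt0 R)).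
have -> : 2 * pi * (n%:R - m%:R) * a = pi * (q * n)%:R - pi * (q * m)%:R :> R.
  by rewrite /a !natrM; field.
by rewrite sinB !sin_pi_nat mul0r mulr0 subrr mulr0 mul0r.
Qed.

Lemma normc_expiB1 t : normc (expi t - 1) ^+ 2 = 2 * (1 - cos t).
Proof.
rewrite normcE sqr_sqrtr ?addr_ge0 ?sqr_ge0//= subr0.
have := cos2Dsin2 t; set x := cos t; set y := sin t => H.
have -> : y ^+ 2 = 1 - x ^+ 2 by lra.
ring.
Qed.

(** The only integer in [[-a, a]] is 0, so there the distance of [expi (2 pi t)] from 1 controls
    [|t|]. Small angles follow from Taylor, those up to [pi] from the monotonicity of the cosine,
    and larger ones by reflection at [pi]. *)
Lemma expiB1_lower a : 2^-1 <= a < 1 -> exists2 K : R, 0 <= K &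
  forall t, `|t| <= a -> t ^+ 2 <= K * normc (expi (2 * pi * t) - 1) ^+ 2.
Proof.
move=> /andP[a2 a1]; have p2 := pi_ge2 R;
(* Lower bounds for [1 - cos] on [[1 / 4, pi]] and on [[pi, 2 pi a]]. *)
pose k1 : R := 1 - cos (4^-1); pose k2 : R := 1 - cos (2 * pi * (1 - a)).
have pa0 : 0 < 2 * pi * (1 - a) by rewrite mulr_gt0 ?mulr_gt0 ?pi_gt0 ?subr_gt0.
have pa1 : 2 * pi * (1 - a) <= pi.
  by rewrite mulrC mulrA -[leRHS]mul1r ler_pM2r ?pi_gt0//; lra.
have cos1 (x : R) : 0 < x <= pi -> 0 < 1 - cos x.
  by move=> /andP[x0 xp]; rewrite subr_gt0 -[ltRHS]cos0 ltr_cos// in_itv /= ?lexx ?pi_ge0// ltW.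
have cos_le_cos (x y : R) : 0 <= x <= pi -> 0 <= y <= pi -> y <= x -> cos x <= cos y.
  by move=> xp yp yx; rewrite leNgt ltr_cos// -leNgt.
have k10 : 0 < k1 by apply: cos1; lra.
have k20 : 0 < k2 by apply: cos1; rewrite pa0.
exists (1 + (2 * k1)^-1 + (2 * k2)^-1) => [|t ta].
  by rewrite !addr_ge0 ?invr_ge0 ?mulr_ge0 ?(ltW k10) ?(ltW k20).
set S := normc _ ^+ 2; have S0 : 0 <= S by exact: sqr_ge0.
have t1 : t ^+ 2 <= 1 by rewrite -[t ^+ 2]real_normK ?num_real// expr_le1// ltW// (le_lt_trans ta).
pose x := 2 * pi * `|t|.
have x0 : 0 <= x by rewrite /x mulr_ge0// mulr_ge0// pi_ge0.
have SE : S = 2 * (1 - cos x).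
  rewrite /S normc_expiB1 /x; have [t0|t0] := ger0P t; first by [].
  by rewrite mulrN cosN.
have i0 (k : R) : 0 < k -> 0 <= (2 * k)^-1 * S.
  by move=> k0; apply: mulr_ge0 => //; rewrite invr_ge0 mulr_ge0// ltW.
have i1 := i0 _ k10; have i2 := i0 _ k20.
have case2 (k : R) : 0 < k -> k <= 1 - cos x -> 1 <= (2 * k)^-1 * S.
  by move=> k0 kx; rewrite mulrC ler_pdivlMr ?mulr_gt0// mul1r SE ler_pM2l.
rewrite [leRHS]mulrDl [X in X + _]mulrDl [1 * S]mul1r.
have [xs|xs] := leP x 4^-1.
  suff : t ^+ 2 <= S by lra.
  have h : x - 2 * x ^+ 2 <= normc (expi (2 * pi * t) - 1).
    have xE : x = `|2 * pi * t| by rewrite normrM /x (ger0_norm (_ : 0 <= 2 * pi))// mulr_ge0 ?pi_ge0.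
    have := expi_taylor (2 * pi * t); set z := expi _ - 1.
    have -> : (2 * pi * t) ^+ 2 = x ^+ 2 by rewrite xE real_normK// num_real.
    have := le_normcD (z - (0 +i* (2 * pi * t))) (0 +i* (2 * pi * t)).
    have -> : normc (0 +i* (2 * pi * t)) = x by rewrite xE normcE /= expr0n add0r sqrtr_sqr.
    have := le_normcD ((0 +i* (2 * pi * t)) - z) z.
    rewrite !subrK normcBC => h1 h2 h3.
    have : normc (0 +i* (2 * pi * t)) = x by rewrite xE normcE /= expr0n add0r sqrtr_sqr.
    by move: h1 h3; lra.
  have xt : 4 * `|t| <= x by rewrite /x ler_wpM2r//; lra.
  have x2 : 2 * x ^+ 2 <= x / 2.
    have : x * x <= x * 4^-1 by rewrite ler_wpM2l.
    by rewrite expr2; lra.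
  rewrite /S -[t ^+ 2]real_normK ?num_real// lerXn2r// ?nnegrE ?normc_ge0//.
  by have := normr_ge0 t; lra.
have [xp|xp] := leP x pi.
  have : k1 <= 1 - cos x.
    by rewrite lerD2l lerN2; apply: cos_le_cos; lra.
  by move=> /(case2 _ k10); lra.
have : k2 <= 1 - cos x.
  rewrite lerD2l lerN2 -[cos x]cosN.
  have -> : cos (- x) = cos (2 * pi - x) by rewrite addrC mulr_natl cosD2pi.
  have xa : x <= 2 * pi * a by rewrite /x ler_wpM2l// mulr_ge0// pi_ge0.
  by apply: cos_le_cos; lra.
by move=> /(case2 _ k20); lra.
Qed.

Local Notation l2 := (@leb2 R).
Definition fejer2 N (v : plane) : R := fejer N v.1 * fejer N v.2.

Lemma fejer2_ge0 N v : 0 <= fejer2 N v.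
Proof. by rewrite mulr_ge0 ?fejer_ge0. Qed.

Lemma measurable_fejer2 N : measurable_fun setT (fejer2 N).
Proof.
by apply: measurable_funM; apply: measurableT_comp => //; exact: measurable_fejer.
Qed.

Lemma integrable_cell (a : R) : l1.-integrable setT (EFin \o cell a).
Proof.
have := integrable_cell_cos a 0; congr (_.-integrable _ _); apply/funext => t /=.
by rewrite mul0r cos0 mulr1.
Qed.

Lemma Rintegral_cell (a : R) : 0 < a -> Rintegral l1 setT (cell a) = 2 * a.
Proof.
move=> a0; have := Rintegral_cell_cos 0 a0; rewrite eqxx => <-.
by apply: eq_Rintegral => t _; rewrite mul0r cos0 mulr1.
Qed.

Definition cell_fejer (a : R) N (v : plane) : R :=
  (cell a v.1 * fejer N v.1) * (cell a v.2 * fejer N v.2).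

Lemma cell_fejer_ge0 a N v : 0 <= cell_fejer a N v.
Proof. by apply: mulr_ge0; apply: mulr_ge0; rewrite ?cell_ge0 ?fejer_ge0. Qed.

Lemma integrable_cell_fejer2 a N : l2.-integrable setT (EFin \o cell_fejer a N).
Proof. exact: integrable_prod (integrable_cell_fejer a N) (integrable_cell_fejer a N). Qed.

Lemma Rintegral_cell_fejer2 (q N : nat) : (0 < q)%N -> (0 < N)%N ->
  Rintegral l2 setT (cell_fejer (q%:R / 2) N) = q%:R ^+ 2.
Proof.
move=> q0 N0; rewrite (Rintegral_prod (integrable_cell_fejer _ N) (integrable_cell_fejer _ N)).
by rewrite Rintegral_cell_fejer// expr2.
Qed.

Section Approximation.
Variables (f : plane -> C) (B a : R).
Hypotheses (mf : cmeas f) (a2 : 2^-1 <= a < 1) (fB : forall v, normc (f v) <= B)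
  (f_lip : forall v, normc (f v - f 0) <= B * (`|v.1| + `|v.2|))
  (f_supp : forall v, f v != 0 -> `|v.1| <= a /\ `|v.2| <= a).

Let a1 : a <= 1. Proof. by case/andP: a2 => _ /ltW. Qed.

Lemma fejer2_bound N v : normc (f v * (fejer2 N v)%:C) <= B * cell_fejer 1 N v.
Proof.
rewrite Normc.normcM normc_real ger0_norm ?fejer2_ge0//.
have [->|f0] := eqVneq (f v) 0.
  have B0 : 0 <= B by exact: le_trans (normc_ge0 _) (fB 0).
  by rewrite Normc.normc0 mul0r mulr_ge0// cell_fejer_ge0.
have [v1 v2] := f_supp f0.
rewrite /cell_fejer /cell !(le_trans _ a1)// !mul1r ler_wpM2r//.
exact: fejer2_ge0.
Qed.

Lemma fejer2_meas N : @cmeas _ _ plane (fun v => f v * (fejer2 N v)%:C).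
Proof. by apply: cmeasM => //; apply: cmeas_real; exact: measurable_fejer2. Qed.

Lemma fejer2_cintble N : cintble l2 (fun v => f v * (fejer2 N v)%:C).
Proof.
apply: le_cintble (fejer2_meas N) (fejer2_bound N).
exact: (integrableZl measurableT B (integrable_cell_fejer2 1 N)).
Qed.

Lemma normc_fejer2 N : (0 < N)%N ->
  normc (cint l2 (fun v => f v * (fejer2 N v)%:C)) <= 4 * B.
Proof.
move=> N0; apply: (le_trans (normc_cint (fejer2_meas N) _ (fejer2_bound N))).
  exact: (integrableZl measurableT B (integrable_cell_fejer2 1 N)).
rewrite RintegralZl//; last exact: integrable_cell_fejer2.
have -> : 1 = 2%:R / 2 :> R by rewrite mulfV.
by have := @Rintegral_cell_fejer2 2 N isT N0 => ->; rewrite expr2; lra.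
Qed.

(** The value [f 0] is compared on the unit cell, where the kernel has mass 1. Off that cell
    [|v.1| + |v.2|] exceeds [1 / 2], so the plain bound for [f] is again linear; the tail of the
    kernel then splits each linear term into parts of order [eps] and [1 / (N eps)]. *)
Lemma fejer2_error K N eps v : 0 <= K ->
  (forall t, `|t| <= a -> t ^+ 2 <= K * normc (expi (2 * pi * t) - 1) ^+ 2) ->
  0 < eps ->
  normc (f v - f 0 * (cell 2^-1 v.1 * cell 2^-1 v.2)%:C) * fejer2 N v <=
  2 * B * (2 * eps * cell_fejer 1 N v + K / eps * (4 * N%:R^-1) *
    (cell 1 v.1 * (cell 1 v.2 * fejer N v.2) + (cell 1 v.1 * fejer N v.1) * cell 1 v.2)).
Proof.
move=> K0 HK eps0.
have B0 : 0 <= B by exact: le_trans (normc_ge0 _) (fB 0).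
have ah : 2^-1 <= a by case/andP: a2.
set z := f v - _.
have N4 : 0 <= 4 * N%:R^-1 :> R by rewrite mulr_ge0 ?invr_ge0.
have Ke : 0 <= K / eps by rewrite divr_ge0// ltW.
have F1 := fejer_ge0 N v.1; have F2 := fejer_ge0 N v.2.
have [->|z0] := eqVneq z 0.
  rewrite Normc.normc0 mul0r; apply: mulr_ge0; first exact: mulr_ge0.
  apply: addr_ge0; first by apply: mulr_ge0; [rewrite mulr_ge0// ltW|exact: cell_fejer_ge0].
  apply: mulr_ge0; first exact: mulr_ge0.
  have c1 := cell_ge0 1 v.1; have c2 := cell_ge0 1 v.2.
  exact: addr_ge0 (mulr_ge0 c1 (mulr_ge0 c2 F2)) (mulr_ge0 (mulr_ge0 c1 F1) c2).
have [v1 v2] : `|v.1| <= a /\ `|v.2| <= a.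
  have [f0|/f_supp//] := eqVneq (f v) 0.
  move: z0; rewrite /z f0 sub0r oppr_eq0 mulf_eq0 negb_or => /andP[_].
  rewrite /cell; have [c1|] := leP `|v.1| 2^-1; last by rewrite mul0r eqxx.
  have [c2|] := leP `|v.2| 2^-1; last by rewrite mulr0 eqxx.
  by split; apply: le_trans ah.
have zB : normc z <= 2 * B * (`|v.1| + `|v.2|).
  have n1 := normr_ge0 v.1; have n2 := normr_ge0 v.2.
  have out : 2^-1 < `|v.1| + `|v.2| -> normc (f v) <= 2 * B * (`|v.1| + `|v.2|).
    move=> h; apply: (le_trans (fB v)); rewrite mulrAC ler_peMl//; lra.
  rewrite /z /cell; have [c1|c1] := leP `|v.1| 2^-1; last by rewrite mul0r mulr0 subr0; apply: out; lra.
  have [c2|c2] := leP `|v.2| 2^-1; last by rewrite mulr0 mulr0 subr0; apply: out; lra.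
  rewrite !mulr1 (le_trans (f_lip v))// -mulrA ler_peMl ?ler1n// mulr_ge0// addr_ge0.
rewrite /cell_fejer /fejer2 /cell !(le_trans _ a1)// !mul1r !mulr1.
(* [`|t|] is at most [eps + t ^ 2 / eps], and [t ^ 2] is controlled by
   [|expi (2 pi t) - 1| ^ 2], which the kernel turns into [O(1 / N)]. *)
have amgm t : `|t| <= eps + t ^+ 2 / eps.
  rewrite -[t ^+ 2]real_normK ?num_real// -subr_ge0.
  have -> : eps + `|t| ^+ 2 / eps - `|t| = ((eps - `|t| / 2) ^+ 2 + 3 / 4 * `|t| ^+ 2) / eps.
    by field; rewrite gt_eqF.
  apply: divr_ge0; last exact: ltW.
  apply: addr_ge0; first exact: sqr_ge0.
  by apply: mulr_ge0; [lra|exact: sqr_ge0].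
set S1 := normc (expi (2 * pi * v.1) - 1) ^+ 2; set S2 := normc (expi (2 * pi * v.2) - 1) ^+ 2.
have T1 : fejer N v.1 * S1 <= 4 * N%:R^-1 := fejer_tail N v.1.
have T2 : fejer N v.2 * S2 <= 4 * N%:R^-1 := fejer_tail N v.2.
have A1 : `|v.1| <= eps + K / eps * S1.
  rewrite (le_trans (amgm _))// lerD2l [leRHS]mulrAC; apply: ler_wpM2r; last exact: HK.
  by rewrite invr_ge0 ltW.
have A2 : `|v.2| <= eps + K / eps * S2.
  rewrite (le_trans (amgm _))// lerD2l [leRHS]mulrAC; apply: ler_wpM2r; last exact: HK.
  by rewrite invr_ge0 ltW.
apply: (@le_trans _ _ (2 * B * (2 * eps + K / eps * (S1 + S2)) * (fejer N v.1 * fejer N v.2))).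
  apply: ler_wpM2r; first exact: mulr_ge0.
  apply: (le_trans zB); apply: ler_wpM2l; first exact: mulr_ge0.
  by rewrite mulrDr; lra.
rewrite -[leLHS]mulrA; apply: ler_wpM2l; first exact: mulr_ge0.
have -> : (2 * eps + K / eps * (S1 + S2)) * (fejer N v.1 * fejer N v.2) =
  2 * eps * (fejer N v.1 * fejer N v.2) +
  K / eps * (fejer N v.1 * S1 * fejer N v.2 + fejer N v.1 * (fejer N v.2 * S2)) by ring.
rewrite lerD2l -[leRHS]mulrA; apply: ler_wpM2l => //; rewrite mulrDr; apply: lerD.
  exact: ler_wpM2r.
by rewrite mulrC; apply: ler_wpM2r.
Qed.

(** The kernel has period 1, but [f] lives in a square of half-side less than 1, which contains no
    lattice point except 0; there the Lipschitz bound is enough. *)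
Lemma fejer2_cvg :
  normc (cint l2 (fun v => f v * (fejer2 N v)%:C) - f 0) @[N --> \oo] --> (0 : R).
Proof.
have [K K0 HK] := expiB1_lower a2.
have B0 : 0 <= B by exact: le_trans (normc_ge0 _) (fB 0).
have i1 := @integrable_cell 1.
have key N eps : (0 < N)%N -> 0 < eps ->
    normc (cint l2 (fun v => f v * (fejer2 N v)%:C) - f 0) <=
    2 * B * (8 * eps + K / eps * (4 * N%:R^-1) * 8).
  move=> N0 eps0.
  have ih := integrable_cell_fejer2 2^-1 N.
  have ic : cintble l2 (fun v => (cell_fejer 2^-1 N v)%:C) by split => //; exact: integrable0.
  have -> : f 0 = cint l2 (fun v => f 0 * (cell_fejer 2^-1 N v)%:C).
    rewrite cintZ// cint_real; have -> : 2^-1 = 1%:R / 2 :> R by rewrite mul1r.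
    by rewrite Rintegral_cell_fejer2// expr1n mulr1.
  rewrite -cintB; [|exact: fejer2_cintble|exact: cintbleZ].
  have i12 : l2.-integrable setT (EFin \o (fun v : plane => cell 1 v.1 * (cell 1 v.2 * fejer N v.2))).
    exact: (integrable_prod i1 (integrable_cell_fejer 1 N)).
  have i21 : l2.-integrable setT (EFin \o (fun v : plane => (cell 1 v.1 * fejer N v.1) * cell 1 v.2)).
    exact: (integrable_prod (integrable_cell_fejer 1 N) i1).
  have i3 := integrableD measurableT i12 i21.
  pose b (v : plane) := 2 * B * (2 * eps * cell_fejer 1 N v + K / eps * (4 * N%:R^-1) *
    (cell 1 v.1 * (cell 1 v.2 * fejer N v.2) + (cell 1 v.1 * fejer N v.1) * cell 1 v.2)).
  have j1 := integrableZl measurableT (2 * eps) (integrable_cell_fejer2 1 N).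
  have j2 := integrableZl measurableT (K / eps * (4 * N%:R^-1)) i3.
  have j3 := integrableD measurableT j1 j2.
  have ib := integrableZl measurableT (2 * B) j3.
  have ib' : l2.-integrable setT (EFin \o b) by [].
  have E1 : 1 = 2%:R / 2 :> R by rewrite mulfV.
  have Q : Rintegral l1 setT (fun t => cell 1 t * fejer N t) = 2.
    by have := @Rintegral_cell_fejer 2 N isT N0; rewrite -E1.
  have Q1 : Rintegral l1 setT (cell 1) = 2 by rewrite Rintegral_cell// mulr1.
  have R1 : Rintegral l2 setT (cell_fejer 1 N) = 4.
    by have := @Rintegral_cell_fejer2 2 N isT N0; rewrite -E1 expr2 => ->; lra.
  have R2 : Rintegral l2 setT (fun v : plane => cell 1 v.1 * (cell 1 v.2 * fejer N v.2)) = 4.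
    by have := Rintegral_prod i1 (integrable_cell_fejer 1 N); rewrite Q Q1 => ->; lra.
  have R3 : Rintegral l2 setT (fun v : plane => (cell 1 v.1 * fejer N v.1) * cell 1 v.2) = 4.
    by have := Rintegral_prod (integrable_cell_fejer 1 N) i1; rewrite Q Q1 => ->; lra.
  have iv : Rintegral l2 setT b = 2 * B * (8 * eps + K / eps * (4 * N%:R^-1) * 8).
    rewrite /b RintegralZl// RintegralD//.
    rewrite !RintegralZl//; last exact: integrable_cell_fejer2.
    rewrite RintegralD// R1 R2 R3; congr (_ * (_ + _ * _)); lra.
  have mg : @cmeas _ _ plane (fun v => f v * (fejer2 N v)%:C - f 0 * (cell_fejer 2^-1 N v)%:C).
    apply: cmeasD; first exact: fejer2_meas.
    by apply: cmeasN; apply: cmeasM; [exact: cmeas_cst|exact: cintble_cmeas ic].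
  rewrite -iv; apply: (normc_cint mg ib') => v.
  apply: le_trans (fejer2_error N v K0 HK eps0).
  rewrite -[X in _ <= _ * X]ger0_norm ?fejer2_ge0// -normc_real -Normc.normcM le_eqVlt; apply/orP; left; apply/eqP; congr normc.
  rewrite mulrBl -mulrA; congr (_ - _ * _); rewrite -rmorphM; congr (_ %:C).
  by rewrite /cell_fejer /fejer2; ring.
(* For [N >= eps ^- 2] both error terms are multiples of [eps]. [D] collects their constants, and
   the added 1 makes it positive and the final inequality strict. *)
pose D := 2 * B * (8 + K * 32) + 1.
have D0 : 0 < D by rewrite ltr_pwDr// mulr_ge0 ?mulr_ge0// addr_ge0 ?mulr_ge0.
apply/cvgrPdist_lt => e e0; near=> N.
have N0 : (0 < N)%N by near: N; exact: nbhs_infty_gt.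
rewrite sub0r normrN ger0_norm ?normc_ge0//.
pose eps := e / D; have eps0 : 0 < eps by rewrite divr_gt0.
have Ne : eps ^- 2 <= N%:R by near: N; exact: nbhs_infty_ger.
have Ne1 : N%:R^-1 <= eps ^+ 2.
  by rewrite -[eps ^+ 2]invrK lef_pV2 ?posrE ?invr_gt0 ?exprn_gt0 ?ltr0n.
apply: (le_lt_trans (key N eps N0 eps0)).
have h : K / eps * (4 * N%:R^-1) * 8 <= K * 32 * eps.
  have -> : K * 32 * eps = K / eps * (4 * eps ^+ 2) * 8 by field; rewrite gt_eqF.
  apply: ler_wpM2r => //; apply: ler_wpM2l; first by rewrite divr_ge0// ltW.
  exact: ler_wpM2l.
apply: (@le_lt_trans _ _ (2 * B * (8 + K * 32) * eps)).
  rewrite -[leRHS]mulrA; apply: ler_wpM2l; first exact: mulr_ge0.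
  by rewrite mulrDl; lra.
have -> : e = D * eps by rewrite /eps mulrC divfK ?gt_eqF.
by rewrite ltr_pM2r// /D ltrDl.
Unshelve. all: end_near. Qed.

End Approximation.

End Fejer.

(** * Sampling on a lattice *)

Section FejerMean.
Context {R : realType}.
Local Notation C := (R[i]).
Local Notation normc := (@Normc.normc R).
Implicit Types (N m n : nat) (k : int * int).

(** The square of side [N] with lower corner [(- m1, - m2)]. Over all shifts below [N], a point [k]
    with coordinates less than [N] in absolute value is counted [(N - |k.1|) (N - |k.2|)] times. *)
Definition box N m1 m2 : seq (int * int) :=
  [seq (Posz n1 - Posz m1, Posz n2 - Posz m2)%R | n1 <- iota 0 N, n2 <- iota 0 N].

(* Averaging over translated boxes produces the Fejer weights. *)
Definition box_mean N (S : seq (int * int) -> C) : C :=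
  (N%:R^-1 * N%:R^-1)%:C * \sum_(0 <= m1 < N) \sum_(0 <= m2 < N) S (box N m1 m2).

Definition boxes N : seq (int * int) :=
  flatten [seq box N m1 m2 | m1 <- iota 0 N, m2 <- iota 0 N].

Lemma box_meanE N (a : int * int -> C) :
  box_mean N (fun s => \sum_(k <- s) a k) =
  (N%:R^-1 * N%:R^-1)%:C * \sum_(k <- boxes N) a k.
Proof.
by rewrite /box_mean /boxes big_flatten big_allpairs_dep; congr (_ * _); rewrite /index_iota subn0.
Qed.

Lemma box_mean_expi N (v : R * R) :
  box_mean N (fun s => \sum_(k <- s) expi (2 * pi * (k.1%:~R * v.1 + k.2%:~R * v.2))) =
  (fejer2 N v)%:C.
Proof.
have -> : (fejer2 N v)%:C = (fejer N v.1)%:C * (fejer N v.2)%:C by exact: rmorphM.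
rewrite !fejer_expi /box_mean mulrACA -rmorphM; congr (_ * _).
have sw t : \sum_(n < N) \sum_(m < N) expi (2 * pi * ((n%:R - m%:R) * t)) =
    \sum_(m < N) \sum_(n < N) expi (2 * pi * ((n%:R - m%:R) * t)) :> C by exact: exchange_big.
rewrite !sw.
rewrite big_distrl /= big_mkord; apply: eq_bigr => m1 _.
rewrite big_distrr /= big_mkord; apply: eq_bigr => m2 _.
rewrite /box big_allpairs_dep big_distrl /=.
have -> : iota 0 N = index_iota 0 N by rewrite /index_iota subn0.
rewrite big_mkord; apply: eq_bigr => n1 _.
rewrite big_distrr /= big_mkord; apply: eq_bigr => n2 _.
by rewrite -expiD; congr expi; rewrite !rmorphB /= -!pmulrn; ring.
Qed.

End FejerMean.

Section Parseval.
Context {R : realType}.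
Local Notation C := (R[i]).
Local Notation l2 := (@leb2 R).

(** [FT_mult] is applied with the conjugate of [FT h], whose own transform is the conjugate of [h]
    by inversion. *)
Lemma parseval (g h : R * R -> C) : schwartz g -> schwartz h ->
  cint l2 (fun x => g x * conjc (h x)) = cint l2 (fun xi => FT g xi * conjc (FT h xi)).
Proof.
move=> sg sh.
have [K _ dg] := cderiv_decay (0%N, 0%N) sg; rewrite cderiv00 in dg.
have [L dh] := FT_fpow_decay (0%N, 0%N) sh.
have f1 xi : fpow (0%N, 0%N) xi = 1 :> C by rewrite /fpow !expr0 mulr1.
have dh' : decay L (FT h).
  by move: dh; congr (decay L _); apply/funext => xi; rewrite f1 mul1r.
rewrite (FT_mult dg (decay_conj dh')); congr cint; apply/funext => x.
congr (_ * _); have := schwartz_inversion (0%N, 0%N) x sh; rewrite cderiv00 => ->.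
rewrite /IFT -cint_conj; last exact: decay_cintble (decay_ichar x dh).
congr cint; apply/funext => xi; rewrite f1 mul1r rmorphM; congr (_ * _).
by rewrite [LHS]expi_conj dotC.
Qed.

End Parseval.

(** * Fejer sums for one window and its lattice *)

Section Block.
Context {R : realType}.
Local Notation C := (R[i]).
Local Notation normc := (@Normc.normc R).
Local Notation l2 := (@leb2 R).
Local Notation plane := (measurableTypeR R * measurableTypeR R)%type.
Variables (L eta : plane -> plane) (s lip : R) (y : int * int -> R * R).
Variables (u g : R * R -> C) (w : plane -> R) (e : int * int -> R * R -> C).
Hypotheses (s0 : 0 < s)
  (hchange : forall (h : plane -> C) (xi : plane), cintble l2 h ->
     cintble l2 (fun v => h (xi + L v)) /\
     cint l2 (fun v => h (xi + L v)) = (s ^+ 2)%:C * cint l2 h)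
  (L_lip : forall v, `|(L v).1| + `|(L v).2| <= lip * (`|v.1| + `|v.2|))
  (etaL : forall (xi v : plane), eta (xi + L v) = eta xi + v)
  (ydot : forall k (xi : R * R), dot xi (y k) = k.1%:~R * (eta xi).1 + k.2%:~R * (eta xi).2)
  (w_supp : forall xi, w xi != 0 -> `|(eta xi).1| < 2^-1 /\ `|(eta xi).2| < 2^-1)
  (su : schwartz u) (sg : schwartz g) (se : forall k, schwartz (e k))
  (FTu : forall xi, FT u xi = (s * w xi)%:C)
  (FTe : forall k xi, FT (e k) xi = FT u xi * expi (- (2 * pi * dot xi (y k)))).

Definition coef (g : R * R -> C) (e : R * R -> C) : C := cint l2 (fun x => g x * conjc (e x)).

Let F (xi : plane) : C := FT g xi * FT u xi.

Lemma product_decay : exists K, decay K F.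
Proof.
have [K dK] := FT_fpow_decay (0%N, 0%N) sg.
have [B _ [HB _]] := FT_schwartz_lip su.
exists (B * K); apply: (decayM (B := B)).
- move: dK; congr (decay K _); apply/funext => xi.
  by rewrite /fpow !expr0 mulr1 mul1r.
- exact: FT_schwartz_cmeas.
- exact: HB.
Qed.

Let phased k (xi z : plane) : C :=
  expi (- (2 * pi * dot xi (y k))) * (F z * expi (2 * pi * dot z (y k))).

Lemma phased_cintble k xi : cintble l2 (phased k xi).
Proof.
have [K dF] := product_decay; apply: cintbleZ.
exact: decay_cintble (decay_ichar _ dF).
Qed.

Lemma phased_cofreq k xi v : phased k xi (xi + L v) =
  F (xi + L v) * expi (2 * pi * (k.1%:~R * v.1 + k.2%:~R * v.2)).
Proof.
rewrite /phased mulrCA -expiD; congr (_ * expi _).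
by rewrite !ydot etaL /=; ring.
Qed.

(** By Parseval the coefficient is a Fourier integral of the product [F]. Recentring the variable at
    [xi] through [L] absorbs the phase, so that a trigonometric sum at [xi] becomes an integral
    against a kernel centred at 0. *)
Lemma coef_phase k xi : coef g (e k) * expi (- (2 * pi * dot xi (y k))) =
  (s ^- 2)%:C * cint l2 (fun v => F (xi + L v) * expi (2 * pi * (k.1%:~R * v.1 + k.2%:~R * v.2))).
Proof.
have [K dF] := product_decay.
have -> : coef g (e k) = cint l2 (fun z => F z * expi (2 * pi * dot z (y k))).
  rewrite /coef parseval//; congr cint; apply/funext => z.
  have uc : conjc (FT u z) = FT u z by rewrite FTu; exact: conjc_real.
  have -> : conjc (FT (e k) z) = conjc (FT u z) * conjc (expi (- (2 * pi * dot z (y k)))).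
    by rewrite FTe; exact: rmorphM.
  by rewrite uc expi_conj opprK mulrA.
rewrite mulrC -(cintZ _ (decay_cintble (decay_ichar (y k) dF))).
have [_ H] := hchange xi (phased_cintble k xi).
have <- : cint l2 (fun v => phased k xi (xi + L v)) =
    cint l2 (fun v => F (xi + L v) * expi (2 * pi * (k.1%:~R * v.1 + k.2%:~R * v.2))).
  by congr cint; apply/funext => v; exact: phased_cofreq.
have ss : (s ^- 2)%:C * (s ^+ 2)%:C = 1 :> C.
  by rewrite -rmorphM mulVf ?expf_neq0 ?gt_eqF.
by rewrite H mulrA ss mul1r.
Qed.

Lemma product_supp xi : F xi != 0 -> `|(eta xi).1| < 2^-1 /\ `|(eta xi).2| < 2^-1.
Proof.
rewrite /F mulf_eq0 negb_or => /andP[_]; rewrite FTu rmorphM mulf_eq0 negb_or => /andP[_ H].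
by apply: w_supp; apply: contra_neq H => ->.
Qed.

Lemma product_lip : exists2 B : R, 0 <= B & (forall xi, normc (F xi) <= B) /\
  forall xi v, normc (F (xi + L v) - F xi) <= B * (`|v.1| + `|v.2|).
Proof.
have [A A0 [HA LA]] := FT_schwartz_lip sg.
have [B B0 [HB LB]] := FT_schwartz_lip su.
have l0 : 0 <= `|lip| by [].
exists (A * B + 2 * A * B * `|lip|).
  by rewrite addr_ge0 ?mulr_ge0.
split=> xi.
  rewrite Normc.normcM (@le_trans _ _ (A * B))//; first by apply: ler_pM; rewrite ?normc_ge0.
  by rewrite lerDl !mulr_ge0.
move=> v; set n := `|v.1| + `|v.2|; have n0 : 0 <= n by rewrite addr_ge0.
have Ln : `|(L v).1| + `|(L v).2| <= `|lip| * n.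
  by apply: (le_trans (L_lip v)); rewrite ler_wpM2r// ler_norm.
have -> : F (xi + L v) - F xi = (FT g (xi + L v) - FT g xi) * FT u (xi + L v) +
    FT g xi * (FT u (xi + L v) - FT u xi) by rewrite /F; ring.
apply: (le_trans (le_normcD _ _)); rewrite !Normc.normcM.
apply: (@le_trans _ _ (`|lip| * n * A * B + A * (`|lip| * n * B))).
  apply: lerD; apply: ler_pM; rewrite ?normc_ge0//.
    by apply: (le_trans (LA _ _)); exact: ler_wpM2r.
  by apply: (le_trans (LB _ _)); exact: ler_wpM2r.
rewrite -subr_ge0.
have -> : (A * B + 2 * A * B * `|lip|) * n - (`|lip| * n * A * B + A * (`|lip| * n * B)) = A * B * n by ring.
by rewrite !mulr_ge0.
Qed.

Let P N (xi : plane) : C :=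
  box_mean N (fun s => \sum_(k <- s) coef g (e k) * expi (- (2 * pi * dot xi (y k)))).

Lemma trig_mean_fejer N xi : P N xi = (s ^- 2)%:C * cint l2 (fun v => F (xi + L v) * (fejer2 N v)%:C).
Proof.
have iF k : cintble l2 (fun v => F (xi + L v) * expi (2 * pi * (k.1%:~R * v.1 + k.2%:~R * v.2))).
  have [iv _] := hchange xi (phased_cintble k xi).
  by move: iv; congr (cintble _ _); apply/funext => v; exact: phased_cofreq.
rewrite /P box_meanE (eq_bigr _ (fun k _ => coef_phase k xi)) -mulr_sumr mulrCA; congr (_ * _).
rewrite -cint_sum// -cintZ; last exact: cintble_sum.
congr cint; apply/funext => v; rewrite -mulr_sumr mulrCA; congr (_ * _).
by rewrite -box_mean_expi box_meanE.
Qed.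

Lemma cofreq0 : L 0 = 0.
Proof.
have := L_lip 0; rewrite /= !normr0 addr0 mulr0 => H.
have h1 := normr_ge0 (L 0).1; have h2 := normr_ge0 (L 0).2.
rewrite [L 0]surjective_pairing; congr (_, _); apply/eqP; rewrite -normr_eq0 eq_le; apply/andP; split; lra.
Qed.

(** Where [FT u] does not vanish, [eta xi] lies in the open cell, so the recentred product has its
    support in a square of half-side below 1 and no other point of the dual lattice interferes. The
    bound, uniform in [xi], prepares dominated convergence. *)
Lemma trig_mean_limit : exists2 B : R, 0 <= B & forall xi, FT u xi != 0 -> 
  (forall N, normc (P N.+1 xi) <= B) /\ normc (P N.+1 xi - (s ^- 2)%:C * F xi) @[N --> \oo] --> (0 : R).
Proof.
have [B B0 [FB FL]] := product_lip; have [K dF] := product_decay.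
exists (normc (s ^- 2)%:C * (4 * B)) => [|xi u0].
  by rewrite mulr_ge0 ?normc_ge0// mulr_ge0.
have [e1 e2] : `|(eta xi).1| < 2^-1 /\ `|(eta xi).2| < 2^-1.
  by apply: w_supp; apply: contra_neq u0 => u0; rewrite FTu u0 mulr0.
pose a := 2^-1 + Num.max `|(eta xi).1| `|(eta xi).2|.
have m1 : `|(eta xi).1| <= Num.max `|(eta xi).1| `|(eta xi).2| by rewrite le_max lexx.
have m2 : `|(eta xi).2| <= Num.max `|(eta xi).1| `|(eta xi).2| by rewrite le_max lexx orbT.
have m3 : Num.max `|(eta xi).1| `|(eta xi).2| < 2^-1 by rewrite gt_max e1.
have a2 : 2^-1 <= a < 1.
  by have := normr_ge0 (eta xi).1; rewrite /a => h; apply/andP; split; lra.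
pose f (v : plane) := F (xi + L v).
have f0 : f 0 = F xi by rewrite /f cofreq0 addr0.
have mf : cmeas f by have [/cintble_cmeas] := hchange xi (decay_cintble dF).
have fB v : normc (f v) <= B by exact: FB.
have fL v : normc (f v - f 0) <= B * (`|v.1| + `|v.2|) by rewrite f0; exact: FL.
have fs v : f v != 0 -> `|v.1| <= a /\ `|v.2| <= a.
  move=> /product_supp; rewrite etaL => -[/= h1 h2].
  have tri (p q : R) : `|q| <= `|p + q| + `|p|.
    by have := ler_normB (p + q) p; rewrite addrAC subrr add0r.
  have t1 := tri (eta xi).1 v.1; have t2 := tri (eta xi).2 v.2.
  by rewrite /a; split; lra.
split=> [N|].
  rewrite trig_mean_fejer Normc.normcM ler_wpM2l ?normc_ge0//.
  exact: (normc_fejer2 mf a2 fB fs).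
have := fejer2_cvg mf a2 fB fL fs; rewrite f0 => H.
rewrite -[X in _ --> X](mulr0 (normc (s ^- 2)%:C)).
under eq_fun do rewrite trig_mean_fejer -mulrBr Normc.normcM.
apply: cvgM; first exact: cvg_cst.
by move: H; rewrite -(cvg_shiftS (fun N => normc (cint l2 (fun v => f v * (fejer2 N v)%:C) - F xi))).
Qed.

Lemma trig_mean_meas N : @cmeas _ _ plane (P N).
Proof.
rewrite (_ : P N = fun xi => (N%:R^-1 * N%:R^-1)%:C * \sum_(k <- boxes N)
  coef g (e k) * expi (- (2 * pi * dot xi (y k)))); last first.
  by apply/funext => xi; rewrite /P box_meanE.
apply: cmeasM; first exact: cmeas_cst.
apply: cmeas_sum => k; apply: cmeasM; first exact: cmeas_cst.
apply: cmeas_expi; apply: measurableT_comp => //.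
rewrite (_ : (fun xi => _) = fun xi => 2 * pi * dot (y k) xi); last by apply/funext => xi; rewrite dotC.
by apply: measurable_funM => //; exact: measurable_dot.
Qed.

(** Under the inverse transform the trigonometric means are multiplied by [FT u], so its zeros,
    where their limit is not known, do no harm. Since [FT u] is [s w], the limit
    [s ^- 2 FT g (FT u) ^ 2] equals [FT g w ^ 2]. *)
Lemma block_cvg b x : 
  normc (box_mean N.+1 (fun s => \sum_(k <- s) coef g (e k) * cderiv b (e k) x) -
    IFT (fun xi => fpow b xi * (FT g xi * (w xi ^+ 2)%:C)) x) @[N --> \oo] --> (0 : R).
Proof.
have [K du] := FT_fpow_decay b su; have [B B0 PB] := trig_mean_limit.
pose chi (xi : plane) : C := fpow b xi * FT u xi * expi (2 * pi * dot xi x).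
have dchi : decay K chi := decay_ichar x du.
have meanE N : box_mean N (fun s => \sum_(k <- s) coef g (e k) * cderiv b (e k) x) =
    cint l2 (fun xi => chi xi * P N xi).
  rewrite box_meanE.
  have ce k : cderiv b (e k) x = cint l2 (fun xi => chi xi * expi (- (2 * pi * dot xi (y k)))).
    rewrite schwartz_inversion// /IFT; congr cint; apply/funext => xi.
    by rewrite FTe /chi; ring.
  have ie k : cintble l2 (fun xi => chi xi * expi (- (2 * pi * dot xi (y k)))).
    by under eq_fun do rewrite dotC; exact: decay_cintble (decay_char (y k) dchi).
  rewrite (eq_bigr (fun k => cint l2 (fun xi => coef g (e k) *
      (chi xi * expi (- (2 * pi * dot xi (y k))))))); last by move=> k _; rewrite cintZ// ce.
  have ic k := cintbleZ (coef g (e k)) (ie k).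
  rewrite -cint_sum// -cintZ; last exact: cintble_sum.
  congr cint; apply/funext => xi; rewrite /P box_meanE mulrCA; congr (_ * _).
  by rewrite mulr_sumr; apply: eq_bigr => k _; rewrite mulrCA.
have FE xi : fpow b xi * (FT g xi * (w xi ^+ 2)%:C) * expi (2 * pi * dot xi x) =
    chi xi * ((s ^- 2)%:C * F xi).
  have -> : (w xi ^+ 2)%:C = (s ^- 2)%:C * FT u xi * FT u xi.
    have sq : (s ^- 2)%:C * (s * w xi)%:C * (s * w xi)%:C = (s ^- 2 * (s * w xi) * (s * w xi))%:C :> C.
      by rewrite !rmorphM.
    rewrite FTu sq; congr (_ %:C); field; rewrite gt_eqF//.
  by rewrite /chi /F; ring.
pose G (xi : plane) := fpow b xi * (FT g xi * (w xi ^+ 2)%:C) * expi (2 * pi * dot xi x).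
have mG : cmeas G.
  rewrite (_ : G = fun xi => chi xi * ((s ^- 2)%:C * F xi)); last by apply/funext => xi; exact: FE.
  have [K' dF] := product_decay; apply: cmeasM; first by case: dchi.
  by apply: cmeasM; [exact: cmeas_cst|case: dF].
have := @cint_dct _ _ _ l2 (fun N xi => chi xi * P N.+1 xi) G (fun xi => B * K * rho xi)
  _ mG (integrable_Krho (B * K)) _ _.
have -> : (fun N => normc (cint l2 (fun xi => chi xi * P N.+1 xi) - cint l2 G)) =
   (fun N => normc (box_mean N.+1 (fun s => \sum_(k <- s) coef g (e k) * cderiv b (e k) x) -
    IFT (fun xi => fpow b xi * (FT g xi * (w xi ^+ 2)%:C)) x)).
  by apply/funext => N; rewrite meanE.
apply.
- by move=> N; apply: cmeasM; [case: dchi|exact: trig_mean_meas].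
- move=> N xi; rewrite Normc.normcM; have [u0|/PB[PN _]] := eqVneq (FT u xi) 0.
    rewrite /chi u0 mulr0 mul0r Normc.normc0 mul0r mulr_ge0 ?(ltW (rho_gt0 _))// mulr_ge0//.
    exact: decay_ge0 dchi.
  have [_ /(_ xi) ck] := dchi.
  have -> : B * K * rho xi = K * rho xi * B by ring.
  by apply: ler_pM; rewrite ?normc_ge0.
- move=> xi; have -> : (fun N => normc (chi xi * P N.+1 xi - G xi)) =
      fun N => normc (chi xi) * normc (P N.+1 xi - (s ^- 2)%:C * F xi).
    by apply/funext => N; rewrite -Normc.normcM mulrBr /G FE.
  have [u0|/PB[_ PN]] := eqVneq (FT u xi) 0.
    rewrite /chi u0 mulr0 mul0r Normc.normc0; under eq_fun do rewrite mul0r; exact: cvg_cst.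
  rewrite -[X in _ --> X](mulr0 (normc (chi xi))).
  by apply: cvgM => //; exact: cvg_cst.
Qed.

End Block.

Ltac nneg := lazymatch goal with
  | |- is_true (0 <= _ * _) => apply: mulr_ge0; nneg
  | |- is_true (0 <= _ + _) => apply: addr_ge0; nneg
  | |- is_true (0 <= _ ^-1) => rewrite invr_ge0; nneg
  | |- is_true (0 <= _ ^+ 2) => exact: sqr_ge0
  | |- is_true (0 <= _ ^+ _) => apply: exprn_ge0; nneg
  | |- is_true (0 <= Normc.normc _) => exact: normc_ge0
  | |- _ => first [done | by apply: ltW | by rewrite ler0n | exact: pi_ge0]
  end.

(** * Decay of the coefficients *)

Section Bracket.
Context {R : realType}.
Implicit Types (x y z : R * R).

Definition bracket z : R := 1 + `|z.1| + `|z.2|.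

Lemma bracket_ge1 z : 1 <= bracket z.
Proof. by rewrite /bracket -addrA lerDl addr_ge0. Qed.

Lemma bracket_gt0 z : 0 < bracket z.
Proof. exact: lt_le_trans (bracket_ge1 z). Qed.

(** Submultiplicativity carries polynomial weights across a translation. *)
Lemma bracketD x y : bracket (x + y) <= bracket x * bracket y.
Proof.
rewrite /bracket /=; have h1 := ler_normD x.1 y.1; have h2 := ler_normD x.2 y.2.
have : 0 <= (`|x.1| + `|x.2|) * (`|y.1| + `|y.2|) by rewrite mulr_ge0// addr_ge0.
rewrite mulrDl !mulrDr; lra.
Qed.

Lemma bracketX m z : bracket z ^+ m <= 3 ^+ m * (1 + `|z.1| ^+ m + `|z.2| ^+ m).
Proof.
pose M := Num.max 1 (Num.max `|z.1| `|z.2|).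
have bM : bracket z <= 3 * M.
  have h1 : 1 <= M by rewrite le_max lexx.
  have h2 : `|z.1| <= M by rewrite !le_max lexx orbT.
  have h3 : `|z.2| <= M by rewrite !le_max lexx !orbT.
  rewrite /bracket; lra.
have M0 : 0 <= M by rewrite le_max ler01.
apply: (@le_trans _ _ ((3 * M) ^+ m)).
  by rewrite lerXn2r// nnegrE ?mulr_ge0// ltW// bracket_gt0.
rewrite exprMn ler_wpM2l ?exprn_ge0//.
have p1 : 0 <= `|z.1| ^+ m by rewrite exprn_ge0.
have p2 : 0 <= `|z.2| ^+ m by rewrite exprn_ge0.
rewrite /M; case: (leP 1 _) => _; last by rewrite expr1n; lra.
by case: (leP `|z.1| _) => _; lra.
Qed.

Lemma bracket_rho z : (bracket z ^+ 4)^-1 <= rho z.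
Proof.
rewrite /rho /rho1 -invfM lef_pV2 ?posrE ?exprn_gt0 ?bracket_gt0//; last first.
  by rewrite mulr_gt0// ltr_pwDl ?sqr_ge0.
have h (t : R) : `|t| <= bracket z - 1 -> 1 + t ^+ 2 <= bracket z ^+ 2.
  move=> ht; have t2 : t ^+ 2 <= (bracket z - 1) ^+ 2.
    by rewrite -[t ^+ 2]real_normK ?num_real// lerXn2r// nnegrE subr_ge0 bracket_ge1.
  by move: t2; have := bracket_ge1 z; rewrite sqrrB expr1n; lra.
have -> : bracket z ^+ 4 = bracket z ^+ 2 * bracket z ^+ 2 by ring.
have n1 := normr_ge0 z.1; have n2 := normr_ge0 z.2.
apply: ler_pM; rewrite ?addr_ge0 ?sqr_ge0//; apply: h; rewrite /bracket; lra.
Qed.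

End Bracket.

Section ElementBound.
Context {R : realType}.
Local Notation C := (R[i]).
Local Notation normc := (@Normc.normc R).
Local Notation l2 := (@leb2 R).
Local Notation plane := (measurableTypeR R * measurableTypeR R)%type.
Variables (Ks : nat * nat -> nat * nat -> R) (Ms : nat * nat -> nat * nat -> nat).

(** [e] is the translate by [y] of the element [u] at the origin, [X] is the scale and [q] the
    integer index of [y]. The alternative [X = 1] in the frequency condition admits the coarse
    window, which contains the origin; the last two fields compare index and position. *)
Record element_at (X : R) (u e : R * R -> C) (y q : R * R) : Prop := {
  element_ge1 : 1 <= X;
  element_base : schwartz u;
  element_schwartz : schwartz e;
  element_FT : forall xi, FT e xi = FT u xi * expi (- (2 * pi * dot xi y));
  element_le1 : forall xi, normc (FT u xi) <= 1;
  element_freq : forall xi, FT u xi != 0 ->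
    [\/ X ^+ 2 <= 16 * `|xi.1|, X ^+ 2 <= 16 * `|xi.2| | X = 1];
  element_seminorm : forall a b x,
    `|x.1 ^+ a.1 * x.2 ^+ a.2| * normc (cderiv b u x) <= Ks a b * X ^+ Ms a b;
  element_lattice : bracket q <= 4 * X ^+ 2 * bracket y;
  element_point : bracket y <= 2 * bracket q }.

(** The transform of [e] is that of a translate of [u], so the inversion formulas for all
    derivatives agree. *)
Lemma element_translate X u e y q b x : element_at X u e y q ->
  cderiv b e x = cderiv b u (x - y).
Proof.
case=> _ su se Fe _ _ _ _ _; rewrite !schwartz_inversion// /IFT.
congr cint; apply/funext => xi; rewrite Fe dotDr dotNr.
have -> : 2 * pi * (dot xi x - dot xi y) = - (2 * pi * dot xi y) + 2 * pi * dot xi x by ring.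
by rewrite expiD; ring.
Qed.

Lemma element_bracket m b : exists (K : R) (M : nat), 0 <= K /\
  forall X u e y q, element_at X u e y q -> forall x,
    bracket x ^+ m * normc (cderiv b u x) <= K * X ^+ M.
Proof.
pose K0 := `|Ks (0%N, 0%N) b| + `|Ks (m, 0%N) b| + `|Ks (0%N, m) b|.
exists (3 ^+ m * K0), (Ms (0%N, 0%N) b + Ms (m, 0%N) b + Ms (0%N, m) b)%N.
split; first by rewrite mulr_ge0 ?exprn_ge0// !addr_ge0.
move=> X u e y q [X1 _ _ _ _ _ H _ _] x; set n := normc _.
have n0 : 0 <= n by exact: normc_ge0.
apply: (le_trans (ler_wpM2r n0 (bracketX m x))).
rewrite -!mulrA; apply: ler_wpM2l; first exact: exprn_ge0.
have X0 : 0 <= X by lra.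
have h (a : nat * nat) M' : (Ms a b <= M')%N ->
    `|x.1 ^+ a.1 * x.2 ^+ a.2| * n <= `|Ks a b| * X ^+ M'.
  move=> am; apply: (le_trans (H a b x)).
  apply: (@le_trans _ _ (`|Ks a b| * X ^+ Ms a b)).
    by apply: ler_wpM2r; [exact: exprn_ge0|exact: ler_norm].
  by apply: ler_wpM2l => //; apply: ler_weXn2l.
set M := (_ + _ + _)%N.
have h0 := h (0%N, 0%N) M; have h1 := h (m, 0%N) M; have h2 := h (0%N, m) M.
move: h0 h1 h2; rewrite /= !expr0 !mulr1 !mul1r normr1 mul1r !normrX.
move=> /(_ _)h0 /(_ _)h1 /(_ _)h2.
rewrite !mulrDl mul1r; apply: lerD; [apply: lerD|].
- by apply: h0; rewrite /M; lia.
- by apply: h1; rewrite /M; lia.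
- by apply: h2; rewrite /M; lia.
Qed.

Lemma schwartz_cmeas (g : R * R -> C) : schwartz g -> @cmeas _ _ plane g.
Proof. by move=> sg; have [K _ []] := cderiv_decay (0%N, 0%N) sg; rewrite cderiv00. Qed.

(** Where the transform of [e] does not vanish, some coordinate of the frequency is at least
    [X ^ 2 / 16], so [N] powers of it gain [X ^ (2 N)]. The summand [D] of the constant takes care
    of [X = 1]. *)
Lemma coef_freq g N : schwartz g -> exists2 K : R, 0 <= K &
  forall X u e y q, element_at X u e y q -> normc (coef g e) * X ^+ (2 * N) <= K.
Proof.
move=> sg.
have [A A0 HA] := FT_schwartz_decay N 0 sg; have [B B0 HB] := FT_schwartz_decay 0 N sg.
have [D D0 HD] := FT_schwartz_decay 0 0 sg.
pose K := 16 ^+ N * A + 16 ^+ N * B + D.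
have K0 : 0 <= K by rewrite !addr_ge0 ?mulr_ge0 ?exprn_ge0.
exists (K * pi ^+ 2) => [|X u e y q [X1 su se Fe u1 uX _ _ _]]; first by rewrite mulr_ge0 ?sqr_ge0.
rewrite /coef parseval//.
have X0 : 0 < X by lra.
have XN0 : 0 <= X ^+ (2 * N) by rewrite exprn_ge0// ltW.
have d : decay (K * X ^- (2 * N)) (fun xi => FT g xi * conjc (FT e xi)).
  split.
    by apply: cmeasM; [exact: FT_schwartz_cmeas|apply: cmeas_conj; exact: FT_schwartz_cmeas].
  move=> xi; rewrite Normc.normcM normc_conj Fe Normc.normcM normc_expi mulr1.
  have r0 := rho_gt0 xi.
  rewrite mulrAC ler_pdivlMr ?exprn_gt0//.
  have [->|u0] := eqVneq (FT u xi) 0.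
    by rewrite Normc.normc0 mulr0 mul0r mulr_ge0// ltW.
  have ng := normc_ge0 (FT g xi).
  apply: (@le_trans _ _ (normc (FT g xi) * X ^+ (2 * N))).
    by apply: ler_wpM2r => //; rewrite ler_piMr.
  have a0 : 0 <= 16 ^+ N * A * rho xi by nneg.
  have b0 : 0 <= 16 ^+ N * B * rho xi by nneg.
  have c0 : 0 <= D * rho xi by rewrite mulr_ge0// ltW.
  rewrite /K !mulrDl.
  have far (t E : R) : X ^+ 2 <= 16 * `|t| -> `|t| ^+ N * normc (FT g xi) <= E * rho xi ->
      normc (FT g xi) * X ^+ (2 * N) <= 16 ^+ N * E * rho xi.
    move=> Xt HE; rewrite exprM -mulrA; apply: le_trans (ler_wpM2l (exprn_ge0 N _) HE) => //.
    rewrite mulrA -exprMn mulrC; apply: ler_wpM2r => //.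
    by rewrite lerXn2r// nnegrE; nneg.
  have [h|h|h] := uX xi u0.
  - by have := HA xi; rewrite expr0 mulr1 => /(far xi.1 A h); lra.
  - by have := HB xi; rewrite expr0 mul1r => /(far xi.2 B h); lra.
  - by have := HD xi; rewrite h expr1n !expr0 !mul1r mulr1; lra.
have := normc_cint_decay d.
rewrite mulrAC ler_pdivlMr ?exprn_gt0//.
Qed.

(** [bracket y] is at most [bracket x * bracket (x - y)]: one factor is absorbed by the decay of
    [g], the other by that of [u], with a loss polynomial in [X]. *)
Lemma coef_space g m : schwartz g -> exists (K : R) (M : nat), 0 <= K /\
  forall X u e y q, element_at X u e y q -> normc (coef g e) * bracket y ^+ m <= K * X ^+ M.
Proof.
move=> sg.
have [K [M [K0 HK]]] := element_bracket m (0%N, 0%N).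
have [A A0 HA] := schwartz_decay (0%N, 0%N) m 0 sg.
have [B B0 HB] := schwartz_decay (0%N, 0%N) 0 m sg.
have [D D0 HD] := schwartz_decay (0%N, 0%N) 0 0 sg.
rewrite cderiv00 in HA HB HD.
pose G := 3 ^+ m * (D + A + B).
have G0 : 0 <= G by rewrite mulr_ge0 ?exprn_ge0// !addr_ge0.
have gG x : bracket x ^+ m * normc (g x) <= G * rho x.
  apply: (le_trans (ler_wpM2r (normc_ge0 _) (bracketX m x))).
  rewrite -!mulrA; apply: ler_wpM2l; first exact: exprn_ge0.
  have [_ /(_ x)] := HA; have [_ /(_ x)] := HB; have [_ /(_ x)] := HD.
  rewrite !Normc.normcM !normc_real !normrM !normrX !expr0 !mulr1 !mul1r.
  by rewrite !mulrDl mul1r; lra.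
exists (G * K * pi ^+ 2), M; split; first by nneg.
move=> X u e y q el; have [X1 su se _ _ _ _ _ _] := el.
have X0 : 0 < X by lra.
have y0 : 0 < bracket y ^+ m by rewrite exprn_gt0// bracket_gt0.
have XM : 0 <= K * X ^+ M by rewrite mulr_ge0// exprn_ge0// ltW.
have d : decay (G * (K * X ^+ M) / bracket y ^+ m) (fun x => g x * conjc (e x)).
  split.
    by apply: cmeasM; [exact: schwartz_cmeas|apply: cmeas_conj; exact: schwartz_cmeas].
  move=> x; rewrite Normc.normcM normc_conj mulrAC ler_pdivlMr//.
  have -> : e x = u (x - y) by have := element_translate (0%N, 0%N) x el; rewrite !cderiv00.
  have bb : bracket y ^+ m <= bracket x ^+ m * bracket (x - y) ^+ m.
    rewrite -exprMn lerXn2r ?nnegrE ?mulr_ge0 ?(ltW (bracket_gt0 _))//.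
    have := bracketD x (y - x); rewrite addrCA subrr addr0.
    by have -> : bracket (y - x) = bracket (x - y) by rewrite /bracket /= (distrC y.1) (distrC y.2).
  have := HK X u e y q el (x - y); rewrite cderiv00 => hu.
  apply: (@le_trans _ _ ((bracket x ^+ m * normc (g x)) * (bracket (x - y) ^+ m * normc (u (x - y))))).
    rewrite mulrACA mulrC; apply: ler_wpM2r => //; by rewrite mulr_ge0 ?normc_ge0.
  have -> : G * (K * X ^+ M) * rho x = (G * rho x) * (K * X ^+ M) by ring.
  by apply: ler_pM; rewrite ?mulr_ge0 ?normc_ge0 ?exprn_ge0 ?(ltW (bracket_gt0 _)).
have := normc_cint_decay d.
have -> : G * (K * X ^+ M) / bracket y ^+ m * pi ^+ 2 = (G * K * pi ^+ 2 * X ^+ M) / bracket y ^+ m by ring.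
by rewrite ler_pdivlMr.
Qed.

Lemma element_weight a b : exists (K : R) (M : nat), 0 <= K /\
  forall X u e y q, element_at X u e y q -> forall x,
    `|x.1 ^+ a.1 * x.2 ^+ a.2| * normc (cderiv b e x) <= K * X ^+ M * bracket y ^+ (a.1 + a.2).
Proof.
have [K [M [K0 HK]]] := element_bracket (a.1 + a.2) b; exists K, M; split=> // X u e y q el x.
rewrite (element_translate b x el).
have xb (t : R) n : `|t| <= bracket x -> `|t ^+ n| <= bracket x ^+ n.
  by move=> h; rewrite normrX lerXn2r// nnegrE ltW// bracket_gt0.
have xa : `|x.1 ^+ a.1 * x.2 ^+ a.2| <= bracket x ^+ (a.1 + a.2).
  rewrite normrM exprD; apply: ler_pM => //; apply: xb; rewrite /bracket.
    by have := normr_ge0 x.2; lra.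
  by have := normr_ge0 x.1; lra.
have bb : bracket x ^+ (a.1 + a.2) <= bracket (x - y) ^+ (a.1 + a.2) * bracket y ^+ (a.1 + a.2).
  rewrite -exprMn lerXn2r ?nnegrE ?mulr_ge0 ?(ltW (bracket_gt0 _))//.
  by have := bracketD (x - y) y; rewrite subrK.
apply: (le_trans (ler_wpM2r (normc_ge0 _) (le_trans xa bb))).
rewrite mulrAC; apply: ler_wpM2r; first by rewrite exprn_ge0// ltW// bracket_gt0.
exact: HK el _.
Qed.

(* The square of the coefficient is the product of its bound on the frequency
   side, a negative power of [X], and of its bound on the space side, a negative
   power of [bracket y]; both beat the growth of the seminorms of [e]. *)
Lemma coef_seminorm g a b : schwartz g -> exists2 K : R, 0 <= K &
  forall X u e y q, element_at X u e y q -> forall x,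
    normc (coef g e) * (`|x.1 ^+ a.1 * x.2 ^+ a.2| * normc (cderiv b e x)) <= K * X ^- 4 * rho q.
Proof.
move=> sg; pose A := (a.1 + a.2)%N.
have [K [M [K0 HK]]] := element_weight a b.
(* In space, [2 A] compensates the squared growth [bracket y ^ A] of the seminorm and 8 pays for the
   weight in [q]. In frequency, [2 M + T] undoes the powers of [X] lost on the way, and 24 is 16,
   from comparing [q] with [y], plus 8, from the square of the claimed [X ^- 4]. *)
have [S [T [S0 HS]]] := coef_space (2 * A + 8) sg.
have [F F0 HF] := coef_freq (M + M + T + 24) sg.
pose D := F * S * (K ^+ 2) * 4 ^+ 8.
have D0 : 0 <= D by rewrite /D; nneg.
exists (Num.sqrt D) => [|X u e y q el x]; first exact: sqrtr_ge0.
have [X1 _ _ _ _ _ _ qy _] := el; have X0 : 0 < X by lra.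
set c := normc _; set p := _ * normc _.
have c0 : 0 <= c by exact: normc_ge0.
have p0 : 0 <= p by rewrite mulr_ge0 ?normc_ge0.
have y0 : 0 < bracket y by exact: bracket_gt0.
have q0 : 0 < bracket q by exact: bracket_gt0.
have X40 : 0 < X ^+ 4 by exact: exprn_gt0.
apply: (@le_trans _ _ (Num.sqrt D * X ^- 4 * (bracket q ^+ 4)^-1)); last first.
  by apply: ler_wpM2l (bracket_rho q); rewrite mulr_ge0 ?sqrtr_ge0// invr_ge0 ltW.
rewrite ler_pdivlMr ?exprn_gt0// ler_pdivlMr//.
have l0 : 0 <= c * p * bracket q ^+ 4 * X ^+ 4 by nneg.
rewrite -[leLHS]ger0_norm// -sqrtr_sqr ler_wsqrtr//.
have h1 : c * X ^+ (2 * (M + M + T + 24)) <= F := HF X u e y q el.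
have h2 : c * bracket y ^+ (2 * A + 8) <= S * X ^+ T := HS X u e y q el.
have h3 : p <= K * X ^+ M * bracket y ^+ A := HK X u e y q el x.
have h4 : bracket q ^+ 8 <= (4 * X ^+ 2 * bracket y) ^+ 8.
  by rewrite lerXn2r ?nnegrE//; nneg.
have -> : (c * p * bracket q ^+ 4 * X ^+ 4) ^+ 2 = c * c * (p ^+ 2 * bracket q ^+ 8) * X ^+ 8 by ring.
have h5 : p ^+ 2 <= (K * X ^+ M * bracket y ^+ A) ^+ 2.
  by rewrite lerXn2r ?nnegrE//; nneg.
apply: (@le_trans _ _ (c * c * ((K * X ^+ M * bracket y ^+ A) ^+ 2 * (4 * X ^+ 2 * bracket y) ^+ 8) * X ^+ 8)).
  apply: ler_wpM2r; first by rewrite exprn_ge0// ltW.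
  apply: ler_wpM2l; first exact: mulr_ge0.
  by apply: ler_pM => //; nneg.
have e1 : c * c * ((K * X ^+ M * bracket y ^+ A) ^+ 2 * (4 * X ^+ 2 * bracket y) ^+ 8) * X ^+ 8 =
    K ^+ 2 * 4 ^+ 8 * X ^+ (M + M + 24) * (c * (c * bracket y ^+ (2 * A + 8))).
  have -> : X ^+ (M + M + 24) = X ^+ M * X ^+ M * X ^+ 24 by rewrite 2!exprD.
  have -> : bracket y ^+ (2 * A + 8) = (bracket y ^+ A) ^+ 2 * bracket y ^+ 8.
    by rewrite exprD mulnC exprM.
  ring.
rewrite e1.
apply: (@le_trans _ _ (K ^+ 2 * 4 ^+ 8 * X ^+ (M + M + 24) * (c * (S * X ^+ T)))).
  apply: ler_wpM2l; first by nneg.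
  exact: ler_wpM2l.
have e2 : K ^+ 2 * 4 ^+ 8 * X ^+ (M + M + 24) * (c * (S * X ^+ T)) =
  (K ^+ 2 * 4 ^+ 8 * S) * (c * X ^+ (M + M + T + 24)) by rewrite !exprD; ring.
rewrite e2 /D.
have -> : F * S * K ^+ 2 * 4 ^+ 8 = (K ^+ 2 * 4 ^+ 8 * S) * F by ring.
apply: ler_wpM2l; first by nneg.
have MN : (M + M + T + 24 <= 2 * (M + M + T + 24))%N by rewrite leq_pmull.
apply: le_trans h1; exact: (ler_wpM2l c0 (ler_weXn2l X1 MN)).
Qed.

End ElementBound.

(** * Coordinates adapted to the sampling lattices *)

Section Lattice.
Context {R : realType}.
Local Notation C := (R[i]).
Local Notation l2 := (@leb2 R).
Local Notation plane := (measurableTypeR R * measurableTypeR R)%type.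
Variables (sw : bool) (k0 k1 lam : R).
Hypotheses (k00 : 0 < k0) (k10 : 0 < k1).

(** The lattices of the vertical system are those of the horizontal one with the coordinates
    exchanged. *)
Definition swapped (f : R * R -> R * R) (x : R * R) : R * R :=
  if sw then ((f (x.2, x.1)).2, (f (x.2, x.1)).1) else f x.

(* Coordinates in which the sampling lattice becomes the integer lattice:
   [dot xi (lat_point q) = dot (lat_freq xi) q], and [lat_cofreq] inverts
   [lat_freq]. *)
Definition lat_freq : R * R -> R * R :=
  swapped (fun xi => (k0 * xi.1, k1 * xi.2 - lam * k0 * xi.1)).
Definition lat_point : R * R -> R * R :=
  swapped (fun q => (k0 * (q.1 - lam * q.2), k1 * q.2)).
Definition lat_cofreq : R * R -> R * R :=
  swapped (fun v => (k0^-1 * v.1, k1^-1 * lam * v.1 + k1^-1 * v.2)).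

Lemma lat_freqD xi v : lat_freq (xi + lat_cofreq v) = lat_freq xi + v.
Proof.
have k0n : k0 != 0 by rewrite gt_eqF.
have k1n : k1 != 0 by rewrite gt_eqF.
rewrite [RHS]surjective_pairing /lat_freq /lat_cofreq /swapped.
by case: sw => /=; congr (_, _); field; rewrite ?k0n ?k1n.
Qed.

Lemma dot_lat_point q xi : dot xi (lat_point q) =
  q.1 * (lat_freq xi).1 + q.2 * (lat_freq xi).2.
Proof. by rewrite /dot /lat_point /lat_freq /swapped; case: sw => /=; ring. Qed.

Lemma lat_cofreq_lip v : `|(lat_cofreq v).1| + `|(lat_cofreq v).2| <=
  (k0^-1 + k1^-1 * `|lam| + k1^-1) * (`|v.1| + `|v.2|).
Proof.
have i0 : 0 <= k0^-1 by rewrite invr_ge0 ltW.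
have i1 : 0 <= k1^-1 by rewrite invr_ge0 ltW.
have h (a b : R) : `|k0^-1 * a| + `|k1^-1 * lam * a + k1^-1 * b| <=
    (k0^-1 + k1^-1 * `|lam| + k1^-1) * (`|a| + `|b|).
  have := ler_normD (k1^-1 * lam * a) (k1^-1 * b).
  rewrite !normrM (ger0_norm i0) (ger0_norm i1) => t.
  have p1 : 0 <= k0^-1 * `|b| by nneg.
  have p2 : 0 <= k1^-1 * `|lam| * `|b| by nneg.
  have p3 : 0 <= k1^-1 * `|a| by nneg.
  rewrite !mulrDl !mulrDr; lra.
rewrite /lat_cofreq /swapped; case: sw => /=; last exact: h.
by rewrite addrC (addrC (Num.norm v.1)).
Qed.

Lemma measurable_swap_plane (f : plane -> plane) : measurable_fun setT f ->
  measurable_fun setT (fun x : plane => ((f (x.2, x.1)).2, (f (x.2, x.1)).1) : plane).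
Proof.
move=> mf; have ms : measurable_fun setT (fun x : plane => (x.2, x.1) : plane) by exact: measurable_swap.
exact: (measurableT_comp ms (measurableT_comp mf ms)).
Qed.

(** The map is an instance of [shear], conjugated by the exchange of coordinates if [sw] holds. *)
Lemma lat_change_ge0 xi (f : plane -> \bar R) : measurable_fun setT f ->
  (forall x, 0 <= f x)%E ->
  (\int[l2]_v f (xi + lat_cofreq v)%R = (k0 * k1)%:E * \int[l2]_v f v)%E.
Proof.
move=> mf f0; pose phi z := shear k0^-1 k1^-1 (k1^-1 * lam) z.
have ms : measurable_fun setT (fun x : plane => (x.2, x.1) : plane) by exact: measurable_swap.
have E (h : plane -> \bar R) z : measurable_fun setT h -> (forall x, 0 <= h x)%E ->
    (\int[l2]_v h (phi z v) = (k0 * k1)%:E * \int[l2]_v h v)%E.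
  move=> mh h0; rewrite plane_shear_ge0 ?invr_gt0//.
  by rewrite invfM !invrK.
rewrite /lat_cofreq /swapped; case: sw.
  pose h (x : plane) := f (x.2, x.1).
  have mh : measurable_fun setT h by exact: (measurableT_comp mf ms).
  transitivity (\int[l2]_v (h (phi (xi.2, xi.1) (v.2, v.1))))%E.
    apply: eq_integral => v _; rewrite /h /phi /shear /=; congr (f (_, _)).
    by rewrite addrA.
  rewrite (plane_swap_ge0 (f := fun v => h (phi (xi.2, xi.1) v))).
  - rewrite E// /h; first by rewrite plane_swap_ge0.
    by move=> x; exact: f0.
  - by apply: (measurableT_comp mh); exact: measurable_shear.
  - by move=> x; exact: f0.
rewrite -(E f xi)//; apply: eq_integral => v _; rewrite /phi /shear /=; congr (f (_, _)).
by rewrite addrA.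
Qed.

Lemma measurable_lat xi : measurable_fun setT ((fun v => xi + lat_cofreq v) : plane -> plane).
Proof.
have H z := @measurable_shear R k0^-1 k1^-1 (k1^-1 * lam) z.
rewrite /lat_cofreq /swapped; case: sw.
  have := measurable_swap_plane (H (xi.2, xi.1)); congr measurable_fun; apply/funext => v.
  by rewrite /shear /= [RHS]surjective_pairing /=; congr (_, _); rewrite addrA.
have := H xi; congr measurable_fun; apply/funext => v.
by rewrite /shear /= [RHS]surjective_pairing /=; congr (_, _); rewrite addrA.
Qed.

Lemma lat_change (h : plane -> C) (xi : plane) : cintble l2 h ->
  cintble l2 (fun v => h (xi + lat_cofreq v)) /\
  cint l2 (fun v => h (xi + lat_cofreq v)) = (k0 * k1)%:C * cint l2 h.
Proof.
move=> ih; have kk : 0 <= k0 * k1 by rewrite mulr_ge0// ltW.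
split.
  exact: (@cintble_change R (fun v => xi + lat_cofreq v) (k0 * k1) (measurable_lat xi) kk (lat_change_ge0 xi) h ih).
exact: (@cint_change R (fun v => xi + lat_cofreq v) (k0 * k1) (lat_change_ge0 xi) h ih).
Qed.

Lemma bracket_swapped f x : bracket (swapped f x) =
  bracket (f (if sw then (x.2, x.1) else x)).
Proof. by rewrite /swapped /bracket; case: sw => //=; ring. Qed.

Lemma bracket_lat_point q : k0 <= 1 -> k1 <= 1 -> `|lam| * k0 <= 1 ->
  bracket (lat_point q) <= 2 * bracket q.
Proof.
move=> a1 a2 a3; rewrite /lat_point bracket_swapped.
have -> : bracket q = bracket (if sw then (q.2, q.1) else q).
  by rewrite /bracket; case: sw => //=; ring.
move: (if sw then _ else _) => {}q; rewrite /bracket /=.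
have := ler_normB q.1 (lam * q.2).
move/(ler_wpM2l (ltW k00)); rewrite -{1}(ger0_norm (ltW k00)) -normrM => t.
have n1 := normr_ge0 q.1; have n2 := normr_ge0 q.2.
have t1 : k0 * `|q.1| <= `|q.1| by rewrite ler_piMl.
have t2 : `|lam| * k0 * `|q.2| <= `|q.2| by rewrite ler_piMl.
have t3 : k1 * `|q.2| <= `|q.2| by rewrite ler_piMl.
have -> : `|k1 * q.2| = k1 * `|q.2| by rewrite normrM (ger0_norm (ltW k10)).
move: t; rewrite (normrM lam).
have -> : k0 * (`|q.1| + `|lam| * `|q.2|) = k0 * `|q.1| + `|lam| * k0 * `|q.2| by ring.
lra.
Qed.

Lemma bracket_lat_index X q : 1 <= X -> `|lam| <= X -> k0^-1 <= 2 * X ^+ 2 -> k1^-1 <= 2 * X ->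
  bracket q <= 4 * X ^+ 2 * bracket (lat_point q).
Proof.
move=> X1 lX i0 i1; rewrite /lat_point bracket_swapped.
have -> : bracket q = bracket (if sw then (q.2, q.1) else q).
  by rewrite /bracket; case: sw => //=; ring.
move: (if sw then _ else _) => {}q; rewrite /bracket /=.
set y1 := k0 * _; set y2 := k1 * q.2.
have k0n : k0 != 0 by rewrite gt_eqF.
have k1n : k1 != 0 by rewrite gt_eqF.
have q2 : q.2 = k1^-1 * y2 by rewrite /y2 mulKf.
have q1 : q.1 = k0^-1 * y1 + lam * q.2 by rewrite /y1 mulKf// subrK.
have n1 := normr_ge0 y1; have n2 := normr_ge0 y2.
have XX : X <= X ^+ 2 by rewrite expr2 ler_peMl//; lra.
have X0 : 0 <= X by lra.
have b2 : `|q.2| <= 2 * X * `|y2|.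
  rewrite q2 normrM ger0_norm ?invr_ge0 ?(ltW k10)//; exact: ler_wpM2r.
have b1 : `|q.1| <= 2 * X ^+ 2 * `|y1| + X * (2 * X * `|y2|).
  rewrite q1; apply: (le_trans (ler_normD _ _)); rewrite (normrM k0^-1) (normrM lam); apply: lerD.
    by rewrite ger0_norm ?invr_ge0 ?(ltW k00)//; exact: ler_wpM2r.
  by apply: ler_pM.
have e1 : X * `|y2| <= X ^+ 2 * `|y2| by exact: ler_wpM2r.
have e2 : X * (2 * X * `|y2|) = 2 * (X ^+ 2 * `|y2|) by ring.
have e3 : 0 <= X ^+ 2 * `|y1| by nneg.
have e4 : 0 <= X ^+ 2 * `|y2| by nneg.
have X2 : 1 <= X ^+ 2 by lra.
rewrite !mulrDr; lra.
Qed.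

End Lattice.

(** * Blocks: all translates at one scale and direction *)

Section BlockFamilies.
Context {R : realType}.
Local Notation C := (R[i]).
Local Notation normc := (@Normc.normc R).
Local Notation plane := (measurableTypeR R * measurableTypeR R)%type.
Variables (Ks : nat * nat -> nat * nat -> R) (Ms : nat * nat -> nat * nat -> nat).

(* The elements of one scale and direction: [w] is their window, [u] the element
   at the origin and [X] is [2 ^ j]. *)
Inductive block (X : R) (w : R * R -> R) (e : int * int -> R * R -> C) : Prop :=
  Block (sw : bool) (k0 k1 lam s : R) (u : R * R -> C) of
    1 <= X & 0 < k0 <= 1 & 0 < k1 <= 1 & `|lam| * k0 <= 1 & `|lam| <= X &
    k0^-1 <= 2 * X ^+ 2 & k1^-1 <= 2 * X & 0 < s <= 1 & s ^+ 2 = k0 * k1 &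
    (forall xi, `|w xi| <= 1) &
    (forall xi, w xi != 0 ->
      [\/ X ^+ 2 <= 16 * `|xi.1|, X ^+ 2 <= 16 * `|xi.2| | X = 1]) &
    (forall xi, w xi != 0 -> `|(lat_freq sw k0 k1 lam xi).1| < 2^-1 /\
      `|(lat_freq sw k0 k1 lam xi).2| < 2^-1) &
    schwartz u & (forall k, schwartz (e k)) &
    (forall xi, FT u xi = (s * w xi)%:C) &
    (forall k xi, FT (e k) xi =
      FT u xi * expi (- (2 * pi * dot xi (lat_point sw k0 k1 lam (zvec k))))) &
    (forall a b x, `|x.1 ^+ a.1 * x.2 ^+ a.2| * normc (cderiv b u x) <= Ks a b * X ^+ Ms a b).

Lemma block_coef_seminorm g a b : schwartz g -> exists2 K : R, 0 <= K &
  forall X w e, block X w e -> forall k x,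
    normc (coef g (e k)) * (`|x.1 ^+ a.1 * x.2 ^+ a.2| * normc (cderiv b (e k) x)) <=
    K * X ^- 4 * rho (zvec k).
Proof.
move=> sg; have [K K0 HK] := coef_seminorm Ks Ms a b sg; exists K => // X w e bl k x.
case: bl => sw k0 k1 lam s u X1 /andP[k00 k01] /andP[k10 k11] lk lX i0 i1 /andP[s0 s1] ss w1 wX wc su se Fu Fe ub.
apply: (HK X u (e k) (lat_point sw k0 k1 lam (zvec k)) (zvec k)); split => //.
- by move=> xi; rewrite Fu normc_real normrM ger0_norm ?(ltW s0)// mulr_ile1// ltW.
- by move=> xi u0; apply: wX; apply: contra_neq u0 => w0; rewrite Fu w0 mulr0.
- exact: bracket_lat_index.
- exact: bracket_lat_point.
Qed.

Lemma block_mean g b x X w e : schwartz g -> block X w e ->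
  normc (box_mean N.+1 (fun s => \sum_(k <- s) coef g (e k) * cderiv b (e k) x) -
    IFT (fun xi => fpow b xi * (FT g xi * (w xi ^+ 2)%:C)) x) @[N --> \oo] --> (0 : R).
Proof.
move=> sg [sw k0 k1 lam s u X1 /andP[k00 k01] /andP[k10 k11] lk lX i0 i1 /andP[s0 s1] ss w1 wX wc su se Fu Fe ub].
apply: (@block_cvg R (lat_cofreq sw k0 k1 lam) (lat_freq sw k0 k1 lam) s
  (k0^-1 + k1^-1 * `|lam| + k1^-1) (fun k => lat_point sw k0 k1 lam (zvec k)) u g w e) => //.
- by move=> h xi; rewrite ss; exact: lat_change.
- by move=> v; exact: lat_cofreq_lip.
- by move=> xi v; exact: lat_freqD.
- by move=> k xi; rewrite dot_lat_point.
Qed.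

Lemma block_schwartz X w e : block X w e -> forall k, schwartz (e k).
Proof. by case. Qed.

Lemma block_le1 X w e : block X w e -> forall xi, `|w xi| <= 1.
Proof. by case. Qed.

End BlockFamilies.

Section Translate.
Context {R : realType}.
Local Notation C := (R[i]).
Local Notation normc := (@Normc.normc R).

Lemma schwartz_shift (g : R * R -> C) y : schwartz g -> schwartz (fun x => g (x - y)).
Proof.
move=> sg; have [g1 g2 _] := sg; split.
- exact: (smooth2_shift y g1).
- exact: (smooth2_shift y g2).
move=> a b.
have bd (n : nat * nat) := schwartz_bound n b sg.
pose m := (a.1 + a.2)%N.
have [A HA] := bd (0%N, 0%N); have [B HB] := bd (m, 0%N); have [D HD] := bd (0%N, m).
pose K := 3 ^+ m * (A + B + D) * bracket y ^+ m.
apply: (@le_lt_trans _ _ K%:E); last exact: ltry.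
apply: seminorm_le => x; rewrite cderiv_shift.
set z := x - y; set n := normc _; have n0 : 0 <= n by exact: normc_ge0.
have xa : `|x.1 ^+ a.1 * x.2 ^+ a.2| <= bracket x ^+ m.
  have xb (t : R) r : `|t| <= bracket x -> `|t ^+ r| <= bracket x ^+ r.
    by move=> h; rewrite normrX lerXn2r// nnegrE ltW// bracket_gt0.
  rewrite normrM exprD; apply: ler_pM => //; apply: xb; rewrite /bracket.
    by have := normr_ge0 x.2; lra.
  by have := normr_ge0 x.1; lra.
have bb : bracket x ^+ m <= bracket z ^+ m * bracket y ^+ m.
  rewrite -exprMn lerXn2r ?nnegrE ?mulr_ge0 ?(ltW (bracket_gt0 _))//.
  by have := bracketD z y; rewrite subrK.
apply: (le_trans (ler_wpM2r n0 (le_trans xa bb))).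
rewrite mulrAC; apply: ler_wpM2r; first by rewrite exprn_ge0// ltW// bracket_gt0.
apply: (le_trans (ler_wpM2r n0 (bracketX m z))).
rewrite -!mulrA; apply: ler_wpM2l; first exact: exprn_ge0.
move: (HA z) (HB z) (HD z); rewrite -/n /= !expr0 !mulr1 !mul1r normr1 mul1r !normrX.
by rewrite !mulrDl mul1r; lra.
Qed.

End Translate.

(** * The shearlet system *)

Section Matrices.
Context {R : realType}.
Implicit Types (a b c d t : R) (j : nat) (l : int).

Lemma mx2M (a b c d a' b' c' d' : R) : mx2 a b c d * mx2 a' b' c' d' =
  mx2 (a * a' + b * c') (a * b' + b * d') (c * a' + d * c') (c * b' + d * d').
Proof.
apply/matrixP => i k; rewrite !mxE !big_ord_recl big_ord0 addr0 !mxE /=.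
by case: i => -[|[|//]] ?; case: k => -[|[|//]] ? /=.
Qed.

Lemma mx2_1 : 1 = mx2 1 0 0 1 :> 'M[R]_2.
Proof.
by apply/matrixP => i k; rewrite !mxE; case: i => -[|[|//]] ?; case: k => -[|[|//]] ? /=.
Qed.

Lemma phase_mx2 xi (a b c d : R) x : phase xi (mx2 a b c d) x =
  xi.1 * (a * x.1 + b * x.2) + xi.2 * (c * x.1 + d * x.2).
Proof.
by rewrite /phase !mxE !big_ord_recl big_ord0 addr0 /= !mxE !big_ord_recl !big_ord0 !addr0 /= !mxE /=; ring.
Qed.

Lemma invr_mx (A B : 'M[R]_2) : A * B = 1 -> B * A = 1 -> A^-1 = B.
Proof.
move=> AB BA; have uA : A \is a GRing.unit by apply/unitrP; exists B.
by apply: (mulrI uA); rewrite divrr// AB.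
Qed.

Lemma diag_expN (a d : R) j : a != 0 -> d != 0 -> (mx2 a 0 0 d) ^- j = mx2 (a ^- j) 0 0 (d ^- j).
Proof.
move=> a0 d0; have -> : mx2 a 0 0 d ^+ j = mx2 (a ^+ j) 0 0 (d ^+ j).
  elim: j => [|j IH]; first by rewrite !expr0 mx2_1.
  by rewrite exprS IH mx2M !exprS; congr mx2; ring.
have aj : a ^+ j != 0 by rewrite expf_neq0.
have dj : d ^+ j != 0 by rewrite expf_neq0.
by apply: invr_mx; rewrite mx2M mx2_1; congr mx2; field; rewrite ?aj ?dj.
Qed.

Lemma shear_exp (f : R -> 'M[R]_2) l : f 0 = 1 -> (forall s t, f s * f t = f (s + t)) ->
  f 1 ^ l = f l%:~R.
Proof.
move=> f0 fD; have fX n : f 1 ^+ n = f n%:R.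
  by elim: n => [|n IH]; rewrite ?expr0 ?f0// exprS IH fD -nat1r.
case: l => n; first by rewrite -exprnP fX.
have -> : (Negz n)%:~R = - n.+1%:R :> R by rewrite NegzE rmorphN /= -pmulrn.
rewrite -[LHS]/((f 1 ^+ n.+1)^-1) fX.
by apply: invr_mx; rewrite fD ?subrr ?addNr f0.
Qed.

(** In lattice coordinates the matrix has the scales [4 ^- j] and [2 ^- j] and the shear [l]; the
    vertical matrix has the same parameters after the exchange of coordinates. *)
Lemma phase_h j l xi (x : R * R) : phase xi (A_h ^- j *m B_h ^ (- l)) x =
  dot xi (lat_point false (2 ^+ j ^- 2) (2 ^+ j)^-1 l%:~R x).
Proof.
have -> : B_h ^ (- l) = mx2 1 (- l%:~R) 0 1 :> 'M[R]_2.
  rewrite /B_h (@shear_exp (fun t => mx2 1 t 0 1)) ?rmorphN//.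
    by rewrite mx2_1.
  by move=> s t; rewrite mx2M; congr mx2; ring.
rewrite /A_h diag_expN// -[_ *m _]/(mx2 _ _ _ _ * mx2 _ _ _ _) mx2M phase_mx2.
have -> : 4 ^- j = 2 ^+ j ^- 2 :> R.
  by congr (_^-1); rewrite -exprM mulnC exprM; congr (_ ^+ j); rewrite expr2; lra.
by rewrite /dot /lat_point /swapped /=; ring.
Qed.

Lemma phase_v j l xi (x : R * R) : phase xi (A_v ^- j *m B_v ^ (- l)) x =
  dot xi (lat_point true (2 ^+ j ^- 2) (2 ^+ j)^-1 l%:~R x).
Proof.
have -> : B_v ^ (- l) = mx2 1 0 (- l%:~R) 1 :> 'M[R]_2.
  rewrite /B_v (@shear_exp (fun t => mx2 1 0 t 1)) ?rmorphN//.
    by rewrite mx2_1.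
  by move=> s t; rewrite mx2M; congr mx2; ring.
rewrite /A_v diag_expN// -[_ *m _]/(mx2 _ _ _ _ * mx2 _ _ _ _) mx2M phase_mx2.
have -> : 4 ^- j = 2 ^+ j ^- 2 :> R.
  by congr (_^-1); rewrite -exprM mulnC exprM; congr (_ ^+ j); rewrite expr2; lra.
by rewrite /dot /lat_point /swapped /=; ring.
Qed.

Lemma phase_half j l xi (x : R * R) : phase xi (2^-1 *: (A_h ^- j *m B_h ^ (- l))) x =
  dot xi (lat_point false (2 ^+ j ^- 2 / 2) ((2 ^+ j)^-1 / 2) l%:~R x).
Proof.
have -> : phase xi (2^-1 *: (A_h ^- j *m B_h ^ (- l))) x =
    2^-1 * phase xi (A_h ^- j *m B_h ^ (- l)) x.
  by rewrite /phase -scalemxAr -scalemxAl mxE.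
by rewrite phase_h /dot /lat_point /swapped /=; ring.
Qed.

Lemma phase1 xi (x : R * R) : phase xi 1 x = dot xi (lat_point false 1 1 0 x).
Proof. by rewrite mx2_1 phase_mx2 /dot /lat_point /swapped /=; ring. Qed.

(** The square of the normalising factor is the area of a lattice cell: [c = 0] for the interior
    elements, [c = 1] for the boundary elements of positive scale, whose lattice is finer by 2 in
    each direction. *)
Lemma pow2_half j (c : R) : let s : R := 2 `^ (- (3 * j%:R / 2) - c) in
  0 < s /\ s ^+ 2 = (2 ^+ j) ^- 2 * (2 ^+ j)^-1 * 2 `^ (- (2 * c)).
Proof.
move=> s; split; first exact: powR_gt0.
have t2 : 2 != 0 :> R by [].
rewrite /s expr2 -powRD ?t2 ?implybT//.
have -> : - (3 * j%:R / 2) - c + (- (3 * j%:R / 2) - c) = - (3 * j)%:R + (- (2 * c)) :> R.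
  by rewrite natrM; field.
have E : 2 `^ (- (3 * j)%:R) = (2 ^+ (3 * j))^-1 :> R by rewrite powRN powR_mulrn.
rewrite powRD ?t2 ?implybT// E; congr (_ * _).
by rewrite mulnC exprM !exprS expr0 mulr1 !invfM; ring.
Qed.

End Matrices.

(** * The squared windows as a partition *)

Section Partition.
Context {R : realType}.
Variables (phihat v : R -> R) (W : R * R -> R).
Hypotheses (hphi : coarse_window phihat) (hW : radial_window phihat W)
  (hv : angular_window v).
Implicit Types (xi : R * R) (j J : nat) (l : int).

(** On the last unit interval only the last two translates can be nonzero, and the three-term
    identity applies to them because its third term vanishes. Elsewhere the new translate vanishes
    and induction applies. *)
Lemma v_partition n (a t : R) : a <= t <= a + n%:R ->
  \sum_(0 <= i < n.+1) v (t - a - i%:R) ^+ 2 = 1.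
Proof.
have v0 := v_supp1 hv.
elim: n => [|n IH] /andP[t1 t2].
  have -> : t = a by rewrite addr0 in t2; apply/eqP; rewrite eq_le t2.
  by rewrite big_nat1 subrr subr0 (angular_one hv) expr1n.
rewrite -natr1 in t2.
have [tn|tn] := leP t (a + n%:R).
  rewrite big_nat_recr//= IH ?t1// v0 ?expr0n ?addr0//.
  by rewrite -natr1 ler0_norm; lra.
rewrite big_nat_recr//= big_nat_recr//= big1_seq ?add0r; last first.
  move=> i /=; rewrite mem_index_iota /= => ilt; rewrite v0 ?expr0n//.
  have : (i.+1)%:R <= n%:R :> R by rewrite ler_nat.
  by rewrite -natr1 => h; rewrite ger0_norm; lra.
have := angular_sqr hv (u := t - a - n%:R).
rewrite [v (_ + 1)]v0; last by rewrite ger0_norm; lra.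
rewrite normr0 expr0n addr0 !real_normK ?num_real// -natr1.
have -> : t - a - (n%:R + 1) = t - a - n%:R - 1 by ring.
by move=> H; rewrite addrC H// ger0_norm; lra.
Qed.

Definition slopes j : seq int := [seq Posz n - Posz (2 ^ j) | n <- iota 0 (2 ^ j.+1).+1].

Lemma mem_slopes j l : (l \in slopes j) = (`|l| <= 2 ^+ j).
Proof.
have E : 2 ^+ j = Posz (2 ^ j) by elim: j => // j IH; rewrite exprS IH expnS PoszM.
apply/mapP/idP => [[n]|H].
  rewrite mem_iota /= => nj ->; rewrite ler_norml; rewrite expnS in nj.
  rewrite E; lia.
rewrite E ler_norml in H; exists (absz (l + Posz (2 ^ j))); last by lia.
by rewrite mem_iota /= expnS; lia.
Qed.

Lemma slopes_uniq j : uniq (slopes j).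
Proof. by rewrite map_inj_uniq ?iota_uniq// => m n /addIr []. Qed.

Lemma slopes_partition j (t : R) : `|t| <= 2 ^+ j ->
  \sum_(l <- slopes j) v (t - l%:~R) ^+ 2 = 1.
Proof.
rewrite ler_norml => /andP[t1 t2].
have := @v_partition (2 ^ j.+1) (- 2 ^+ j) t.
rewrite natrX exprS t1 => /(_ _)H.
rewrite /slopes big_map -[RHS]H; last by lra.
rewrite /index_iota subn0; apply: eq_bigr => n _; congr (v _ ^+ 2).
by rewrite rmorphB /= -!pmulrn natrX; ring.
Qed.

(** At a given point the windows of one cone count, and the slope scaled by [2 ^ j] lies between
    [- 2 ^ j] and [2 ^ j]. The interior windows supply the directions [|l| < 2 ^ j]; the boundary
    windows, active in both cones, supply the two extreme ones. *)
Lemma wedge_partition j xi :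
  \sum_(l <- slopes j | `|l| < 2 ^+ j) (wedge v W 1 0 j l xi ^+ 2 + wedge v W 0 1 j l xi ^+ 2) +
  \sum_(l <- slopes j | `|l| == 2 ^+ j) wedge v W 1 1 j l xi ^+ 2 =
  W ((2 ^- (2 * j) : R) *: xi) ^+ 2.
Proof.
have X0 : 0 < 2 ^+ j :> R by rewrite exprn_gt0.
have [x0|x0] := eqVneq xi 0.
  have D0 al be l : wedge v W al be j l xi = 0 by rewrite /wedge /D_h /D_v x0 /= !eqxx !andbF.
  rewrite !big1 ?addr0; last first.
  - by move=> l _; rewrite !D0 !expr0n addr0.
  - by move=> l _; rewrite D0 expr0n.
  rewrite x0 scaler0 (W_near hphi hW) ?expr0n// normr0; lra.
pose t : R := 2 ^+ j * (if `|xi.2| <= `|xi.1| then xi.2 / xi.1 else xi.1 / xi.2).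
have tX : `|t| <= 2 ^+ j.
  rewrite normrM ger0_norm ?(ltW X0)// ler_piMr ?(ltW X0)//.
  have r (p q : R) : `|p| <= `|q| -> `|p / q| <= 1.
    rewrite normf_div; have [->|q0] := eqVneq q 0; first by rewrite normr0 invr0 mulr0.
    by move=> pq; rewrite ler_pdivrMr ?normr_gt0// mul1r.
  by case: ifPn => [/r//|]; rewrite -ltNge => /ltW /r.
set w := W _.
have E al be l : wedge v W al be j l xi =
    (if `|xi.2| <= `|xi.1| then al else be) * (w * v (t - l%:~R)).
  rewrite /wedge /D_h /D_v -/w /t; case: leP => h /=.
    rewrite ifT//; apply: contra_neq x0 => x10; move: h; rewrite x10 normr0 normr_le0 => /eqP x20.
    by rewrite [xi]surjective_pairing x10 x20.
  by rewrite (ltW h) ifT// -normr_gt0 (le_lt_trans _ h).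
under eq_bigr do rewrite !E.
under [X in _ + X]eq_bigr do rewrite E.
transitivity (w ^+ 2 * \sum_(l <- slopes j) v (t - l%:~R) ^+ 2); last by rewrite slopes_partition// mulr1.
rewrite mulr_sumr.
rewrite [RHS](bigID (fun l : int => `|l| < 2 ^+ j)) /=; congr (_ + _).
  by apply: eq_bigr => l _; case: leP => _; rewrite ?mul1r ?mul0r expr0n ?add0r ?addr0 exprMn.
rewrite big_seq_cond [RHS]big_seq_cond; apply: eq_big => l.
  by rewrite mem_slopes -leNgt eq_le; case: (`|l| <= 2 ^+ j).
by move=> _; case: leP => _; rewrite mul1r exprMn.
Qed.

Definition slope_pairs J : seq (nat * int) := [seq (j, l) | j <- iota 0 J, l <- slopes j].

Lemma window_partition J xi :
  Phihat phihat xi ^+ 2 +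
  \sum_(p <- slope_pairs J | `|p.2| < 2 ^+ p.1)
    (wedge v W 1 0 p.1 p.2 xi ^+ 2 + wedge v W 0 1 p.1 p.2 xi ^+ 2) +
  \sum_(p <- slope_pairs J | `|p.2| == 2 ^+ p.1) wedge v W 1 1 p.1 p.2 xi ^+ 2 =
  Phihat phihat ((2 ^- (2 * J) : R) *: xi) ^+ 2.
Proof.
rewrite -addrA big_mkcond [X in _ + (_ + X)]big_mkcond /slope_pairs !big_allpairs_dep -big_split /=.
rewrite (eq_bigr (fun j => W ((2 ^- (2 * j) : R) *: xi) ^+ 2)); last first.
  by move=> j _; rewrite -wedge_partition -big_mkcond -[X in _ + X]big_mkcond.
elim: J => [|J IH]; first by rewrite big_nil addr0 muln0 expr0 invr1 scale1r.
rewrite -[J.+1]addn1 iotaD big_cat /= addrA IH big_seq1 add0n (radial_sqr hW) scalerA.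
have -> : 2 ^- 2 * 2 ^- (2 * J) = 2 ^- (2 * (J + 1)) :> R.
  by rewrite -invfM -exprD; congr (_ ^- _); lia.
by rewrite addrC subrK.
Qed.

End Partition.

(** * The shearlets form blocks *)

Section ShearletBlocks.
Context {R : realType}.
Local Notation C := (R[i]).
Local Notation normc := (@Normc.normc R).
Variables (phihat v : R -> R) (W : R * R -> R).
Variables (Phi : R * R -> C) (psi_h psi_v psi_b : nat -> int -> int * int -> R * R -> C).
Hypotheses (hphi : coarse_window phihat) (hW : radial_window phihat W)
  (hv : angular_window v) (hpsi : shearlet_system phihat W v Phi psi_h psi_v psi_b).
Implicit Types (xi : R * R) (j : nat) (l : int) (al be : R).

Lemma wedge_bounded al be j l xi : wedge v W al be j l xi != 0 ->
  `|xi.1| < (2 ^+ j) ^+ 2 / 2 /\ `|xi.2| < (2 ^+ j) ^+ 2 / 2.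
Proof.
have XX : 2 ^+ (2 * j) = (2 ^+ j) ^+ 2 :> R by rewrite mulnC exprM.
have far := wedge_far v hphi hW al be (j := j) l (xi := xi); rewrite XX in far.
by move=> w0; split; rewrite ltNge; apply/negP => h; move: w0; rewrite far ?eqxx//; [left|right].
Qed.

Lemma wedge_freq al be j l xi : wedge v W al be j l xi != 0 ->
  [\/ (2 ^+ j) ^+ 2 <= 16 * `|xi.1|, (2 ^+ j) ^+ 2 <= 16 * `|xi.2| | 2 ^+ j = 1 :> R].
Proof.
have XX : 2 ^+ (2 * j) = (2 ^+ j) ^+ 2 :> R by rewrite mulnC exprM.
have near := wedge_near v hphi hW al be (j := j) l (xi := xi); rewrite XX in near.
move=> w0; have [h1|h1] := leP ((2 ^+ j) ^+ 2) (16 * `|xi.1|); first by constructor 1.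
have [h2|h2] := leP ((2 ^+ j) ^+ 2) (16 * `|xi.2|); first by constructor 2.
by move: w0; rewrite near ?eqxx//; lra.
Qed.

Lemma slope_bound j l : `|l| <= 2 ^+ j -> `|l%:~R| <= 2 ^+ j :> R.
Proof. by rewrite -intr_norm -(ler_int R) rmorphXn. Qed.

(** In lattice coordinates the second entry is the first one times the argument of [v], hence no
    larger where [v] does not vanish; the first is below [1 / 2] by the radial support. *)
Lemma wedge_cell_h j l xi : wedge v W 1 0 j l xi != 0 ->
  `|(lat_freq false (2 ^+ j ^- 2) (2 ^+ j)^-1 l%:~R xi).1| < 2^-1 /\
  `|(lat_freq false (2 ^+ j ^- 2) (2 ^+ j)^-1 l%:~R xi).2| < 2^-1.
Proof.
move=> w0; have [h1 h2] := wedge_bounded w0; have X0 : 0 < 2 ^+ j :> R by rewrite exprn_gt0.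
set X := 2 ^+ j in h1 h2 X0 *.
have i0 : 0 <= X ^- 2 by rewrite invr_ge0 sqr_ge0.
have f1 : `|X ^- 2 * xi.1| < 2^-1.
  by rewrite normrM ger0_norm// ltr_pdivrMl ?exprn_gt0.
rewrite /lat_freq /swapped /=; split => //.
move: w0; rewrite /wedge; case: ifP => [/andP[_ x0]|_]; last first.
  by case: ifP; rewrite ?mul0r eqxx.
rewrite mul1r mulf_eq0 negb_or => /andP[_ v0].
have t1 : `|X * (xi.2 / xi.1) - l%:~R| < 1.
  by rewrite ltNge; apply/negP => h; move: v0; rewrite (v_supp1 hv h) eqxx.
have -> : X^-1 * xi.2 - l%:~R * X ^- 2 * xi.1 = (X * (xi.2 / xi.1) - l%:~R) * (X ^- 2 * xi.1).
  by field; rewrite x0 gt_eqF.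
by rewrite normrM (le_lt_trans _ f1)// ler_piMl// ltW.
Qed.

Lemma wedge_cell_v j l xi : wedge v W 0 1 j l xi != 0 ->
  `|(lat_freq true (2 ^+ j ^- 2) (2 ^+ j)^-1 l%:~R xi).1| < 2^-1 /\
  `|(lat_freq true (2 ^+ j ^- 2) (2 ^+ j)^-1 l%:~R xi).2| < 2^-1.
Proof.
move=> w0; have [h1 h2] := wedge_bounded w0; have X0 : 0 < 2 ^+ j :> R by rewrite exprn_gt0.
set X := 2 ^+ j in h1 h2 X0 *.
have i0 : 0 <= X ^- 2 by rewrite invr_ge0 sqr_ge0.
have f2 : `|X ^- 2 * xi.2| < 2^-1.
  by rewrite normrM ger0_norm// ltr_pdivrMl ?exprn_gt0.
rewrite /lat_freq /swapped /=; split => //.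
move: w0; rewrite /wedge; case: ifP => [_|_]; first by rewrite mul0r eqxx.
case: ifP => [/andP[_ x0]|_]; last by rewrite eqxx.
rewrite mul1r mulf_eq0 negb_or => /andP[_ v0].
have t1 : `|X * (xi.1 / xi.2) - l%:~R| < 1.
  by rewrite ltNge; apply/negP => h; move: v0; rewrite (v_supp1 hv h) eqxx.
have -> : X^-1 * xi.1 - l%:~R * X ^- 2 * xi.2 = (X * (xi.1 / xi.2) - l%:~R) * (X ^- 2 * xi.2).
  by field; rewrite x0 gt_eqF.
by rewrite normrM (le_lt_trans _ f2)// ler_piMl// ltW.
Qed.

(** In the horizontal cone the reasoning is that of [wedge_cell_h]. In the vertical cone
    [l ^ 2 = X ^ 2] shows that the second entry, before the factor [1 / 2], is up to sign the
    argument of [v] times [X ^- 2 * xi.2]. *)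
Lemma wedge_cell_b j l xi : `|l| = 2 ^+ j -> wedge v W 1 1 j l xi != 0 ->
  `|(lat_freq false (2 ^+ j ^- 2 / 2) ((2 ^+ j)^-1 / 2) l%:~R xi).1| < 2^-1 /\
  `|(lat_freq false (2 ^+ j ^- 2 / 2) ((2 ^+ j)^-1 / 2) l%:~R xi).2| < 2^-1.
Proof.
move=> lj w0; have [h1 h2] := wedge_bounded w0; have X0 : 0 < 2 ^+ j :> R by rewrite exprn_gt0.
have lX : `|l%:~R| = 2 ^+ j :> R by rewrite -intr_norm lj rmorphXn.
set X := 2 ^+ j in h1 h2 X0 lX *.
have i0 : 0 <= X ^- 2 by rewrite invr_ge0 sqr_ge0.
have f (t : R) : `|t| < X ^+ 2 / 2 -> `|X ^- 2 * t| < 2^-1.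
  by move=> h; rewrite normrM ger0_norm// ltr_pdivrMl ?exprn_gt0.
rewrite /lat_freq /swapped /=.
have half (t : R) : `|t| < 2^-1 -> `|t / 2| < 2^-1.
  move=> h; rewrite normrM (ger0_norm (_ : 0 <= 2^-1 :> R)) ?invr_ge0//; have := normr_ge0 t; lra.
split; first by rewrite mulrAC; apply/half/f.
have -> : X^-1 / 2 * xi.2 - l%:~R * (X ^- 2 / 2) * xi.1 = (X^-1 * xi.2 - l%:~R * X ^- 2 * xi.1) / 2.
  by field; rewrite gt_eqF.
apply: half; move: w0; rewrite /wedge; case: ifP => [/andP[_ x0]|_].
  rewrite mul1r mulf_eq0 negb_or => /andP[_ v0].
  have t1 : `|X * (xi.2 / xi.1) - l%:~R| < 1.
    by rewrite ltNge; apply/negP => h; move: v0; rewrite (v_supp1 hv h) eqxx.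
  have -> : X^-1 * xi.2 - l%:~R * X ^- 2 * xi.1 = (X * (xi.2 / xi.1) - l%:~R) * (X ^- 2 * xi.1).
    by field; rewrite x0 gt_eqF.
  by rewrite normrM (le_lt_trans _ (f _ h1))// ler_piMl// ltW.
case: ifP => [/andP[_ x0]|_]; last by rewrite eqxx.
rewrite mul1r mulf_eq0 negb_or => /andP[_ v0].
have t1 : `|X * (xi.1 / xi.2) - l%:~R| < 1.
  by rewrite ltNge; apply/negP => h; move: v0; rewrite (v_supp1 hv h) eqxx.
have l2 : l%:~R ^+ 2 = X ^+ 2 :> R by rewrite -[LHS]real_normK ?num_real// lX.
have -> : X^-1 * xi.2 - l%:~R * X ^- 2 * xi.1 =
    - (l%:~R / X) * (X * (xi.1 / xi.2) - l%:~R) * (X ^- 2 * xi.2).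
  have -> : - (l%:~R / X) * (X * (xi.1 / xi.2) - l%:~R) * (X ^- 2 * xi.2) =
      (l%:~R ^+ 2 * xi.2 / X - l%:~R * xi.1) * X ^- 2 by field; rewrite x0 gt_eqF.
  by rewrite l2; field; rewrite gt_eqF.
rewrite normrM (le_lt_trans _ (f _ h2))// ler_piMl// normrM normrN normf_div lX (ger0_norm (ltW X0)).
by rewrite divff ?gt_eqF// mul1r ltW.
Qed.

Variables (Ks : nat * nat -> nat * nat -> R) (Ms : nat * nat -> nat * nat -> nat).
Hypothesis wedge_bound : forall a b j l al be s (u : R * R -> C),
  `|al| <= 1 -> `|be| <= 1 -> `|s| <= 1 -> schwartz u ->
  (forall xi, FT u xi = (s * wedge v W al be j l xi)%:C) ->
  forall x, `|x.1 ^+ a.1 * x.2 ^+ a.2| * normc (cderiv b u x) <= Ks a b * (2 ^+ j) ^+ Ms a b.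
Hypothesis coarse_bound : forall a b x,
  `|x.1 ^+ a.1 * x.2 ^+ a.2| * normc (cderiv b Phi x) <= Ks a b.
Local Notation block := (block Ks Ms).

Lemma zvec0 : zvec (0, 0) = 0 :> R * R.
Proof. by []. Qed.

(** [h] is the refinement of the sampling lattice: 1, or 2 for the boundary elements of positive
    scale. The element with index [(0, 0)] serves as the element at the origin. *)
Lemma wedge_block sw (h : R) (lam : R) al be j l s (e : int * int -> R * R -> C) :
  h = 1 \/ h = 2 -> `|al| <= 1 -> `|be| <= 1 -> `|lam| <= 2 ^+ j -> 0 < s ->
  s ^+ 2 = (2 ^+ j ^- 2 / h) * ((2 ^+ j)^-1 / h) ->
  (forall xi, wedge v W al be j l xi != 0 ->
    `|(lat_freq sw (2 ^+ j ^- 2 / h) ((2 ^+ j)^-1 / h) lam xi).1| < 2^-1 /\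
    `|(lat_freq sw (2 ^+ j ^- 2 / h) ((2 ^+ j)^-1 / h) lam xi).2| < 2^-1) ->
  (forall k, schwartz_with_fourier (e k) (fun xi => (s * wedge v W al be j l xi)%:C *
    expi (- (2 * pi * dot xi (lat_point sw (2 ^+ j ^- 2 / h) ((2 ^+ j)^-1 / h) lam (zvec k)))))) ->
  block (2 ^+ j) (wedge v W al be j l) e.
Proof.
move=> hh al1 be1 lX s0 ss wc He.
have h1 : 1 <= h by case: hh => ->; rewrite ?ler1n.
have h2 : h <= 2 by case: hh => ->; rewrite ?ler1n.
have h0 : 0 < h by lra.
have hi : h^-1 <= 1 by rewrite invf_le1.
have hi0 : 0 < h^-1 by rewrite invr_gt0.
set X : R := 2 ^+ j in ss lX wc He *.
have X1 : 1 <= X by rewrite exprn_ege1// ler1n.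
have X0 : 0 < X by lra.
have X2 : 1 <= X ^+ 2 by rewrite exprn_ege1.
have I0 : 0 < X ^- 2 by rewrite invr_gt0 exprn_gt0.
have I1 : X ^- 2 <= 1 by rewrite invf_le1 ?exprn_gt0.
have J0 : 0 < X^-1 by rewrite invr_gt0.
have J1 : X^-1 <= 1 by rewrite invf_le1.
have FTe k xi : FT (e k) xi = (s * wedge v W al be j l xi)%:C *
    expi (- (2 * pi * dot xi (lat_point sw (X ^- 2 / h) (X^-1 / h) lam (zvec k)))).
  by have [_ /(_ xi)] := He k; rewrite fourierE.
have FTu xi : FT (e (0, 0)) xi = (s * wedge v W al be j l xi)%:C.
  rewrite FTe dot_lat_point zvec0 /= !mul0r addr0 mulr0 oppr0 expi0.
  exact: mulr1.
have k01 : X ^- 2 / h <= 1 by rewrite mulr_ile1 ?(ltW I0) ?(ltW hi0).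
have k11 : X^-1 / h <= 1 by rewrite mulr_ile1 ?(ltW J0) ?(ltW hi0).
have s1 : s <= 1.
  rewrite -(expr_le1 (n := 2)) ?(ltW s0)// ss; apply: mulr_ile1 => //; apply/ltW; exact: divr_gt0.
apply: (@Block R Ks Ms X _ e sw (X ^- 2 / h) (X^-1 / h) lam s (e (0, 0))) => //.
- by rewrite divr_gt0.
- by rewrite divr_gt0.
- apply: (@le_trans _ _ (X * (X ^- 2))).
    apply: ler_pM => //; first by rewrite ltW// divr_gt0.
    by rewrite ler_piMr// ltW.
  by rewrite expr2 invfM mulrA mulfV ?mul1r// gt_eqF.
- by rewrite invfM invrK invrK mulrC; apply: ler_wpM2r => //; rewrite sqr_ge0.
- by rewrite invfM !invrK mulrC; apply: ler_wpM2r => //; exact: ltW.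
- by rewrite s0.
- by move=> xi; exact: (wedge_le1 hphi hW hv).
- by move=> xi; exact: wedge_freq.
- by have [] := He (0, 0).
- by move=> k; have [] := He k.
- by move=> k xi; rewrite FTu FTe.
- move=> a b x; apply: (wedge_bound a b al1 be1 _ _ FTu); last by have [] := He (0, 0).
  by rewrite ger0_norm// ltW.
Qed.

Lemma block_h j l : `|l| < 2 ^+ j -> block (2 ^+ j) (wedge v W 1 0 j l) (psi_h j l).
Proof.
move=> lj; have [s0 ss] := @pow2_half R j 0; set s := _ `^ _ in s0 ss.
apply: (@wedge_block false 1 l%:~R 1 0 j l s) => //.
- by left.
- by rewrite normr1.
- by rewrite normr0.
- exact: slope_bound (ltW lj).
- by rewrite ss mulr0 oppr0 powRr0 mulr1 !divr1.
- by move=> xi w0; have := wedge_cell_h w0; rewrite !divr1.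
move=> k; have [sk Hk] := shearlet_h hpsi k lj; split => // xi; rewrite Hk.
rewrite /psi_h_hat /wedge; case: ifP => _; last first.
  by case: ifP => _; rewrite ?mul0r mulr0 mul0r.
rewrite /modulation phase_h !divr1 mul1r /s subr0; congr (_ %:C * _).
by rewrite -[LHS]mulrA.
Qed.

Lemma block_v j l : `|l| < 2 ^+ j -> block (2 ^+ j) (wedge v W 0 1 j l) (psi_v j l).
Proof.
move=> lj; have [s0 ss] := @pow2_half R j 0; set s := _ `^ _ in s0 ss.
apply: (@wedge_block true 1 l%:~R 0 1 j l s) => //.
- by left.
- by rewrite normr0.
- by rewrite normr1.
- exact: slope_bound (ltW lj).
- by rewrite ss mulr0 oppr0 powRr0 mulr1 !divr1.
- by move=> xi w0; have := wedge_cell_v w0; rewrite !divr1.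
move=> k; have [sk Hk] := shearlet_v hpsi k lj; split => // xi; rewrite Hk.
rewrite /psi_v_hat /wedge; have [dv|dv] := boolP (D_v xi); last first.
  by case: ifP => _; rewrite ?mul0r mulr0 mul0r.
rewrite /modulation phase_v !divr1 /s subr0; have [dh|dh] := boolP (D_h xi); last first.
  by rewrite mul1r; congr (_ %:C * _); rewrite -[LHS]mulrA.
(* On the diagonal the argument of [v] has absolute value at least 1. *)
have xx : `|xi.1| = `|xi.2|.
  by apply/eqP; rewrite eq_le; move: dv dh => /andP[-> _] /andP[-> _].
have /andP[_ x2] := dv.
rewrite [v _](v_supp1 hv) ?mulr0 ?mul0r ?mulr0 ?mul0r//.
have lj' : (`|l| + 1)%:~R <= (2 ^+ j)%:~R :> R by rewrite ler_int; lia.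
rewrite intrD intr_norm rmorphXn /= in lj'.
have t1 : `|2 ^+ j * (xi.1 / xi.2)| = 2 ^+ j.
  by rewrite normrM normf_div xx divff ?normr_eq0// mulr1 ger0_norm// exprn_ge0.
have := lerB_dist (2 ^+ j * (xi.1 / xi.2)) l%:~R.
by rewrite t1; lra.
Qed.

Lemma block_b j l : `|l| = 2 ^+ j -> block (2 ^+ j) (wedge v W 1 1 j l) (psi_b j l).
Proof.
move=> lj; have [j0|j0] := eqVneq j 0%N.
  (* At scale 0 the lattice consists of the integer points and is not sheared; the radial support by
     itself fits into the cell. *)
  apply: (@wedge_block false 1 0 1 1 j l 1) => //.
  - by left.
  - by rewrite normr1.
  - by rewrite normr1.
  - by rewrite normr0 exprn_ge0.
  - by rewrite j0 expr0 !(expr1n, divr1, invr1, mulr1).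
  - move=> xi /wedge_bounded; rewrite j0 expr0 !(expr1n, divr1, invr1, mulr1) /lat_freq /swapped /=.
    by rewrite !mul0r subr0 !mul1r.
  move=> k; have [sk Hk] := shearlet_b hpsi k lj; split => // xi; rewrite Hk /psi_b_hat j0 eqxx.
  rewrite /modulation phase1 expr0 !(expr1n, divr1, invr1, mulr1); congr (_ %:C * _).
  rewrite /omega /wedge muln0 expr0 invr1 scale1r !mul1r.
  by case: ifP => _ //; case: ifP => _ //; rewrite mulr0.
have [s0 ss] := @pow2_half R j 1; set s := _ `^ _ in s0 ss.
apply: (@wedge_block false 2 l%:~R 1 1 j l s) => //.
- by right.
- by rewrite normr1.
- by rewrite normr1.
- by apply: slope_bound; rewrite lj.
- have e : 2 `^ (- (2 * 1)) = 2^-1 * 2^-1 :> R by rewrite mulr1 powRN powR_mulrn// expr2 invfM.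
  by rewrite ss e; ring.
- by move=> xi w0; exact: wedge_cell_b.
move=> k; have [sk Hk] := shearlet_b hpsi k lj; split => // xi; rewrite Hk.
rewrite /psi_b_hat (negbTE j0) /modulation phase_half /s; congr (_ %:C * _).
rewrite /omega /wedge !mul1r -mulrA; case: ifP => _ //; case: ifP => _ //.
by rewrite !mulr0.
Qed.

Lemma block_coarse : block 1 (Phihat phihat) (translate Phi).
Proof.
have [sP FP] := shearlet_coarse hpsi.
have FTP xi : FT Phi xi = (Phihat phihat xi)%:C by rewrite -fourierE FP.
have p01 := Phihat_01 hphi.
have psupp xi : Phihat phihat xi != 0 -> `|xi.1| < 2^-1 /\ `|xi.2| < 2^-1.
  rewrite mulf_eq0 negb_or => /andP[p1 p2].
  have h t : phihat t != 0 -> `|t| < 2^-1.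
    by move=> pt; rewrite ltNge; apply/negP => ht; move: pt; rewrite (phihat_supp hphi) ?eqxx//; lra.
  by split; apply: h.
apply: (@Block R Ks Ms 1 _ _ false 1 1 0 1 Phi) => //.
- by rewrite ltr01 lexx.
- by rewrite ltr01 lexx.
- by rewrite normr0 mul0r.
- by rewrite normr0.
- by rewrite invr1 expr1n mulr1 ler1n.
- by rewrite invr1 mulr1 ler1n.
- by rewrite ltr01 lexx.
- by move=> xi; have /andP[p0 p1] := p01 xi; rewrite ger0_norm.
- by move=> xi _; constructor 3.
- by move=> xi /psupp; rewrite /lat_freq /swapped /= !mul0r subr0 !mul1r.
- by move=> k; exact: schwartz_shift.
- by move=> xi; rewrite mul1r FTP.
- move=> k xi; have [K _ dP] := cderiv_decay (0%N, 0%N) sP; rewrite cderiv00 in dP.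
  have := FT_translate (- zvec k) xi dP.
  rewrite (_ : (fun x => _) = translate Phi k); last by apply/funext => x; rewrite /translate addrC.
  move=> ->; rewrite mulrC; congr (_ * expi _).
  by rewrite /lat_point /swapped /dot /=; ring.
- by move=> a b x; rewrite expr1n mulr1.
Qed.

End ShearletBlocks.

(** * Unordered sums *)

Section NormcLimits.
Context {R : realType}.
Local Notation C := (R[i]).
Local Notation normc := (@Normc.normc R).

Definition cto (u : nat -> C) (l : C) := normc (u n - l) @[n --> \oo] --> (0 : R).

Lemma ctoD u v k l : cto u k -> cto v l -> cto (fun n => u n + v n) (k + l).
Proof.
move=> uk vl.
have H : normc (u n - k) + normc (v n - l) @[n --> \oo] --> (0 : R).
  by rewrite -[X in _ --> X](addr0 0); apply: cvgD.
apply: squeeze_cvgr (cvg_cst 0) H; apply: nearW => n; rewrite normc_ge0 /=.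
have -> : u n + v n - (k + l) = (u n - k) + (v n - l) by ring.
exact: le_normcD.
Qed.

Lemma cto_cst l : cto (fun=> l) l.
Proof. by rewrite /cto; under eq_fun do rewrite subrr Normc.normc0; exact: cvg_cst. Qed.

Lemma cto_sum (I : Type) (s : seq I) (u : I -> nat -> C) (l : I -> C) :
  (forall i, cto (u i) (l i)) -> cto (fun n => \sum_(i <- s) u i n) (\sum_(i <- s) l i).
Proof.
move=> H; elim: s => [|i s IH].
  by rewrite big_nil; under eq_fun do rewrite big_nil; exact: cto_cst.
by rewrite big_cons; under eq_fun do rewrite big_cons; exact: ctoD.
Qed.

Lemma cto_le u l (z : C) (B : nat -> R) (b : R) : cto u l ->
  (forall n, normc (z - u n) <= B n) -> B n @[n --> \oo] --> b -> normc (z - l) <= b.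
Proof.
move=> ul zB Bb; rewrite -subr_le0.
apply: (@ge0_cvg_le _ _ (fun n => normc (u n - l) + (B n - b))) => [n|].
  have -> : z - l = (u n - l) + (z - u n) by ring.
  by have := le_normcD (u n - l) (z - u n); have := zB n; lra.
have Bb' : B n - b @[n --> \oo] --> (0 : R).
  by rewrite -(subrr b); apply: cvgB => //; exact: cvg_cst.
by rewrite -[X in _ --> X](addr0 0); apply: cvgD.
Qed.

End NormcLimits.

Section BoxMeans.
Context {R : realType}.
Local Notation C := (R[i]).
Local Notation normc := (@Normc.normc R).
Implicit Types (S : seq (int * int) -> C) (N : nat).

Lemma box_meanD N S S' : box_mean N (fun s => S s + S' s) = box_mean N S + box_mean N S'.
Proof.
rewrite /box_mean -mulrDr -big_split; congr (_ * _); apply: eq_bigr => m1 _.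
by rewrite -big_split.
Qed.

Lemma box_mean_sum (I : Type) (r : seq I) N (S : I -> seq (int * int) -> C) :
  box_mean N (fun s => \sum_(i <- r) S i s) = \sum_(i <- r) box_mean N (S i).
Proof.
elim: r => [|i r IH].
  rewrite big_nil /box_mean big1 ?mulr0// => m1 _; rewrite big1// => m2 _.
  by rewrite big_nil.
by rewrite big_cons -IH -box_meanD; congr box_mean; apply/funext => s; rewrite big_cons.
Qed.

(** If neither shift is an edge, the box contains every index whose coordinates are less than [r] in
    absolute value. *)
Definition edge (r N m : nat) : bool := (m < r)%N || (N < m + r)%N.

Lemma edge_sum r N : \sum_(0 <= m < N) (edge r N m)%:R <= (2 * r)%:R :> R.
Proof.
have E : (\sum_(0 <= m < N) edge r N m <= 2 * r)%N.
  have H1 n : (\sum_(0 <= m < n) (m < r)%N <= minn n r)%N.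
    elim: n => [|n IH]; first by rewrite big_geq.
    rewrite big_nat_recr//=; lia.
  have H2 n : (\sum_(0 <= m < n) (N < m + r)%N <= (n + r) - N)%N.
    elim: n => [|n IH]; first by rewrite big_geq.
    rewrite big_nat_recr//=; lia.
  apply: (@leq_trans (\sum_(0 <= m < N) (m < r)%N + \sum_(0 <= m < N) (N < m + r)%N)).
    by rewrite -big_split; apply: leq_sum => m _; rewrite /edge; case: (m < r)%N; case: (N < m + r)%N.
  by have := H1 N; have := H2 N; lia.
by rewrite -natr_sum ler_nat.
Qed.

(** At most [2 r] values of each shift are edges, hence at most [4 r N] of the [N ^ 2] boxes have
    the error [M] instead of [e]. *)
Lemma box_mean_dist N r S (z : C) (e M : R) : (0 < N)%N -> 0 <= e -> 0 <= M ->
  (forall m1 m2, (m1 < N)%N -> (m2 < N)%N -> normc (z - S (box N m1 m2)) <=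
     (if edge r N m1 || edge r N m2 then M else e)) ->
  normc (z - box_mean N S) <= e + M * (4 * r)%:R / N%:R.
Proof.
move=> N0 e0 M0 H.
have n0 : N%:R != 0 :> R by rewrite pnatr_eq0 -lt0n.
have np : 0 < N%:R^-1 :> R by rewrite invr_gt0 ltr0n.
have -> : z - box_mean N S = (N%:R^-1 * N%:R^-1)%:C *
    \sum_(0 <= m1 < N) \sum_(0 <= m2 < N) (z - S (box N m1 m2)).
  under eq_bigr => m1 _ do rewrite sumrB sumr_const_nat subn0.
  rewrite sumrB sumr_const_nat subn0 mulrBr; congr (_ - _).
  rewrite -!mulrnA -[X in _ * X]mulr_natl mulrA.
  have -> : (N%:R^-1 * N%:R^-1)%:C * (N * N)%:R = 1 :> C.
    have -> : (N * N)%:R = (N%:R * N%:R)%:C :> C by rewrite -natrM rmorph_nat.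
    rewrite -rmorphM; have -> : N%:R^-1 * N%:R^-1 * (N%:R * N%:R) = 1 :> R by field.
    by [].
  by rewrite mul1r.
rewrite Normc.normcM normc_real ger0_norm ?mulr_ge0 ?(ltW np)//.
apply: (@le_trans _ _ (N%:R^-1 * N%:R^-1 * \sum_(0 <= m1 < N) \sum_(0 <= m2 < N)
    (e + M * ((edge r N m1)%:R + (edge r N m2)%:R)))).
  apply: ler_wpM2l; first by rewrite mulr_ge0// ltW.
  apply: (le_trans (normc_sum _ _ _)); rewrite !big_nat; apply: ler_sum => m1 /= m1N.
  apply: (le_trans (normc_sum _ _ _)); rewrite !big_nat; apply: ler_sum => m2 /= m2N.
  apply: (le_trans (H m1 m2 m1N m2N)).
  case: (edge r N m1); case: (edge r N m2) => /=; lra.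
have Es : \sum_(0 <= m1 < N) \sum_(0 <= m2 < N) (e + M * ((edge r N m1)%:R + (edge r N m2)%:R)) =
    N%:R * N%:R * e + M * (2 * N%:R * \sum_(0 <= m < N) (edge r N m)%:R).
  have in1 m1 : \sum_(0 <= m2 < N) (e + M * ((edge r N m1)%:R + (edge r N m2)%:R)) =
      N%:R * e + M * (N%:R * (edge r N m1)%:R + \sum_(0 <= m < N) (edge r N m)%:R).
    rewrite big_split /= sumr_const_nat subn0 -[e *+ N]mulr_natl; congr (_ + _).
    by rewrite -mulr_sumr big_split /= sumr_const_nat subn0 -[(edge r N m1)%:R *+ N]mulr_natl.
  under eq_bigr do rewrite in1.
  rewrite big_split /= sumr_const_nat subn0 -[(N%:R * e) *+ N]mulr_natl mulrA; congr (_ + _).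
  rewrite -mulr_sumr big_split /= sumr_const_nat subn0 -mulr_sumr.
  rewrite -[(\sum_(0 <= m < N) (edge r N m)%:R) *+ N]mulr_natl; congr (_ * _).
  set E := \sum_(0 <= m < N) _; ring.
rewrite Es mulrDr.
have -> : N%:R^-1 * N%:R^-1 * (N%:R * N%:R * e) = e by field.
rewrite lerD2l.
have -> : N%:R^-1 * N%:R^-1 * (M * (2 * N%:R * \sum_(0 <= m < N) (edge r N m)%:R)) =
   M * (2 * \sum_(0 <= m < N) (edge r N m)%:R) / N%:R by field.
apply: ler_wpM2r; first exact: ltW.
apply: ler_wpM2l => //.
by have := edge_sum r N; rewrite !natrM; lra.
Qed.

Lemma mem_box N m1 m2 (k : int * int) : (k \in box N m1 m2) =
  [&& - m1%:Z <= k.1, k.1 < N%:Z - m1%:Z, - m2%:Z <= k.2 & k.2 < N%:Z - m2%:Z].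
Proof.
apply/allpairsP/idP => [[[n1 n2] /=]|].
  by rewrite !mem_iota /= !add0n => -[h1 h2 ->] /=; lia.
case/and4P => h1 h2 h3 h4.
exists (absz (k.1 + m1%:Z), absz (k.2 + m2%:Z)) => /=; rewrite !mem_iota /=.
split; [lia|lia|].
by rewrite [LHS]surjective_pairing; congr (_, _); lia.
Qed.

Lemma box_uniq N m1 m2 : uniq (box N m1 m2).
Proof.
apply: allpairs_uniq; rewrite ?iota_uniq// => -[a b] [c d] _ _ /= [] /eqP h1 /eqP h2.
by congr (_, _); apply/eqP; lia.
Qed.

End BoxMeans.

Section UnorderedSum.
Context {R : realType} {I : choiceType}.
Local Notation C := (R[i]).
Local Notation normc := (@Normc.normc R).
Variables (rate : I -> R) (M : R).
Hypothesis rate_sum : forall s : seq I, uniq s -> \sum_(i <- s) rate i <= M.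

(** The finite sums have a supremum, and a set that nearly attains it leaves at most [e] for any set
    disjoint from it. *)
Lemma rate_tail (e : R) : 0 < e -> exists A0 : {fset I},
  forall s : seq I, uniq s -> (forall i, i \in s -> i \notin A0) -> \sum_(i <- s) rate i <= e.
Proof.
move=> e0; pose S : set R := [set t | exists2 s : seq I, uniq s & t = \sum_(i <- s) rate i].
have S0 : has_sup S.
  split; first by exists 0; exists [::] => //; rewrite big_nil.
  by exists M => _ [s us ->]; exact: rate_sum.
have [_ [s0 us0 ->] H] := sup_adherent e0 S0.
exists [fset i in s0]%fset => s us dis.
have u : uniq (s0 ++ s).
  rewrite cat_uniq us0 us andbT /=; apply/hasPn => i /dis; by rewrite !inE.
have : \sum_(i <- s0 ++ s) rate i <= sup S.
  by apply: (sup_upper_bound S0); exists (s0 ++ s).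
rewrite big_cat /=; lra.
Qed.

Variable Bx : nat -> seq (int * int) -> seq I.
Hypotheses (Bx_uniq : forall J s, uniq s -> uniq (Bx J s))
  (Bx_exhaust : forall i, exists r, forall J N m1 m2, (r <= J)%N -> (r <= m1)%N -> (r <= m2)%N ->
     (m1 + r <= N)%N -> (m2 + r <= N)%N -> i \in Bx J (box N m1 m2)).

Lemma exhaust_fset (A : {fset I}) : exists r, forall J N m1 m2, (r <= J)%N -> (r <= m1)%N -> (r <= m2)%N ->
     (m1 + r <= N)%N -> (m2 + r <= N)%N -> forall i, i \in A -> i \in Bx J (box N m1 m2).
Proof.
pose P (s : seq I) := exists r, forall J N m1 m2, (r <= J)%N -> (r <= m1)%N -> (r <= m2)%N ->
     (m1 + r <= N)%N -> (m2 + r <= N)%N -> forall i, i \in s -> i \in Bx J (box N m1 m2).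
suff H s : P s by have [r Hr] := H A; exists r.
elim: s => [|i s [r Hr]]; first by exists 0%N.
have [q Hq] := Bx_exhaust i; exists (maxn r q) => J N m1 m2 h1 h2 h3 h4 h5 i'.
by rewrite inE => /predU1P[->|]; [apply: Hq; lia|apply: Hr; lia].
Qed.

Variables (A0 : {fset I}) (e : R).
Hypotheses (e0 : 0 < e)
  (tail : forall s : seq I, uniq s -> (forall i, i \in s -> i \notin A0) -> \sum_(i <- s) rate i <= e).

Variables (K : R) (a : I -> C).
Hypotheses (K0 : 0 <= K) (aK : forall i, normc (a i) <= K * rate i).

Lemma sum_dist (s t : seq I) : uniq s -> uniq t -> {subset A0 <= s} -> {subset A0 <= t} ->
  normc (\sum_(i <- s) a i - \sum_(i <- t) a i) <= K * (2 * e).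
Proof.
have part (p q : seq I) : uniq p -> {subset A0 <= q} ->
    normc (\sum_(i <- p | i \notin q) a i) <= K * e.
  move=> up Aq; rewrite -big_filter; apply: (le_trans (normc_sum _ _ _)).
  apply: (@le_trans _ _ (\sum_(i <- [seq i <- p | i \notin q]) K * rate i)).
    by apply: ler_sum => i _; exact: aK.
  rewrite -mulr_sumr; apply: ler_wpM2l => //; apply: tail; first exact: filter_uniq.
  by move=> i; rewrite mem_filter => /andP[iq _]; apply: contra iq => /Aq.
move=> us ut As At.
rewrite (bigID (mem t)) /= [X in _ - X](bigID (mem s)) /=.
have -> : \sum_(i <- s | i \in t) a i = \sum_(i <- t | i \in s) a i.
  rewrite -[LHS]big_filter -[RHS]big_filter; apply: perm_big; apply: uniq_perm; rewrite ?filter_uniq//.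
  by move=> i; rewrite !mem_filter andbC.
set x := \sum_(i <- t | i \in s) _; set y := \sum_(i <- s | _) _; set z := \sum_(i <- t | _) _.
have -> : x + y - (x + z) = y - z by ring.
apply: (le_trans (normcB _ _)).
have -> : K * (2 * e) = K * e + K * e by ring.
by apply: lerD; apply: part.
Qed.

Lemma sum_bound (s : seq I) : uniq s -> normc (\sum_(i <- s) a i) <= K * M.
Proof.
move=> us; apply: (le_trans (normc_sum _ _ _)).
apply: (@le_trans _ _ (\sum_(i <- s) K * rate i)); first by apply: ler_sum => i _; exact: aK.
by rewrite -mulr_sumr; apply: ler_wpM2l => //; exact: rate_sum.
Qed.

(** All but a vanishing proportion of the boxes contain [A0], so up to the tail the Fejer means
    agree with any finite sum over a set containing [A0]. The limits in [N] and then in [J] identify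
    the value, while the error depends on the family only through [K]. *)
Lemma unordered_limit (T_ : nat -> C) (T : C) :
  (forall J, cto (fun N => box_mean N.+1 (fun s => \sum_(i <- Bx J s) a i)) (T_ J)) ->
  cto T_ T -> forall A : {fset I}, {subset A0 <= A} ->
  normc (\sum_(i <- A) a i - T) <= K * (2 * e).
Proof.
move=> HT_ HT A A0A; have [r Hr] := exhaust_fset A0.
have M0 : 0 <= M by have := rate_sum (isT : uniq [::]); rewrite big_nil.
have step J : (r <= J)%N -> normc (\sum_(i <- A) a i - T_ J) <= K * (2 * e).
  move=> rJ; pose D := K * M + K * M.
  apply: (cto_le (B := fun N => K * (2 * e) + D * (4 * r)%:R * N.+1%:R^-1) (HT_ J)).
    move=> N; apply: box_mean_dist => //.
    - by apply: mulr_ge0 => //; apply: mulr_ge0 => //; exact: ltW.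
    - by rewrite /D addr_ge0 ?mulr_ge0.
    move=> m1 m2 m1N m2N.
    have ub : uniq (Bx J (box N.+1 m1 m2)) by apply: Bx_uniq; exact: box_uniq.
    case: ifPn => [_|].
      by apply: (le_trans (normcB _ _)); apply: lerD; apply: sum_bound => //; exact: fset_uniq.
    rewrite !negb_or -!leqNgt => /andP[/andP[g1 g2] /andP[g3 g4]].
    apply: sum_dist => //.
    by move=> i iA; exact: (Hr J N.+1 m1 m2).
  rewrite -[X in _ --> X]addr0; apply: cvgD; first exact: cvg_cst.
  rewrite -[X in _ --> X](mulr0 (D * (4 * r)%:R)); apply: cvgM; first exact: cvg_cst.
  exact: cvg_harmonic.
apply: (cto_le (u := fun n => T_ (n + r)%N) (B := fun=> K * (2 * e))).
- by move: HT; rewrite /cto -(cvg_shiftn r).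
- by move=> n; apply: step; exact: leq_addl.
- exact: cvg_cst.
Qed.

End UnorderedSum.

(** * Summability over positions, scales and directions *)

Section RateSums.
Context {R : realType}.

(** A discrete primitive: [t / (1 + |t|)] is bounded by 1 and its unit increments dominate a quarter
    of [rho1]. The excluded gap between -1 and 0 contains no integer. *)
Lemma rho1_telescope (t : R) : 0 <= t \/ t <= -1 ->
  rho1 t <= 4 * ((t + 1) / (1 + `|t + 1|) - t / (1 + `|t|)).
Proof.
move=> H; rewrite /rho1; have q0 : 0 < 1 + t ^+ 2 by rewrite ltr_pwDl ?sqr_ge0.
case: H => ht.
  rewrite !ger0_norm//; last by lra.
  have -> : 4 * ((t + 1) / (1 + (t + 1)) - t / (1 + t)) = 4 / ((t + 1) * (t + 2)).
    by field; apply/andP; split; rewrite gt_eqF//; lra.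
  have p0 : 0 < (t + 1) * (t + 2) by rewrite mulr_gt0//; lra.
  rewrite ler_pdivlMr// mulrC ler_pdivrMr//.
  have tt : 0 <= t * t by rewrite -expr2 sqr_ge0.
  have : 0 <= (t - 1) ^+ 2 by exact: sqr_ge0.
  rewrite sqrrB expr1n expr2 => h.
  have -> : (t + 1) * (t + 2) = t * t + 3 * t + 2 by ring.
  by lra.
have [t1 t2] : `|t + 1| = - (t + 1) /\ `|t| = - t by split; rewrite ler0_norm//; lra.
rewrite t1 t2.
have -> : 4 * ((t + 1) / (1 + - (t + 1)) - t / (1 + - t)) = 4 / (t * (t - 1)).
  have n1 : t != 0 by rewrite lt_eqF//; lra.
  have n2 : t - 1 != 0 by rewrite lt_eqF//; lra.
  have -> : 1 + - (t + 1) = - t by ring.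
  have -> : 1 + - t = - (t - 1) by ring.
  by field; rewrite n1 n2.
have p0 : 0 < t * (t - 1) by rewrite nmulr_rgt0; lra.
rewrite ler_pdivlMr// mulrC ler_pdivrMr//.
have := sqr_ge0 (t + 1); rewrite sqrrD expr1n expr2 => h.
have -> : t * (t - 1) = t * t - t by ring.
have : 0 <= t * t by rewrite -expr2 sqr_ge0.
by lra.
Qed.

Lemma rho1_sum N m : \sum_(n <- iota 0 N) rho1 (n%:R - m%:R : R) <= 8.
Proof.
pose A (t : R) := t / (1 + `|t|).
have A1 t : `|A t| <= 1.
  have h0 : 0 < 1 + `|t| by rewrite ltr_pwDl.
  by rewrite normrM normfV (ger0_norm (ltW h0)) ler_pdivrMr// mul1r lerDr.
have H : \sum_(n <- iota 0 N) rho1 (n%:R - m%:R : R) <= 4 * (A (N%:R - m%:R) - A (- m%:R)).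
  elim: N => [|N IH]; first by rewrite big_nil sub0r subrr mulr0.
  rewrite -[N.+1]addn1 iotaD big_cat /= big_seq1 add0n.
  have zz : 0 <= N%:R - m%:R :> R \/ N%:R - m%:R <= -1 :> R.
    have [h|h] := leqP m N; first by left; rewrite subr_ge0 ler_nat.
    right; have : N.+1%:R <= m%:R :> R by rewrite ler_nat.
    by rewrite -natr1; lra.
  have := rho1_telescope zz; rewrite -!/(A _) natrD.
  have -> : N%:R - m%:R + 1 = N%:R + 1 - m%:R :> R by ring.
  by lra.
apply: (le_trans H).
by have := A1 (N%:R - m%:R); have := A1 (- m%:R); rewrite !ler_norml => /andP[? ?] /andP[? ?]; lra.
Qed.

Lemma box_rho N m1 m2 : \sum_(k <- box N m1 m2) rho (zvec k : R * R) <= 64.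
Proof.
rewrite /box big_allpairs_dep /=.
have E n1 : \sum_(n2 <- iota 0 N) rho (zvec (Posz n1 - Posz m1, Posz n2 - Posz m2) : R * R) =
    rho1 (n1%:R - m1%:R) * \sum_(n2 <- iota 0 N) rho1 (n2%:R - m2%:R).
  by rewrite mulr_sumr; apply: eq_bigr => n2 _; rewrite /rho /= !rmorphB /= -!pmulrn.
rewrite (eq_bigr _ (fun n1 _ => E n1)) -mulr_suml.
have -> : 64 = 8 * 8 :> R by ring.
by apply: ler_pM; rewrite ?rho1_sum// sumr_ge0// => n _; rewrite ltW// rho1_gt0.
Qed.

(** A summable weight for scale and direction. As [j] and [|l|] are at most [2 ^ j], the available
    factor [(2 ^ j) ^- 4] is bounded by a multiple of it in [level_lower]. *)
Definition level (p : nat * int) : R := rho1 p.1%:R * rho1 p.2%:~R.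

Lemma level_gt0 p : 0 < level p.
Proof. by rewrite mulr_gt0 ?rho1_gt0. Qed.

Lemma level_sum J : \sum_(p <- slope_pairs J) level p <= 64.
Proof.
rewrite /slope_pairs big_allpairs_dep /= /level /=.
apply: (@le_trans _ _ (\sum_(j <- iota 0 J) rho1 (j%:R - 0%:R) * 8 :> R)).
  apply: ler_sum => j _; rewrite -mulr_sumr subr0; apply: ler_wpM2l; first exact/ltW/rho1_gt0.
  rewrite /slopes big_map.
  rewrite (eq_bigr (fun n => rho1 (n%:R - (2 ^ j)%:R))); first exact: rho1_sum.
  by move=> n _; rewrite rmorphB /= -!pmulrn.
rewrite -mulr_suml; have := rho1_sum J 0; lra.
Qed.

Lemma level_lower j l : `|l| <= 2 ^+ j -> (2 ^+ j) ^- 4 <= 4 * level (j, l).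
Proof.
move=> lj; have lX := @slope_bound R _ _ lj.
set X : R := 2 ^+ j in lX *.
have X1 : 1 <= X by rewrite exprn_ege1// ler1n.
have jX : j%:R <= X.
  by rewrite /X -natrX ler_nat ltnW// ltn_expl.
have X0 : 0 < X by lra.
have sq (t : R) : `|t| <= X -> 1 + t ^+ 2 <= 2 * X ^+ 2.
  move=> h; have : t ^+ 2 <= X ^+ 2.
    by rewrite -[t ^+ 2]real_normK ?num_real// lerXn2r// nnegrE ltW.
  have : 1 <= X ^+ 2 by rewrite exprn_ege1.
  lra.
rewrite /level /rho1 /= -invfM ler_pdivlMr; last by rewrite mulr_gt0// ltr_pwDl ?sqr_ge0.
rewrite mulrC ler_pdivrMr ?exprn_gt0//.
have -> : 4 * X ^+ 4 = (2 * X ^+ 2) * (2 * X ^+ 2) by ring.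
by apply: ler_pM; rewrite ?addr_ge0 ?sqr_ge0//; apply: sq; rewrite ?normr_nat.
Qed.

End RateSums.

Section Subsequences.

Lemma big_insub (T : eqType) (P : pred T) (V : nmodType) (s : seq T) (F : T -> V) :
  \sum_(p <- pmap (insub : T -> option {x | P x}) s) F (val p) = \sum_(x <- s | P x) F x.
Proof.
rewrite -(big_map val xpredT F) pmap_filter; last exact: insubK.
rewrite big_filter; apply: eq_bigl => x; exact: isSome_insub.
Qed.

Lemma ler_sum_sub (R : realType) (T : eqType) (s t : seq T) (F : T -> R) :
  uniq s -> uniq t -> {subset s <= t} -> (forall i, 0 <= F i) ->
  \sum_(i <- s) F i <= \sum_(i <- t) F i.
Proof.
move=> us ut st F0; rewrite [leRHS](bigID (mem s)) /=.
have -> : \sum_(i <- t | i \in s) F i = \sum_(i <- s) F i.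
  rewrite -[LHS]big_filter; apply: perm_big; apply: uniq_perm; rewrite ?filter_uniq// => i.
  by rewrite mem_filter; case: (boolP (i \in s)) => // /st ->.
by rewrite lerDl; apply: sumr_ge0.
Qed.

End Subsequences.

(** * Finite boxes of frame indices *)

Section IndexBoxes.
Context {R : realType}.

Definition interiors J : seq interior_index := pmap insub (slope_pairs J).
Definition boundaries J : seq boundary_index := pmap insub (slope_pairs J).

Definition index_box J (s : seq (int * int)) : seq shearlet_index :=
  [seq inl (inl (inl k)) | k <- s] ++
  [seq inl (inl (inr (p, k))) | p <- interiors J, k <- s] ++
  [seq inl (inr (p, k)) | p <- interiors J, k <- s] ++
  [seq inr (p, k) | p <- boundaries J, k <- s].

Lemma big_index_box (V : nmodType) J s (F : shearlet_index -> V) :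
  \sum_(i <- index_box J s) F i =
  \sum_(k <- s) F (inl (inl (inl k))) +
  (\sum_(p <- interiors J) \sum_(k <- s) F (inl (inl (inr (p, k)))) +
   (\sum_(p <- interiors J) \sum_(k <- s) F (inl (inr (p, k))) +
    \sum_(p <- boundaries J) \sum_(k <- s) F (inr (p, k)))).
Proof. by rewrite /index_box !big_cat big_map !big_allpairs_dep. Qed.

Lemma slope_pairs_uniq J : uniq (slope_pairs J).
Proof.
apply: allpairs_uniq_dep; rewrite ?iota_uniq//.
  by move=> j _; exact: slopes_uniq.
by move=> [j l] [j' l'] _ _ /= [-> ->].
Qed.

Lemma mem_slope_pairs J p : (p.1 < J)%N -> `|p.2| <= 2 ^+ p.1 -> p \in slope_pairs J.
Proof.
move=> pJ pl; apply/allpairsPdep; exists p.1, p.2; split; last by case: p {pJ pl}.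
  by rewrite mem_iota.
by rewrite mem_slopes.
Qed.

Lemma index_box_uniq J s : uniq s -> uniq (index_box J s).
Proof.
move=> us; have ui : uniq (interiors J) by apply: pmap_sub_uniq; exact: slope_pairs_uniq.
have ub : uniq (boundaries J) by apply: pmap_sub_uniq; exact: slope_pairs_uniq.
rewrite /index_box !cat_uniq !allpairs_uniq//; last 3 first.
- by move=> [p k] [p' k'] _ _ /= [-> ->].
- by move=> [p k] [p' k'] _ _ /= [-> ->].
- by move=> [p k] [p' k'] _ _ /= [-> ->].
rewrite map_inj_uniq ?us; last by move=> k k' [].
rewrite /= andbT; apply/and3P; split; apply/hasPn => i.
- rewrite !mem_cat => /or3P[] /allpairsP[[p k] [/= _ _ ->]]; apply/mapP => -[] //.
- rewrite mem_cat => /orP[] /allpairsP[[p k] [/= _ _ ->]]; apply/allpairsP => -[[p' k'] []] //.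
- move=> /allpairsP[[p k] [/= _ _ ->]]; apply/allpairsP => -[[p' k'] []] //.
Qed.

Lemma index_box_exhaust (i : shearlet_index) : exists r, forall J N m1 m2, (r <= J)%N ->
  (r <= m1)%N -> (r <= m2)%N -> (m1 + r <= N)%N -> (m2 + r <= N)%N ->
  i \in index_box J (box N m1 m2).
Proof.
have bx (k : int * int) N m1 m2 r : (absz k.1 + absz k.2 < r)%N ->
    (r <= m1)%N -> (r <= m2)%N -> (m1 + r <= N)%N -> (m2 + r <= N)%N -> k \in box N m1 m2.
  by rewrite mem_box; lia.
rewrite /index_box; case: i => [[[k|[p k]]|[p k]]|[p k]].
- exists (absz k.1 + absz k.2).+1 => J N m1 m2 h1 h2 h3 h4 h5; rewrite !mem_cat map_f//.
  by apply: bx h2 h3 h4 h5.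
- exists ((val p).1 + (absz k.1 + absz k.2)).+1 => J N m1 m2 h1 h2 h3 h4 h5.
  rewrite !mem_cat (_ : _ \in [seq inl (inl (inr (p0, k0))) | p0 <- interiors J, k0 <- _]) ?orbT//.
  apply: allpairs_f; last by apply: bx h2 h3 h4 h5; rewrite ltnS leq_addl.
  rewrite mem_pmap_sub; apply: mem_slope_pairs; last exact/ltW/(valP p).
  by apply: leq_trans h1; rewrite ltnS leq_addr.
- exists ((val p).1 + (absz k.1 + absz k.2)).+1 => J N m1 m2 h1 h2 h3 h4 h5.
  rewrite !mem_cat (_ : _ \in [seq inl (inr (p0, k0)) | p0 <- interiors J, k0 <- _]) ?orbT//.
  apply: allpairs_f; last by apply: bx h2 h3 h4 h5; rewrite ltnS leq_addl.
  rewrite mem_pmap_sub; apply: mem_slope_pairs; last exact/ltW/(valP p).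
  by apply: leq_trans h1; rewrite ltnS leq_addr.
- exists ((val p).1 + (absz k.1 + absz k.2)).+1 => J N m1 m2 h1 h2 h3 h4 h5.
  rewrite !mem_cat (_ : _ \in [seq inr (p0, k0) | p0 <- boundaries J, k0 <- _]) ?orbT//.
  apply: allpairs_f; last by apply: bx h2 h3 h4 h5; rewrite ltnS leq_addl.
  rewrite mem_pmap_sub; apply: mem_slope_pairs; last by rewrite (eqP (valP p)).
  by apply: leq_trans h1; rewrite ltnS leq_addr.
Qed.

Definition index_rate (i : shearlet_index) : R :=
  match i with
  | inl (inl (inl k)) => rho (zvec k)
  | inl (inl (inr (p, k))) => level (val p) * rho (zvec k)
  | inl (inr (p, k)) => level (val p) * rho (zvec k)
  | inr (p, k) => level (val p) * rho (zvec k)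
  end.

Lemma index_rate_ge0 i : 0 <= index_rate i.
Proof.
have h p (x : R * R) : 0 <= level p * rho x by rewrite ltW// mulr_gt0 ?level_gt0 ?rho_gt0.
by case: i => [[[k|[p k]]|[p k]]|[p k]] //=; rewrite ltW ?rho_gt0.
Qed.

(** A finite set of indices lies in a single index box. There the coarse elements contribute at most
    64, the square of the bound 8 for one coordinate, and each of the three shearlet families at
    most 64 times 64. *)
Lemma index_rate_sum (s : seq shearlet_index) : uniq s ->
  \sum_(i <- s) index_rate i <= 64 + 3 * (64 * 64).
Proof.
move=> us; have [r Hr] : exists r, forall J N m1 m2, (r <= J)%N ->
  (r <= m1)%N -> (r <= m2)%N -> (m1 + r <= N)%N -> (m2 + r <= N)%N ->
  {subset s <= index_box J (box N m1 m2)}.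
  elim: s {us} => [|i s [r Hr]]; first by exists 0%N.
  have [q Hq] := index_box_exhaust i; exists (maxn r q) => J N m1 m2 h1 h2 h3 h4 h5 i'.
  by rewrite inE => /predU1P[->|]; [apply: Hq; lia|apply: Hr; lia].
pose b := box (r + r) r r.
have sb : {subset s <= index_box r b} by apply: Hr.
apply: (le_trans (ler_sum_sub us (index_box_uniq r (box_uniq _ _ _)) sb index_rate_ge0)).
rewrite big_index_box /=.
have b64 : \sum_(k <- b) rho (zvec k : R * R) <= 64 := box_rho _ _ _.
have b0 : 0 <= \sum_(k <- b) rho (zvec k : R * R) by apply: sumr_ge0 => k _; exact/ltW/rho_gt0.
have lev (P : pred (nat * int)) : \sum_(p <- pmap (insub : nat * int -> option {x | P x}) (slope_pairs r))
    \sum_(k <- b) level (val p) * rho (zvec k : R * R) <= 64 * 64.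
  rewrite (eq_bigr (fun p => level (val p) * \sum_(k <- b) rho (zvec k : R * R))); last first.
    by move=> p _; rewrite mulr_sumr.
  rewrite -mulr_suml big_insub; apply: ler_pM => //.
    by apply: sumr_ge0 => p _; exact/ltW/level_gt0.
  apply: le_trans (level_sum r); rewrite [leRHS](bigID P) /= lerDl.
  by apply: sumr_ge0 => p _; exact/ltW/level_gt0.
have := lev (fun p : nat * int => `|p.2| < 2 ^+ p.1).
have := lev (fun p : nat * int => `|p.2| == 2 ^+ p.1).
rewrite -/(boundaries r) -/(interiors r) => h1 h2.
by move: b64 h1 h2; lra.
Qed.

End IndexBoxes.

(** * Convergence of the expansion *)

Section InverseSums.
Context {R : realType}.
Local Notation C := (R[i]).
Local Notation normc := (@Normc.normc R).
Local Notation l2 := (@leb2 R).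
Local Notation plane := (measurableTypeR R * measurableTypeR R)%type.

Lemma IFTD K L (f h : plane -> C) x : decay K f -> decay L h ->
  IFT (fun xi => f xi + h xi) x = IFT f x + IFT h x.
Proof.
move=> df dh; rewrite /IFT -cintD; [|exact: decay_cintble (decay_ichar x df)|
  exact: decay_cintble (decay_ichar x dh)].
by congr cint; apply/funext => xi; rewrite mulrDl.
Qed.

Lemma IFT_sum (I : Type) (s : seq I) K (f : I -> plane -> C) x : (forall i, decay K (f i)) ->
  IFT (fun xi => \sum_(i <- s) f i xi) x = \sum_(i <- s) IFT (f i) x.
Proof.
move=> df; rewrite /IFT -cint_sum; last by move=> i; exact: decay_cintble (decay_ichar x (df i)).
by congr cint; apply/funext => xi; rewrite mulr_suml.
Qed.

Lemma decay_sum (I : Type) (s : seq I) K (f : I -> plane -> C) : (forall i, decay K (f i)) ->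
  exists L, decay L (fun xi => \sum_(i <- s) f i xi).
Proof.
move=> df; elim: s => [|i s [L HL]].
  exists 0; split => [|xi]; last by rewrite big_nil Normc.normc0 mul0r.
  by under eq_fun do rewrite big_nil; exact: cmeas_cst.
by exists (K + L); under eq_fun do rewrite big_cons; exact: decayD.
Qed.

Lemma block_decay Ks Ms X w e K (h : plane -> C) : block Ks Ms X w e -> decay K h ->
  decay K (fun xi => h xi * (w xi ^+ 2)%:C).
Proof.
move=> bl dh; have w1 := block_le1 bl.
case: bl => sw k0 k1 lam s u _ _ _ _ _ _ _ /andP[s0 _] _ _ _ _ su _ Fu _ _.
rewrite -[K]mul1r; apply: decayM => //.
  have mw : @cmeas _ _ plane (fun xi => (w xi)%:C).
    rewrite (_ : (fun xi => (w xi)%:C) = fun xi => (s^-1)%:C * FT u xi).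
      by apply: cmeasM; [exact: cmeas_cst|exact: FT_schwartz_cmeas].
    apply/funext => xi; rewrite Fu -rmorphM; congr (_ %:C).
    by rewrite mulKf// gt_eqF.
  rewrite (_ : (fun xi => _) = fun xi => (w xi)%:C * (w xi)%:C); first exact: cmeasM.
  by apply/funext => xi; rewrite expr2 rmorphM.
move=> xi; rewrite normc_real normrX expr_le1//; exact: w1.
Qed.

End InverseSums.

Section FrameLimit.
Context {R : realType}.
Local Notation C := (R[i]).
Local Notation normc := (@Normc.normc R).
Local Notation l2 := (@leb2 R).
Local Notation plane := (measurableTypeR R * measurableTypeR R)%type.
Variables (phihat v : R -> R) (W : R * R -> R).
Variables (Phi : R * R -> C) (psi_h psi_v psi_b : nat -> int -> int * int -> R * R -> C).
Hypotheses (hphi : coarse_window phihat) (hW : radial_window phihat W)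
  (hv : angular_window v) (hpsi : shearlet_system phihat W v Phi psi_h psi_v psi_b).
Local Notation fam := (shearlet_family Phi psi_h psi_v psi_b).

(** Choice turns the constants into functions of the seminorm, uniform in scale and direction and
    valid for the coarse function as well; in this form they can be parameters of [block]. *)
Lemma schwartz_constants : exists (Ks : nat * nat -> nat * nat -> R) (Ms : nat * nat -> nat * nat -> nat),
  (forall a b j l al be s (u : R * R -> C),
    `|al| <= 1 -> `|be| <= 1 -> `|s| <= 1 -> schwartz u ->
    (forall xi, FT u xi = (s * wedge v W al be j l xi)%:C) ->
    forall x, `|x.1 ^+ a.1 * x.2 ^+ a.2| * normc (cderiv b u x) <= Ks a b * (2 ^+ j) ^+ Ms a b) /\
  (forall a b x, `|x.1 ^+ a.1 * x.2 ^+ a.2| * normc (cderiv b Phi x) <= Ks a b).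
Proof.
have [sP _] := shearlet_coarse hpsi.
have H (ab : (nat * nat) * (nat * nat)) : exists KM : R * nat,
  (forall j l al be s (u : R * R -> C),
    `|al| <= 1 -> `|be| <= 1 -> `|s| <= 1 -> schwartz u ->
    (forall xi, FT u xi = (s * wedge v W al be j l xi)%:C) ->
    forall x, `|x.1 ^+ ab.1.1 * x.2 ^+ ab.1.2| * normc (cderiv ab.2 u x) <= KM.1 * (2 ^+ j) ^+ KM.2) /\
  (forall x, `|x.1 ^+ ab.1.1 * x.2 ^+ ab.1.2| * normc (cderiv ab.2 Phi x) <= KM.1).
  have [K [M [K0 HK]]] := wedge_seminorm hphi hW hv ab.1 ab.2.
  have [L HL] := schwartz_bound ab.1 ab.2 sP.
  exists (K + `|L|, M) => /=; split.
    move=> j l al be s u al1 be1 s1 su Fu x.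
    apply: (le_trans (HK j l al be s u al1 be1 s1 su Fu x)).
    by apply: ler_wpM2r; rewrite ?exprn_ge0// lerDl.
  by move=> x; apply: (le_trans (HL x)); rewrite (le_trans (ler_norm L))// lerDr.
have [KM HKM] := boolp.choice H.
exists (fun a b => (KM (a, b)).1), (fun a b => (KM (a, b)).2); split.
  by move=> a b; case: (HKM (a, b)).
by move=> a b; case: (HKM (a, b)).
Qed.

Variables (Ks : nat * nat -> nat * nat -> R) (Ms : nat * nat -> nat * nat -> nat).
Hypothesis wedge_bound : forall a b j l al be s (u : R * R -> C),
  `|al| <= 1 -> `|be| <= 1 -> `|s| <= 1 -> schwartz u ->
  (forall xi, FT u xi = (s * wedge v W al be j l xi)%:C) ->
  forall x, `|x.1 ^+ a.1 * x.2 ^+ a.2| * normc (cderiv b u x) <= Ks a b * (2 ^+ j) ^+ Ms a b.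
Hypothesis coarse_bound : forall a b x,
  `|x.1 ^+ a.1 * x.2 ^+ a.2| * normc (cderiv b Phi x) <= Ks a b.

Let bc := block_coarse hphi hpsi Ms coarse_bound.
Let bh (p : interior_index) := block_h hphi hW hv hpsi wedge_bound (valP p).
Let bv (p : interior_index) := block_v hphi hW hv hpsi wedge_bound (valP p).
Let bb (p : boundary_index) := block_b hphi hW hv hpsi wedge_bound (eqP (valP p)).

Lemma family_schwartz i : schwartz (fam i).
Proof.
case: i => [[[k|[p k]]|[p k]]|[p k]].
- exact: (block_schwartz bc k).
- exact: (block_schwartz (bh p) k).
- exact: (block_schwartz (bv p) k).
- exact: (block_schwartz (bb p) k).
Qed.

Lemma family_rate g a b : schwartz g -> exists2 K : R, 0 <= K & forall i x,
  normc (coef g (fam i)) * (`|x.1 ^+ a.1 * x.2 ^+ a.2| * normc (cderiv b (fam i) x)) <=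
  K * index_rate i.
Proof.
move=> sg; have [K K0 HK] := block_coef_seminorm Ks Ms a b sg.
exists (K * 4) => [|i x]; first exact: mulr_ge0.
have lev (p : nat * int) (k : int * int) t : `|p.2| <= 2 ^+ p.1 ->
    t <= K * (2 ^+ p.1) ^- 4 * rho (zvec k) -> t <= K * 4 * (level p * rho (zvec k)).
  move=> pl /le_trans; apply; rewrite mulrA; apply: ler_wpM2r; first exact/ltW/rho_gt0.
  by rewrite -[leRHS]mulrA; apply: ler_wpM2l => //; case: p pl => j l pl; exact: level_lower.
case: i => [[[k|[p k]]|[p k]]|[p k]] /=.
- apply: (le_trans (HK 1 _ _ bc k x)); rewrite expr1n invr1 mulr1.
  apply: ler_wpM2r; first exact/ltW/rho_gt0.
  by rewrite ler_peMr// ler1n.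
- by apply: lev (HK _ _ _ (bh p) k x); exact: ltW (valP p).
- by apply: lev (HK _ _ _ (bv p) k x); exact: ltW (valP p).
- by apply: lev (HK _ _ _ (bb p) k x); rewrite (eqP (valP p)).
Qed.

Lemma family_box_mean g b x J : schwartz g ->
  cto (fun N => box_mean N.+1 (fun s => \sum_(i <- index_box J s) coef g (fam i) * cderiv b (fam i) x))
    (IFT (fun xi => fpow b xi * (FT g xi * (Phihat phihat ((2 ^- (2 * J) : R) *: xi) ^+ 2)%:C)) x).
Proof.
move=> sg; have [K dg] := FT_fpow_decay b sg.
pose G (w : R * R -> R) (xi : plane) : C := fpow b xi * (FT g xi * (w xi ^+ 2)%:C).
have dG w X e : block Ks Ms X w e -> decay K (G w).
  move=> bl; have := block_decay bl dg; congr decay; apply/funext => xi.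
  by rewrite /G mulrA.
pose w1 (p : nat * int) := wedge v W 1 0 p.1 p.2.
pose w2 (p : nat * int) := wedge v W 0 1 p.1 p.2.
pose w3 (p : nat * int) := wedge v W 1 1 p.1 p.2.
have lim : IFT (fun xi => fpow b xi * (FT g xi * (Phihat phihat ((2 ^- (2 * J) : R) *: xi) ^+ 2)%:C)) x =
    IFT (G (Phihat phihat)) x + (\sum_(p <- interiors J) IFT (G (w1 (val p))) x +
    (\sum_(p <- interiors J) IFT (G (w2 (val p))) x +
     \sum_(p <- boundaries J) IFT (G (w3 (val p))) x)).
  have d1 (p : interior_index) : decay K (G (w1 (val p))) := dG _ _ _ (bh p).
  have d2 (p : interior_index) : decay K (G (w2 (val p))) := dG _ _ _ (bv p).
  have d3 (p : boundary_index) : decay K (G (w3 (val p))) := dG _ _ _ (bb p).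
  have [L1 D1] := decay_sum (interiors J) d1.
  have [L2 D2] := decay_sum (interiors J) d2.
  have [L3 D3] := decay_sum (boundaries J) d3.
  rewrite -(IFT_sum (interiors J) x d1) -(IFT_sum (interiors J) x d2) -(IFT_sum (boundaries J) x d3).
  rewrite -(IFTD x D2 D3) -(IFTD x D1 (decayD D2 D3)) -(IFTD x (dG _ _ _ bc) (decayD D1 (decayD D2 D3))).
  congr IFT; apply/funext => xi; rewrite -(window_partition hphi hW hv J xi).
  rewrite (big_insub (fun p : nat * int => `|p.2| < 2 ^+ p.1) _ (fun p => G (w1 p) xi)).
  rewrite (big_insub (fun p : nat * int => `|p.2| < 2 ^+ p.1) _ (fun p => G (w2 p) xi)).
  rewrite (big_insub (fun p : nat * int => `|p.2| == 2 ^+ p.1) _ (fun p => G (w3 p) xi)).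
  by rewrite /G -!mulr_sumr -!mulrDr -!rmorph_sum -!rmorphD /= big_split /= -!addrA.
rewrite lim.
have E N : box_mean N (fun s => \sum_(i <- index_box J s) coef g (fam i) * cderiv b (fam i) x) =
  box_mean N (fun s => \sum_(k <- s) coef g (translate Phi k) * cderiv b (translate Phi k) x) +
  (\sum_(p <- interiors J) box_mean N (fun s => \sum_(k <- s)
     coef g (psi_h (val p).1 (val p).2 k) * cderiv b (psi_h (val p).1 (val p).2 k) x) +
  (\sum_(p <- interiors J) box_mean N (fun s => \sum_(k <- s)
     coef g (psi_v (val p).1 (val p).2 k) * cderiv b (psi_v (val p).1 (val p).2 k) x) +
   \sum_(p <- boundaries J) box_mean N (fun s => \sum_(k <- s)
     coef g (psi_b (val p).1 (val p).2 k) * cderiv b (psi_b (val p).1 (val p).2 k) x))).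
  rewrite -!box_mean_sum -!box_meanD; congr box_mean; apply/funext => s.
  exact: big_index_box.
rewrite /cto; under eq_fun do rewrite E.
apply: ctoD; first exact: block_mean sg bc.
apply: ctoD; first by apply: cto_sum => p; exact: block_mean sg (bh p).
by apply: ctoD; apply: cto_sum => p; [exact: block_mean sg (bv p)|exact: block_mean sg (bb p)].
Qed.

Lemma window_exhaust g b x : schwartz g ->
  cto (fun J => IFT (fun xi => fpow b xi * (FT g xi * (Phihat phihat ((2 ^- (2 * J) : R) *: xi) ^+ 2)%:C)) x)
    (cderiv b g x).
Proof.
move=> sg; have [K [mK HK]] := FT_fpow_decay b sg.
rewrite schwartz_inversion// /cto /IFT.
have mphi : measurable_fun setT (phihat : measurableTypeR R -> R).
  apply: continuous_measurable_fun => t.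
  exact: is_derive_continuous (smooth1_jet (coarse_smooth hphi) 0%N t).
have P01 xi : `|Phihat phihat xi ^+ 2| <= 1.
  by have /andP[h0 h1] := Phihat_01 hphi xi; rewrite ger0_norm ?sqr_ge0// expr_le1.
have me : @cmeas _ _ plane (fun xi => expi (2 * pi * dot xi x)).
  apply: cmeas_expi; rewrite (_ : (fun xi => _) = fun xi => 2 * pi * dot x xi).
    by apply: measurable_funM => //; exact: measurable_dot.
  by apply/funext => xi; rewrite dotC.
apply: (@cint_dct _ _ _ l2
  (fun J xi => fpow b xi * (FT g xi * (Phihat phihat ((2 ^- (2 * J) : R) *: xi) ^+ 2)%:C) * expi (2 * pi * dot xi x))
  (fun xi => fpow b xi * FT g xi * expi (2 * pi * dot xi x)) (fun xi => K * rho xi)).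
- move=> J; apply: cmeasM => //.
  rewrite (_ : (fun xi => _) = fun xi => (fpow b xi * FT g xi) *
     (Phihat phihat ((2 ^- (2 * J) : R) *: xi) ^+ 2)%:C); last by apply/funext => xi; rewrite mulrA.
  apply: cmeasM => //; apply: cmeas_real; apply: measurable_funX.
  by apply: measurable_funM; apply: (measurableT_comp mphi); apply: measurable_funM.
- exact: cmeasM.
- exact: integrable_Krho.
- move=> J xi; rewrite Normc.normcM normc_expi mulr1 mulrA Normc.normcM normc_real.
  by rewrite (le_trans _ (HK xi))// ler_piMr ?normc_ge0.
move=> xi; apply: (@cvg_trans _ ((fun=> 0 : R) @ \oo)); last exact: cvg_cst.
apply: near_eq_cvg; near=> J.
(* For large [J] the dilated point lies in the square on which the window is 1, so the sequence is
   eventually constant. *)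
suff -> : Phihat phihat ((2 ^- (2 * J) : R) *: xi) = 1.
  by rewrite expr1n [_%:C]/= mulr1 subrr Normc.normc0.
have J1 : 16 * (`|xi.1| + `|xi.2|) <= 2 ^+ (2 * J).
  apply: (@le_trans _ _ J%:R); first by near: J; exact: nbhs_infty_ger.
  rewrite -natrX ler_nat (leq_trans (ltnW (ltn_expl J (ltnSn 1))))// leq_exp2l//; lia.
have p0 : 0 < 2 ^+ (2 * J) :> R by rewrite exprn_gt0.
have one (t : R) : `|t| <= `|xi.1| + `|xi.2| -> phihat (2 ^- (2 * J) * t) = 1.
  move=> ht; apply: (coarse_one hphi); rewrite in_itv /= -ler_norml normrM.
  rewrite ger0_norm ?invr_ge0 ?(ltW p0)// ler_pdivrMl//; lra.
by rewrite /Phihat /= !one ?mulr1// ?lerDl ?lerDr.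
Unshelve. all: end_near. Qed.

Definition partial_sum (g : R * R -> C) (A : {fset shearlet_index}) (x : R * R) : C :=
  \sum_(i <- A) coef g (fam i) * fam i x.

Lemma partial_sum_schwartz g A : schwartz g -> schwartz (partial_sum g A).
Proof. by move=> sg; exact: (schwartz_sum _ _ sg family_schwartz). Qed.

(** Neither [A0] nor the rates depend on [x], so the estimate of the unordered sum at each point is
    uniform and bounds the seminorm. *)
Lemma partial_sum_seminorm g a b (d : R) : schwartz g -> 0 < d ->
  \forall A \near (@totally shearlet_index),
    (seminorm a b (fun x => partial_sum g A x - g x)%R < d%:E)%E.
Proof.
move=> sg d0; have [K K0 HK] := family_rate a b sg.
(* The distance is controlled by [2 K e], which is at most [d / 2]; the added 1 allows for
   [K = 0]. *)
pose e := d / (4 * (K + 1)).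
have e0 : 0 < e by rewrite divr_gt0// mulr_gt0// ltr_wpDl.
have [A0 HA0] := rate_tail (@index_rate_sum R) e0.
exists A0 => // A /fsubsetP A0A.
apply: (@le_lt_trans _ _ (K * (2 * e))%:E); last first.
  rewrite lte_fin /e; have k1 : 0 < 4 * (K + 1) by rewrite mulr_gt0// ltr_wpDl.
  rewrite !mulrA ltr_pdivrMr//.
  have : K * d <= (K + 1) * d by rewrite ler_wpM2r ?(ltW d0)// lerDl.
  have : 0 < (K + 1) * d by rewrite mulr_gt0// ltr_wpDl.
  lra.
apply: seminorm_le => x.
have sP := partial_sum_schwartz A sg.
have -> : cderiv b (fun x => partial_sum g A x - g x) x =
    \sum_(i <- A) coef g (fam i) * cderiv b (fam i) x - cderiv b g x.
  have [g1 g2 _] := sg; have [p1 p2 _] := sP.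
  have := cderiv_lin (-1) b g1 g2 p1 p2; rewrite (cderiv_sum _ _ b sg family_schwartz).
  rewrite (_ : (fun x => -1 * g x + _) = fun x => partial_sum g A x - g x); last first.
    by apply/funext => z; rewrite mulN1r addrC.
  by move=> ->; rewrite mulN1r addrC.
pose z : C := (x.1 ^+ a.1 * x.2 ^+ a.2)%:C.
have nz : normc z = `|x.1 ^+ a.1 * x.2 ^+ a.2| := normc_real _.
rewrite -nz -Normc.normcM mulrBr mulr_sumr.
have zc u l : cto u l -> cto (fun n => z * u n) (z * l).
  move=> ul; have H : normc z * normc (u n - l) @[n --> \oo] --> normc z * 0.
    by apply: cvgM => //; exact: cvg_cst.
  have E : (fun n => normc (z * u n - z * l)) = fun n => normc z * normc (u n - l).
    by apply/funext => n; rewrite -mulrBr Normc.normcM.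
  by rewrite /cto E; rewrite mulr0 in H; exact: H.
have aK i : normc (z * (coef g (fam i) * cderiv b (fam i) x)) <= K * index_rate i.
  by rewrite Normc.normcM nz Normc.normcM mulrCA HK.
apply: (unordered_limit (@index_rate_sum R) index_box_uniq index_box_exhaust e0 HA0 K0 aK
  (T_ := fun J => z * IFT (fun xi => fpow b xi * (FT g xi * (Phihat phihat ((2 ^- (2 * J) : R) *: xi) ^+ 2)%:C)) x)) => //.
- move=> J; have := zc _ _ (family_box_mean b x J sg); congr cto; apply/funext => N.
  rewrite /box_mean mulrCA; congr (_ * _); rewrite mulr_sumr; apply: eq_bigr => m1 _.
  by rewrite mulr_sumr; apply: eq_bigr => m2 _; rewrite mulr_sumr.
- by apply: zc; exact: window_exhaust.
Qed.

End FrameLimit.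

(** * Transposition to tempered distributions *)

Section Distribution.
Context {R : realType}.
Local Notation C := (R[i]).
Local Notation normc := (@Normc.normc R).
Local Notation l2 := (@leb2 R).
Variables (f : (R * R -> C) -> C).
Hypothesis hf : tempered f.

Lemma tempered_sum (I : Type) (s : seq I) (c : I -> C) (e : I -> R * R -> C)
    (g : R * R -> C) : schwartz g ->
  (forall i, schwartz (e i)) ->
  f (fun x => \sum_(i <- s) c i * e i x) = \sum_(i <- s) c i * f (e i).
Proof.
move=> sg se; elim: s => [|i s IH].
  rewrite big_nil; have := tempered_linear hf (-1) sg sg.
  rewrite mulN1r addNr => f0; rewrite -[RHS]f0; congr f; apply/funext => x.
  by rewrite big_nil mulN1r addNr.
rewrite big_cons -IH -(tempered_linear hf)//; last exact: schwartz_sum sg se.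
by congr f; apply/funext => x; rewrite big_cons.
Qed.

(** The integral of [e i] against the conjugate of [g] is the conjugate of a coefficient of [g];
    linearity of [f] then collects the sum into its value on the conjugate of the partial expansion
    of [g]. *)
Lemma pairing_frame_sum (I : choiceType) (e : I -> R * R -> C) (A : {fset I})
    (g : R * R -> C) : schwartz g ->
  (forall i, schwartz (e i)) ->
  pairing (regular (frame_sum e f A)) g = f (fun x => conjc (\sum_(i <- A) coef g (e i) * e i x)).
Proof.
move=> sg se; have sc i : schwartz (fun x => conjc (e i x)) := schwartz_conj (se i).
have ie i : cintble l2 (fun x => e i x * conjc (g x)).
  have [K _ de] := cderiv_decay (0%N, 0%N) (se i); rewrite cderiv00 in de.
  have [L _ dg] := cderiv_decay (0%N, 0%N) sg; rewrite cderiv00 in dg.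
  apply: (@decay_cintble _ (L * K)); apply: decayM => //.
    by apply: cmeas_conj; exact: schwartz_cmeas.
  by move=> x; rewrite normc_conj; exact: decay_bound.
transitivity (cint l2 (fun x => \sum_(i <- A) pairing f (e i) * (e i x * conjc (g x)))).
  congr cint; apply/funext => x; rewrite /frame_sum mulr_suml.
  by apply: eq_bigr => i _; rewrite mulrA.
rewrite cint_sum; last by move=> i; exact: cintbleZ.
transitivity (\sum_(i <- A) conjc (coef g (e i)) * f (fun x => conjc (e i x))).
  apply: eq_bigr => i _; rewrite cintZ// mulrC; congr (_ * _).
  rewrite /coef -cint_conj.
    congr cint; apply/funext => x; rewrite [RHS]rmorphM mulrC; congr (_ * _).
    by rewrite [RHS]conjcK.
  have := ie i; rewrite -[X in cintble _ X]/(fun x => _) => ii.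
  have : cintble l2 (fun x => conjc (e i x * conjc (g x))).
    case: ii => i1 i2; split.
      by under eq_fun do rewrite ReJc.
    under eq_fun do rewrite ImJc EFinN; exact: integrableN.
  congr cintble; apply/funext => x; rewrite [LHS]rmorphM mulrC; congr (_ * _).
  exact: conjcK.
rewrite -(tempered_sum _ _ sg sc); congr f; apply/funext => x.
rewrite [RHS]rmorph_sum; apply: eq_bigr => i _; exact/esym/rmorphM.
Qed.

Lemma seminorm_conj a b (h : R * R -> C) : schwartz h ->
  seminorm a b (fun x => conjc (h x)) = seminorm a b h.
Proof.
move=> sh; rewrite /seminorm; congr ereal_sup; apply: eq_imagel => x _.
by rewrite cderiv_conj// normc_conj.
Qed.

Lemma schwartzB (h g : R * R -> C) : schwartz h -> schwartz g ->
  schwartz (fun x => h x - g x).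
Proof.
move=> sh sg; have := schwartz_lin (-1) sg sh; congr schwartz; apply/funext => x.
by rewrite mulN1r addrC.
Qed.

End Distribution.

Theorem theorem5p2p3 (R : realType) (phihat v : R -> R) (W : R * R -> R)
    (Phi : R * R -> R[i])
    (psi_h psi_v psi_b : nat -> int -> int * int -> R * R -> R[i])
    (hphi : coarse_window phihat)
    (hW : radial_window phihat W)
    (hv : angular_window v)
    (hpsi : shearlet_system phihat W v Phi psi_h psi_v psi_b)
    (f : (R * R -> R[i]) -> R[i])
    (hf : tempered f) :
  cvg_tempered (@totally shearlet_index)
    (fun A : {fset shearlet_index} =>
       regular (frame_sum (shearlet_family Phi psi_h psi_v psi_b) f A))
    f.
Proof.
move=> g sg; have [Ks [Ms [wb cb]]] := schwartz_constants hphi hW hv hpsi.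
have sF := family_schwartz hphi hW hv hpsi wb cb.
have TP : ProperFilter (@totally shearlet_index) := totally_filter.
(* In the order on the complex numbers a positive element is real. *)
apply/cvgrPdist_lt => -[er ei]; rewrite ltcE /= => /andP[/eqP -> e0].
have [N [d d0 H]] := tempered_continuous hf (schwartz_conj sg) e0.
(* Continuity at the conjugate of [g] involves finitely many seminorms; indexing them by a finite
   type makes the eventual bounds simultaneous. *)
have near_small : \forall A \near (@totally shearlet_index),
    forall q : ('I_N.+1 * 'I_N.+1) * ('I_N.+1 * 'I_N.+1),
    (seminorm (val q.1.1, val q.1.2) (val q.2.1, val q.2.2)
      (fun x => partial_sum Phi psi_h psi_v psi_b g A x - g x)%R < d%:E)%E.
  by apply: filter_forall => q; exact: (partial_sum_seminorm hphi hW hv hpsi wb cb).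
apply: filterS near_small => A small; rewrite pairing_frame_sum//.
rewrite -opprB normrN normc_def -normcE ltcR; apply: H.
  exact: (schwartz_conj (partial_sum_schwartz hphi hW hv hpsi wb cb A sg)).
move=> a b /andP[a1 a2] /andP[b1 b2].
have := small ((inord a.1, inord a.2), (inord b.1, inord b.2)); rewrite /= !inordK//.
case: a b a1 a2 b1 b2 => [a1 a2] [b1 b2] /= *.
rewrite (_ : (fun x => _) = fun x => conjc (partial_sum Phi psi_h psi_v psi_b g A x - g x)).
  by rewrite seminorm_conj//; apply: schwartzB => //; exact: (partial_sum_schwartz hphi hW hv hpsi wb cb A sg).
by apply/funext => x; exact/esym/rmorphB.
Qed.
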